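(* Let $X=\{f=0\}$ be a quasi-ordinary surface singularity with $g>1$ characteristic exponents and such that $\lambda_1=(\frac1{n_1},\frac1{n_1})$. Then $lct(X,\mathbb A^3)$ cannot be contributed by monomial valuations in any variables; that is, there is no regular system of parameters $(u_1,u_2,u_3)$ of $\mathbb C[[x_1,x_2,z]]$ and no nonzero weight vector $w\in\mathbb Z_{\ge0}^3$ such that the monomial valuation $v_w$ in the variables $(u_1,u_2,u_3)$ satisfies $lct(X,\mathbb A^3)=\frac{w_1+w_2+w_3}{v_w(f)}$.
   Context: Let $f\in\mathbb C\{x_1,x_2\}[z]$ be an irreducible quasi-ordinary Weierstrass polynomial of degree $n$ in $z$ (its $z$-discriminant is $x_1^{\delta_1}x_2^{\delta_2}$ times a unit), defining the germ $(X,0)\subset(\mathbb C^3,0)$. A root $\zeta=\sum\beta_\lambda x^\lambda\in\mathbb C\{x_1^{1/n},x_2^{1/n}\}$ of $f$ has characteristic exponents $0\neq\lambda_1\le\dots\le\lambda_g$ in $\mathbb Q^2_{\ge0}$ ($\le$ coordinatewise): with $M_0=\mathbb Z^2$, $M_j=M_{j-1}+\mathbb Z\lambda_j$, $\lambda_0=0$, $\lambda_{g+1}=\infty$, one has $\beta_{\lambda_i}\ne0$; $\beta_\lambda\neq0$ implies $\lambda\in M_j$ for the unique $j$ with $\lambda_j\le\lambda$, $\lambda_{j+1}\not\le\lambda$; and $\lambda_j\notin M_{j-1}$. Put $n_j=[M_j:M_{j-1}]>1$. Standing assumptions: $(\lambda_1^{(1)},\dots,\lambda_g^{(1)})\ge_{lex}(\lambda_1^{(2)},\dots,\lambda_g^{(2)})$,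 and $\zeta$ is normalized, i.e. $\lambda_1$ is not of the form $(a,0)$ with $a<1$. $lct(X,\mathbb A^3)$ is the log canonical threshold of the pair at the origin. It is contributed by a divisorial valuation $v$ if it equals (log discrepancy of $v$)$/v(f)$. The monomial valuation $v_w$ in variables $(u_1,u_2,u_3)$ with weights $w$ is $v_w(\sum c_\alpha u^\alpha)=\min\{\langle w,\alpha\rangle:c_\alpha\neq0\}$; its log discrepancy (for primitive $w$, and in general by homogeneity) is $w_1+w_2+w_3$. *)

(* Defs.v *)
From HB Require Import structures.
From mathcomp Require Import all_boot all_order all_algebra.
From mathcomp Require Import boolp classical_sets reals complex.
Set Implicit Arguments.
Unset Strict Implicit.
Unset Printing Implicit Defensive.
Import Order.TTheory GRing.Theory Num.Theory.
Local Open Scope ring_scope.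

Notation midx k := {ffun 'I_k -> nat}.

Definition mtdeg k (a : midx k) : nat := (\sum_i a i)%N.

Definition mle k (a b : midx k) : bool := [forall i, (a i <= b i)%N].

Definition msub k (a b : midx k) : midx k := [ffun i => (a i - b i)%N].

Definition munit k (i : 'I_k) : midx k := [ffun j => (j == i) : nat].

Definition midx_lt k (d : nat) : seq (midx k) :=
  [seq a <- [seq [ffun i => val (b i)] | b : {ffun 'I_k -> 'I_d}]
  | (mtdeg a < d)%N].

Definition mbelow k (a : midx k) : seq (midx k) :=
  [seq b <- midx_lt k (mtdeg a).+1 | mle b a].

Section MultiIndex.
Variable k : nat.
Implicit Types a b c : midx k.

Lemma leq_mtdeg a i : (a i <= mtdeg a)%N.
Proof. by rewrite /mtdeg (bigD1 i) //= leq_addr. Qed.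

Lemma mem_midx_lt d a : (a \in midx_lt k d) = (mtdeg a < d)%N.
Proof.
rewrite mem_filter andb_idr // => lt_ad; apply/mapP.
exists [ffun i => Ordinal (leq_ltn_trans (leq_mtdeg a i) lt_ad)].
  by rewrite mem_enum.
by apply/ffunP => i; rewrite !ffunE.
Qed.

Lemma midx_lt_uniq d : uniq (midx_lt k d).
Proof.
rewrite filter_uniq // map_inj_uniq ?enum_uniq // => b1 b2 /ffunP eqb.
by apply/ffunP => i; apply: val_inj; have := eqb i; rewrite !ffunE.
Qed.

Lemma mbelow_uniq a : uniq (mbelow a).
Proof. by rewrite filter_uniq // midx_lt_uniq. Qed.

Lemma mem_mbelow a b : (b \in mbelow a) = mle b a.
Proof.
rewrite mem_filter andb_idr // => /forallP le_ba.
by rewrite mem_midx_lt ltnS; apply: leq_sum.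
Qed.

Lemma mleP a b : reflect (forall i, a i <= b i)%N (mle a b).
Proof. exact: forallP. Qed.

Lemma maddE a b i : (a + b) i = (a i + b i)%N.
Proof. by rewrite ffunE. Qed.

Lemma msubE a b i : msub a b i = (a i - b i)%N.
Proof. by rewrite ffunE. Qed.

End MultiIndex.

Definition mpser (k : nat) (A : Type) : Type := midx k -> A.

HB.instance Definition _ k A := gen_eqMixin (mpser k A).
HB.instance Definition _ k A := gen_choiceMixin (mpser k A).

Section PowerSeriesRing.
Variables (k : nat) (A : comNzRingType).
Implicit Types f g h : mpser k A.

Definition mpser_zero : mpser k A := fun=> 0.
Definition mpser_opp f : mpser k A := fun a => - f a.
Definition mpser_add f g : mpser k A := fun a => f a + g a.
Definition mpser_one : mpser k A := fun a => (a == 0)%:R.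
Definition mpser_mul f g : mpser k A :=
  fun a => \sum_(b <- mbelow a) f b * g (msub a b).

Fact mpser_addA : associative mpser_add.
Proof. by move=> f g h; apply/funext => a; apply: addrA. Qed.
Fact mpser_addC : commutative mpser_add.
Proof. by move=> f g; apply/funext => a; apply: addrC. Qed.
Fact mpser_add0 : left_id mpser_zero mpser_add.
Proof. by move=> f; apply/funext => a; apply: add0r. Qed.
Fact mpser_addN : left_inverse mpser_zero mpser_opp mpser_add.
Proof. by move=> f; apply/funext => a; apply: addNr. Qed.

HB.instance Definition _ := GRing.isZmodule.Build (mpser k A)
  mpser_addA mpser_addC mpser_add0 mpser_addN.

Fact mpser_mulC : commutative mpser_mul.
Proof.
move=> f g; apply/funext => a; rewrite /mpser_mul.
have msubK b : mle b a -> msub a (msub a b) = b.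
  by move/mleP=> le_ba; apply/ffunP => i; rewrite !msubE subKn.
rewrite (perm_big [seq msub a b | b <- mbelow a]) /=; last first.
  apply: uniq_perm; rewrite ?mbelow_uniq //.
    rewrite map_inj_in_uniq ?mbelow_uniq // => b c.
    by rewrite !mem_mbelow => /msubK {2}<- /msubK {2}<- ->.
  move=> b; rewrite mem_mbelow; apply/idP/mapP => [le_ba | [c _ ->]].
    exists (msub a b); last by rewrite msubK.
    by rewrite mem_mbelow; apply/mleP => i; rewrite msubE leq_subr.
  by apply/mleP => i; rewrite msubE leq_subr.
rewrite big_map; apply: eq_big_seq => b; rewrite mem_mbelow => le_ba.
by rewrite msubK // mulrC.
Qed.

Fact mpser_mulA : associative mpser_mul.
Proof.
move=> f g h; apply/funext => a; rewrite /mpser_mul.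
pose F b c := f b * g c * h (msub (msub a b) c).
transitivity (\sum_(p <- [seq (b, c) | b <- mbelow a, c <- mbelow (msub a b)])
   F p.1 p.2).
  rewrite big_allpairs_dep; apply: eq_big_seq => b _.
  by rewrite big_distrr /=; apply: eq_bigr => c _; rewrite /F mulrA.
transitivity (\sum_(p <- [seq (c, msub b c) | b <- mbelow a, c <- mbelow b])
   F p.1 p.2); last first.
  rewrite big_allpairs_dep; apply: eq_big_seq => b _.
  rewrite big_distrl /=; apply: eq_big_seq => c; rewrite mem_mbelow => /mleP cb.
  rewrite /F; congr (_ * h _); apply/ffunP => i; rewrite !msubE.
  by rewrite -subnDA subnKC.
apply: perm_big; apply: uniq_perm.
- apply: allpairs_uniq_dep => [|b _|[b c] [b' c'] _ _ /= [-> ->]] //;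
    exact: mbelow_uniq.
- apply: allpairs_uniq_dep => [|b _|]; rewrite ?mbelow_uniq //.
  move=> [b c] [b' c'] /allpairsPdep[b1 [c1 [_ c1b /= [e1 e2]]]].
  move/allpairsPdep=> [b2 [c2 [_ c2b /= [e3 e4]]]] /= [ecc esub].
  move: c1b c2b; rewrite -e1 -e2 -e3 -e4 !mem_mbelow => /mleP cb /mleP cb'.
  have -> : b = b'.
    apply/ffunP => i; rewrite -(subnKC (cb i)) -(subnKC (cb' i)).
    by rewrite -msubE esub msubE ecc.
  by rewrite ecc.
move=> [b c]; apply/allpairsPdep/allpairsPdep.
  move=> [b1 [c1 []]]; rewrite !mem_mbelow => /mleP ba /mleP cab [-> ->].
  exists (b1 + c1), b1; rewrite !mem_mbelow; split.
  - apply/mleP => i; rewrite maddE -(subnKC (ba i)) leq_add2l.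
    by have := cab i; rewrite msubE.
  - by apply/mleP => i; rewrite maddE leq_addr.
  - by congr (_, _); apply/ffunP => i; rewrite msubE maddE addKn.
move=> [b1 [c1 []]]; rewrite !mem_mbelow => /mleP ba /mleP cb [-> ->].
exists c1, (msub b1 c1); rewrite !mem_mbelow; split => //.
- by apply/mleP => i; apply: leq_trans (ba i).
- by apply/mleP => i; rewrite !msubE leq_sub2r.
Qed.

Fact mpser_mul1 : left_id mpser_one mpser_mul.
Proof.
move=> f; apply/funext => a; rewrite /mpser_mul.
have mem0 : (0 : midx k) \in mbelow a.
  by rewrite mem_mbelow; apply/mleP => i; rewrite ffunE.
rewrite (bigD1_seq 0) ?mbelow_uniq //= big1 ?addr0 => [|b nz_b]; last first.
  by rewrite /mpser_one (negPf nz_b) mul0r.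
rewrite /mpser_one eqxx mul1r; congr (f _).
by apply/ffunP => i; rewrite msubE ffunE subn0.
Qed.

Fact mpser_mulDl : left_distributive mpser_mul mpser_add.
Proof.
move=> f g h; apply/funext => a; rewrite /mpser_mul /mpser_add -big_split /=.
by apply: eq_bigr => b _; rewrite mulrDl.
Qed.

Fact mpser_one_neq0 : mpser_one != 0.
Proof.
apply/eqP => /(congr1 (fun f : mpser k A => f 0)) /eqP.
by rewrite /mpser_one eqxx oner_eq0.
Qed.

HB.instance Definition _ := GRing.Zmodule_isComNzRing.Build (mpser k A)
  mpser_mulA mpser_mulC mpser_mul1 mpser_mulDl mpser_one_neq0.

End PowerSeriesRing.

Section PowerSeriesOps.
Variable A : comNzRingType.

Definition mpX k (i : 'I_k) : mpser k A := fun a => (a == munit i)%:R.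

Definition mpderiv k (i : 'I_k) (h : mpser k A) : mpser k A :=
  fun a => h (a + munit i) *+ (a i).+1.

(* [h(u_1, ..., u_k)], for series [u_i] without constant term: [u ^ a] has
   order at least [|a|], so that only the terms of degree [<= |c|] of [h]
   contribute to the coefficient of index [c]. *)
Definition mpsubst k l (h : mpser k A) (u : 'I_k -> mpser l A) : mpser l A :=
  fun c => \sum_(a <- midx_lt k (mtdeg c).+1) h a * (\prod_i u i ^+ a i) c.

(* [h(x_1, ..., x_k) |-> h(s_1 ^ n, ..., s_k ^ n)], where [s_i = x_i ^ (1/n)]. *)
Definition mpram k (n : nat) (h : mpser k A) : mpser k A :=
  fun a => if [forall i, (n %| a i)%N] then h [ffun i => (a i %/ n)%N] else 0.

Definition i2_0 : 'I_2 := @Ordinal 2 0 isT.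
Definition i2_1 : 'I_2 := @Ordinal 2 1 isT.
Definition i3_0 : 'I_3 := @Ordinal 3 0 isT.
Definition i3_1 : 'I_3 := @Ordinal 3 1 isT.
Definition i3_2 : 'I_3 := @Ordinal 3 2 isT.

(* The inclusion of [A[[x_1, x_2]][z]] in [A[[x_1, x_2, z]]]. *)
Definition mpser_of_poly (f : {poly mpser 2 A}) : mpser 3 A :=
  fun a => f`_(a i3_2) [ffun i : 'I_2 => if i == i2_0 then a i3_0 else a i3_1].

(* [u] generates the maximal ideal of [A[[x_1, x_2, z]]] ([A] a field). *)
Definition regular_parameters (u : 'I_3 -> mpser 3 A) : Prop :=
  (forall i, u i 0 = 0) /\
  forall h : mpser 3 A, h 0 = 0 ->
    exists a : 'I_3 -> mpser 3 A, h = \sum_i a i * u i.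

Definition mwdot k (w a : midx k) : nat := (\sum_i w i * a i)%N.

Definition weight_order k (w : midx k) (h : mpser k A) (v : nat) : Prop :=
  (exists2 a, h a != 0 & mwdot w a = v) /\
  (forall a, h a != 0 -> (v <= mwdot w a)%N).

(* [v] is the value at [h] of the monomial valuation in the variables [u] with
   weights [w]. *)
Definition monomial_value (u : 'I_3 -> mpser 3 A) (w : midx 3)
    (h : mpser 3 A) (v : nat) : Prop :=
  exists2 c : mpser 3 A, h = mpsubst c u & weight_order w c v.

End PowerSeriesOps.

Section Convergent.
Variable R : realType.
Local Notation C := (R[i]).

Definition convergent k (h : mpser k C) : Prop :=
  exists M r : C, forall a, `|h a| <= M * r ^+ mtdeg a.

Definition sums_to k (h : mpser k C) (p : 'I_k -> C) (s : C) : Prop :=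
  forall e : C, 0 < e -> exists N : nat, forall d, (N <= d)%N ->
    `|\sum_(a <- midx_lt k d) h a * \prod_i p i ^+ a i - s| < e.

Definition conv_poly (f : {poly mpser 2 C}) : Prop :=
  forall i, convergent f`_i.

Definition conv_poly_unit (f : {poly mpser 2 C}) : Prop :=
  exists2 g, conv_poly g & f * g = 1.

Definition conv_poly_irreducible (f : {poly mpser 2 C}) : Prop :=
  [/\ f != 0, ~ conv_poly_unit f &
      forall g h, conv_poly g -> conv_poly h -> f = g * h ->
        conv_poly_unit g \/ conv_poly_unit h].

Definition weierstrass_poly (f : {poly mpser 2 C}) : Prop :=
  [/\ conv_poly f, f \is monic
    & forall i, (i < (size f).-1)%N -> f`_i 0 = 0].

(* For [f] monic, the resultant of [f] and [f'] is the discriminant of [f] up to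
   sign. *)
Definition quasi_ordinary (f : {poly mpser 2 C}) : Prop :=
  exists d1 d2 : nat, exists e : mpser 2 C,
    [/\ convergent e, e 0 != 0 &
        resultant f f^`() = mpX C i2_0 ^+ d1 * mpX C i2_1 ^+ d2 * e].

(* [zeta(s_1, s_2)], with [s_i = x_i ^ (1/n)], is a root of [f]. *)
Definition fractional_root (f : {poly mpser 2 C}) (n : nat)
    (zeta : mpser 2 C) : Prop :=
  convergent zeta /\ root (map_poly (mpram n) f) zeta.

End Convergent.

Notation Q2 := (rat * rat)%type.

Definition Q2le (l m : Q2) : bool := (l.1 <= m.1) && (l.2 <= m.2).

(* The exponent in [x] of the monomial [s ^ a], [s_i = x_i ^ (1/n)]. *)
Definition frac_exponent (n : nat) (a : midx 2) : Q2 :=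
  ((a i2_0)%:R / n%:R, (a i2_1)%:R / n%:R).

(* [lam] is the list [lambda_1, ..., lambda_g]. *)
Definition lam_ (lam : seq Q2) (j : nat) : Q2 :=
  if j is j'.+1 then nth 0 lam j' else 0.

Fixpoint M_ (lam : seq Q2) (j : nat) (m : Q2) : Prop :=
  if j is j'.+1 then exists c : int, M_ lam j' (m - lam_ lam j *~ c)
  else (m.1 \is a Num.int) && (m.2 \is a Num.int).

(* [lambda_j <= m] and [lambda_{j+1} </= m], where [lambda_{g+1}] is infinite. *)
Definition at_level (lam : seq Q2) (j : nat) (m : Q2) : bool :=
  [&& (j <= size lam)%N, Q2le (lam_ lam j) m
    & (j < size lam)%N ==> ~~ Q2le (lam_ lam j.+1) m].

Definition characteristic_exponents (R : realType) (n : nat)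
    (zeta : mpser 2 R[i]) (lam : seq Q2) : Prop :=
  [/\ lam_ lam 1 != 0,
      forall j, (j < size lam)%N -> Q2le (lam_ lam j) (lam_ lam j.+1),
      forall j, (0 < j <= size lam)%N ->
        exists2 a, frac_exponent n a = lam_ lam j & zeta a != 0,
      forall a, zeta a != 0 -> forall j,
        at_level lam j (frac_exponent n a) -> M_ lam j (frac_exponent n a)
    & forall j, (0 < j <= size lam)%N -> ~ M_ lam j.-1 (lam_ lam j)].

(* [[M : N] = d], for a subgroup [N] of [M]. *)
Definition lattice_index (M N : Q2 -> Prop) (d : nat) : Prop :=
  exists r : 'I_d -> Q2,
    (forall i, M (r i)) /\ (forall m, M m -> exists! i, N (m - r i)).

Definition lex_normalized (lam : seq Q2) : Prop :=
  ((map snd lam : seqlexi rat) <= (map fst lam : seqlexi rat))%O.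

Definition normalized_root (lam : seq Q2) : Prop :=
  ~~ (((lam_ lam 1).2 == 0) && ((lam_ lam 1).1 < 1)).

Section Lct.
Variable R : realType.
Local Notation C := (R[i]).

Definition jacobian (phi : 'I_3 -> mpser 3 C) : mpser 3 C :=
  \det (\matrix_(i < 3, j < 3) mpderiv j (phi i)).

(* The germ of analytic map [phi] is injective off its critical locus, which is
   where a modification between smooth spaces is not an isomorphism; [r] may
   always be shrunk, so that all the series converge on the polydisc. *)
Definition bimeromorphic_germ (phi : 'I_3 -> mpser 3 C) : Prop :=
  exists2 r : C, 0 < r & forall (p q y : 'I_3 -> C) (jp jq : C),
    (forall i, `|p i| < r) -> (forall i, `|q i| < r) ->
    sums_to (jacobian phi) p jp -> jp != 0 ->
    sums_to (jacobian phi) q jq -> jq != 0 ->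
    (forall i, sums_to (phi i) p (y i)) ->
    (forall i, sums_to (phi i) q (y i)) ->
    p =1 q.

(* Prime divisors over [(C^3, 0)] are given by charts: [phi] is a bimeromorphic
   modification [Y -> C^3], with [Y] smooth, written in local coordinates
   [(t, a, b)] of [Y] at a point of the fibre of [0] where the prime divisor is
   [E = {t = 0}].  The centre of [E] then contains the origin,
   [ord_E h = ord_t (h o phi)], and the log discrepancy of [E] is
   [1 + ord_E (K_{Y/C^3}) = 1 + ord_t (jacobian phi)]. *)
Definition divisor_chart (phi : 'I_3 -> mpser 3 C) : Prop :=
  [/\ forall i, convergent (phi i), forall i, phi i 0 = 0,
      jacobian phi != 0 & bimeromorphic_germ phi].

Definition ord_t (h : mpser 3 C) (v : nat) : Prop :=
  weight_order (munit i3_0) h v.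

Definition ord_E (phi : 'I_3 -> mpser 3 C) (h : mpser 3 C) (v : nat) : Prop :=
  ord_t (mpsubst h phi) v.

Definition log_discrepancy (phi : 'I_3 -> mpser 3 C) (d : nat) : Prop :=
  exists2 k, ord_t (jacobian phi) k & d = k.+1.

(* The pair [(C^3, c {h = 0})] is log canonical at the origin. *)
Definition log_canonical (h : mpser 3 C) (c : R) : Prop :=
  forall phi d v, divisor_chart phi -> log_discrepancy phi d -> ord_E phi h v ->
    c * v%:R <= d%:R.

Definition lct (h : mpser 3 C) : R :=
  sup [set c : R | 0 <= c /\ log_canonical h c]%classic.

End Lct.

(* Main.v *)
Require Import Defs.
From HB Require Import structures.
From mathcomp Require Import all_boot all_order all_algebra.
From mathcomp Require Import cyclic separable cyclotomic.
From mathcomp Require Import boolp classical_sets reals complex.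
From mathcomp Require Import ring zify.
Set Implicit Arguments.
Unset Strict Implicit.
Unset Printing Implicit Defensive.
Import Order.TTheory GRing.Theory Num.Theory.
Local Open Scope ring_scope.

(* Put [n = n_1 e].  After translating [z] by the part of [zeta] with integral
   exponents, the [n] conjugates of [zeta] all have the form
   [eps (gam x_1 x_2)^(1/n_1) + higher terms] with [eps^n_1 = 1], so that [f] is
   [(z^n_1 - gam x_1 x_2)^e] plus terms strictly above its Newton polygon.

   A monomial valuation with weights [w] in any regular parameters [u] then
   satisfies [(n_1 + 1) v(f) <= n (w_1 + w_2 + w_3)].  Indeed [v(f)] is at most
   the order of [f] along any family of arcs on which the [u_i] have order at
   least [w_i].  With [w_1 <= w_2 <= w_3] and [u_3] transversal to the
   [x_2]-axis, the arc [x_1 = u_3 = 0] bounds [v(f)] by [n] times a weight [m],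
   while arcs moved in the direction of [x_2] by a parameter of weight [w_3]
   bound it by [e (w_3 + m')]; the contact of [x_1 = 0] and [u_2 = 0] on
   [u_3 = 0] ensures that [m + m' <= w_1 + w_2].  When [u_3 = 0] is tangent to
   [z = 0], the tangent cone gives [v(f) <= e (w_1 + w_2)].

   On the other hand, the weighted blowup for which [x_1, x_2, z] have weights
   [e (n_1 - 1), e, e] and [y = z^n_1 - gam x_1 x_2] has weight [e n_1 + 1] shows
   that the log canonical threshold is at most
   [(e (n_1 + 1) + 1) / (e (e n_1 + 1))], which is less than [(n_1 + 1) / n]. *)

(** * Multi-indices and weights *)

(** The two halves are only compared by inequalities: [lct] is a supremum over coefficients that
    must pass every divisor, so one explicit divisor bounds it from above and the threshold itself
    is never computed. The blowup is dictated by the part of [f] above the Newton polygon. Weights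
    [n_1 - 1, 1, 1] make [x_1 x_2] and [z^n_1] balance at [n_1], and give every other monomial
    weight at least [n + 1]. Scaling by [e] raises these to [e (n + 1)], which is exactly the value
    of [y^e] once [y] has weight one more than [e n_1]; hence the factor [e]. For the monomial
    valuations the obstacle is that the three parameters are arbitrary and cannot be normalized
    together with [f]. So [f] enters only through substitution tests: its restriction to [x_1 = 0]
    or [x_2 = 0], which is [z^n], and its leading coefficient where [z^n_1] is negligible against
    [x_1 x_2]. Of the parameters only the linear part of [u_3] and one order of contact matter. *)

Section Index.
Variable k : nat.
Implicit Types a b w : midx k.

Lemma mtdegD a b : mtdeg (a + b) = (mtdeg a + mtdeg b)%N.
Proof. by rewrite /mtdeg -big_split; apply: eq_bigr => i _; rewrite maddE. Qed.

Lemma mwdotD w a b : mwdot w (a + b) = (mwdot w a + mwdot w b)%N.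
Proof.
rewrite /mwdot -big_split; apply: eq_bigr => i _ /=.
by rewrite maddE mulnDr.
Qed.

Lemma mwdot0 w : mwdot w 0 = 0%N.
Proof. by rewrite /mwdot big1 // => i _; rewrite ffunE muln0. Qed.

Lemma mwdot_unit w i : mwdot w (munit i) = w i.
Proof.
rewrite /mwdot (bigD1 i) //= big1 ?addn0 ?ffunE ?eqxx ?muln1 // => j ji.
by rewrite ffunE (negPf ji) muln0.
Qed.

Lemma mulrn_midxE a m i : (a *+ m) i = (m * a i)%N.
Proof. by elim: m => [|m IH]; rewrite ?mulr0n ?ffunE // mulrS maddE IH mulSn. Qed.

Lemma mwdotMn w a m : mwdot w (a *+ m) = (m * mwdot w a)%N.
Proof.
elim: m => [|m IH]; first by rewrite mulr0n mwdot0.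
by rewrite mulrS mwdotD IH mulSn.
Qed.

Lemma mtdegE a : mtdeg a = mwdot [ffun=> 1%N] a.
Proof. by rewrite /mtdeg /mwdot; apply: eq_bigr => i _; rewrite ffunE mul1n. Qed.

Lemma mtdeg_eq0 a : (mtdeg a == 0)%N = (a == 0).
Proof.
rewrite sum_nat_eq0; apply/forallP/eqP => [z|-> i]; last by rewrite ffunE.
by apply/ffunP => i; rewrite ffunE; apply/eqP/z.
Qed.

Lemma mtdeg0 : mtdeg (0 : midx k) = 0%N.
Proof. by apply/eqP; rewrite mtdeg_eq0. Qed.

Lemma msubK a b : mle b a -> b + msub a b = a.
Proof. by move/mleP => ba; apply/ffunP => i; rewrite maddE msubE subnKC. Qed.

Lemma mle_addr a b : mle a (a + b).
Proof. by apply/mleP => i; rewrite maddE leq_addr. Qed.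

Lemma maddK a b : msub (a + b) a = b.
Proof. by apply/ffunP => i; rewrite msubE maddE addKn. Qed.

Lemma midx_sumE a : a = \sum_i munit i *+ a i.
Proof.
apply/ffunP => j; rewrite sum_ffunE (bigD1 j) //= mulrn_midxE ffunE eqxx muln1.
rewrite big1 ?addr0 // => i ij; rewrite mulrn_midxE ffunE eq_sym (negPf ij).
by rewrite muln0.
Qed.

Lemma mtdeg1P a : mtdeg a = 1%N -> exists i, a = munit i.
Proof.
move=> a1; have [i ai] : exists i, a i != 0%N.
  apply/existsP; rewrite -negb_forall; apply/negP => /forallP z.
  by move: a1; rewrite /mtdeg big1 // => i _; apply/eqP/z.
exists i; move: a1; rewrite /mtdeg (bigD1 i) //= => a1.
apply/ffunP => j; rewrite ffunE; have [->|ji] := eqVneq j i.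
  by move: a1 ai; case: (a i) => [|[|]].
have : (\sum_(j < k | j != i) a j = 0)%N.
  by move: a1 ai; case: (a i) => [|s] // + _; rewrite addSn => -[] /eqP; rewrite addn_eq0 => /andP[_ /eqP].
by move/eqP; rewrite sum_nat_eq0 => /forallP /(_ j); rewrite ji => /eqP.
Qed.

End Index.

(** * The filtrations of a power series ring by weight and by degree *)

Section Weight.
Variables (k : nat) (A : comNzRingType).
Implicit Types (f g h : mpser k A) (a b w : midx k).

(** The lower bound half of [weight_order]. It also holds of the zero series, so for fixed [w] it is
    a filtration by ideals, and error terms can be added freely. *)
Definition wge w (m : nat) h : Prop := forall a, h a != 0 -> (m <= mwdot w a)%N.

Definition mpC (c : A) : mpser k A := fun a => c *+ (a == 0).
Definition mpmon b : mpser k A := fun a => (a == b)%:R.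

Lemma mpserP f g : (forall a, f a = g a) -> f = g.
Proof. by move=> fg; apply/funext. Qed.

Lemma mpaddE f g a : (f + g) a = f a + g a. Proof. by []. Qed.

Lemma mpoppE f a : (- f) a = - f a. Proof. by []. Qed.

Lemma mpsubE f g a : (f - g) a = f a - g a. Proof. by []. Qed.

Lemma mp0E a : (0 : mpser k A) a = 0. Proof. by []. Qed.

Lemma mp1E a : (1 : mpser k A) a = (a == 0)%:R. Proof. by []. Qed.

Lemma mpmulE f g a :
  (f * g) a = \sum_(b <- mbelow a) f b * g (msub a b).
Proof. by []. Qed.

Lemma mpsumE (I : Type) (r : seq I) (P : pred I) (F : I -> mpser k A) a :
  (\sum_(i <- r | P i) F i) a = \sum_(i <- r | P i) F i a.
Proof. by elim/big_rec2: _ => //= i x y _ <-. Qed.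

Lemma mpC1 : mpC 1 = 1. Proof. by []. Qed.

Lemma mpX_mon (i : 'I_k) : mpX A i = mpmon (munit i). Proof. by []. Qed.

Lemma mpmulmonE h b a :
  (h * mpmon b) a = if mle b a then h (msub a b) else 0.
Proof.
rewrite mulrC mpmulE; case: ifPn => ba.
  rewrite (bigD1_seq b) ?mbelow_uniq ?mem_mbelow //= /mpmon eqxx mul1r.
  by rewrite [X in _ + X]big1 ?addr0 // => c /negPf ->; rewrite mul0r.
rewrite big1_seq // => c /=; rewrite mem_mbelow /mpmon => ca.
by case: eqVneq => [cb|]; rewrite ?mul0r //; rewrite -cb ca in ba.
Qed.

Lemma mpmonD a b : mpmon (a + b) = mpmon a * mpmon b.
Proof.
apply: mpserP => c; rewrite mpmulmonE /mpmon; case: ifPn => bc.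
  congr (_%:R); congr nat_of_bool; apply/eqP/eqP => [->|<-].
    by rewrite addrC maddK.
  by rewrite addrC msubK.
by case: eqP => // cab; move: bc; rewrite cab addrC mle_addr.
Qed.

Lemma mpmonMn a m : mpmon (a *+ m) = mpmon a ^+ m.
Proof.
by elim: m => [|m IH]; rewrite ?mulr0n ?expr0 // mulrS mpmonD IH exprS.
Qed.

Lemma mpmon_prod a : mpmon a = \prod_i mpX A i ^+ a i.
Proof.
rewrite {1}[a]midx_sumE.
elim/big_ind2: _ => // [x y z t <- <-|i _]; first exact: mpmonD.
by rewrite mpmonMn.
Qed.

Lemma mpCmulE c h a : (mpC c * h) a = c * h a.
Proof.
rewrite mulrC mpmulE (bigD1_seq a) ?mbelow_uniq ?mem_mbelow //=; last first.
  exact/mleP.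
have -> : msub a a = 0 by apply/ffunP => i; rewrite msubE ffunE subnn.
rewrite /mpC eqxx mulr1n mulrC big1_seq ?addr0 // => b /andP[ba].
rewrite mem_mbelow => le; case: eqP => // E; last by rewrite mulr0.
by move: ba; rewrite -[in b != _](msubK le) E addr0 eqxx.
Qed.

Lemma mpCD c d : mpC (c + d) = mpC c + mpC d.
Proof. by apply: mpserP => a; rewrite mpaddE /mpC mulrnDl. Qed.

Lemma mpCN c : mpC (- c) = - mpC c.
Proof. by apply: mpserP => a; rewrite mpoppE /mpC mulNrn. Qed.

Lemma mpCM c d : mpC (c * d) = mpC c * mpC d.
Proof. by apply: mpserP => a; rewrite mpCmulE /mpC mulrnAr. Qed.
HB.instance Definition _ := GRing.isZmodMorphism.Build A (mpser k A) mpC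
  (fun c d => etrans (mpCD c (- d)) (congr1 _ (mpCN d))).
HB.instance Definition _ := GRing.isMonoidMorphism.Build A (mpser k A) mpC
  (conj mpC1 mpCM).

Definition mpc0 (h : mpser k A) : A := h 0.

Lemma mpc0M f g : (f * g) 0 = f 0 * g 0.
Proof.
rewrite mpmulE (bigD1_seq 0) ?mbelow_uniq ?mem_mbelow //=; last exact/mleP.
have -> : msub 0 0 = 0 :> midx k by apply/ffunP => i; rewrite msubE ffunE.
rewrite big1_seq ?addr0 // => b /andP[b0]; rewrite mem_mbelow => /mleP le.
by case/eqP: b0; apply/ffunP => i; have := le i; rewrite !ffunE leqn0 => /eqP.
Qed.

HB.instance Definition _ := GRing.isZmodMorphism.Build (mpser k A) A mpc0
  (fun f g => erefl).
HB.instance Definition _ := GRing.isMonoidMorphism.Build (mpser k A) A mpc0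
  (conj (congr1 (fun b : bool => b%:R) (eqxx 0)) mpc0M).

Lemma wge_zero w m : wge w m 0.
Proof. by move=> a; rewrite mp0E eqxx. Qed.

Lemma wge_le w m m' h : (m' <= m)%N -> wge w m h -> wge w m' h.
Proof. by move=> mm wh a /wh; apply: leq_trans. Qed.

Lemma wgeD w m f g : wge w m f -> wge w m g -> wge w m (f + g).
Proof.
move=> wf wg a; rewrite mpaddE; have [->|/wf//] := eqVneq (f a) 0.
by rewrite add0r => /wg.
Qed.

Lemma wgeN w m f : wge w m f -> wge w m (- f).
Proof. by move=> wf a; rewrite mpoppE oppr_eq0 => /wf. Qed.

Lemma wgeB w m f g : wge w m f -> wge w m g -> wge w m (f - g).
Proof. by move=> wf wg; apply: wgeD => //; apply: wgeN. Qed.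

Lemma wge_sum w m (I : Type) (r : seq I) (P : pred I) (F : I -> mpser k A) :
  (forall i, P i -> wge w m (F i)) -> wge w m (\sum_(i <- r | P i) F i).
Proof. by move=> wF; elim/big_ind: _ => //; [exact: wge_zero|exact: wgeD]. Qed.

Lemma wgeM w m m' f g : wge w m f -> wge w m' g -> wge w (m + m') (f * g).
Proof.
move=> wf wg a; rewrite mpmulE => nz.
have [b ba nzb] : exists2 b, b \in mbelow a & f b * g (msub a b) != 0.
  apply/hasP; apply: contraNT nz => /hasPn z; rewrite big1_seq // => b /= /z.
  by rewrite negbK => /eqP.
move: ba; rewrite mem_mbelow => /msubK <-; rewrite mwdotD leq_add //.
  by apply: wf; apply: contraNneq nzb => ->; rewrite mul0r.
by apply: wg; apply: contraNneq nzb => ->; rewrite mulr0.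
Qed.

Lemma wgeMr w m f g : wge w m f -> wge w m (f * g).
Proof. by move=> wf; rewrite -[m]addn0; apply: wgeM. Qed.

Lemma wgeMl w m f g : wge w m g -> wge w m (f * g).
Proof. by move=> wf; rewrite -[m]add0n; apply: wgeM. Qed.

Lemma wgeX w m f d : wge w m f -> wge w (d * m) (f ^+ d).
Proof.
by move=> wf; elim: d => [|d IH] //; rewrite exprS mulSn; apply: wgeM.
Qed.

Lemma wge_prod w (I : Type) (r : seq I) (P : pred I) (F : I -> mpser k A) v :
  (forall i, P i -> wge w (v i) (F i)) ->
  wge w (\sum_(i <- r | P i) v i) (\prod_(i <- r | P i) F i).
Proof. by move=> wF; elim/big_rec2: _ => // i y x Pi; apply: wgeM; apply: wF. Qed.

Lemma wge_mon w b : wge w (mwdot w b) (mpmon b).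
Proof. by move=> a; rewrite /mpmon; have [->|_] := eqVneq a b; rewrite ?eqxx. Qed.

Lemma wge_X w i : wge w (w i) (mpX A i).
Proof. by rewrite -{1}(mwdot_unit w i); apply: wge_mon. Qed.

Lemma wge_coef0 w m h a : wge w m h -> (mwdot w a < m)%N -> h a = 0.
Proof. by move=> wh lt; apply/eqP; apply: contraTT lt; rewrite -leqNgt => /wh. Qed.

Lemma wge_subM w m f g f' g' : wge w m (f - f') -> wge w m (g - g') ->
  wge w m (f * g - f' * g').
Proof.
move=> wf wg; have -> : f * g - f' * g' = (f - f') * g + f' * (g - g').
  by ring.
by apply: wgeD; [apply: wgeMr|apply: wgeMl].
Qed.

Lemma wge_subX w m f g d : wge w m (f - g) -> wge w m (f ^+ d - g ^+ d).
Proof.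
move=> wfg; elim: d => [|d IH]; first by rewrite subrr; apply: wge_zero.
by rewrite !exprS; apply: wge_subM.
Qed.

(** Equal leading forms have powers with equal leading forms: in the telescoping sum each product
    trades one factor of weight [m] for the difference, of weight [m + 1]. *)
Lemma wge_subX_lead w m f g d : wge w m f -> wge w m g -> wge w m.+1 (f - g) ->
  wge w (d * m).+1 (f ^+ d - g ^+ d).
Proof.
move=> wf wg wfg; elim: d => [|d IH]; first by rewrite subrr; apply: wge_zero.
have -> : f ^+ d.+1 - g ^+ d.+1 =
    (f - g) * f ^+ d + g * (f ^+ d - g ^+ d) by rewrite !exprS; ring.
apply: wgeD.
  by apply: wge_le _ (wgeM wfg (wgeX wf)); lia.
by apply: wge_le _ (wgeM wg IH); lia.
Qed.

(** All weights are 1. Series are separated and complete for this filtration by total degree;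
    equalities between them are proved modulo every degree through [mord_eq]. *)
Definition mord (m : nat) h := wge [ffun=> 1%N] m h.

Lemma mordP m h : (forall a, (mtdeg a < m)%N -> h a = 0) -> mord m h.
Proof.
move=> hz a; rewrite -mtdegE leqNgt => nz; apply/negP => /hz h0.
by rewrite h0 eqxx in nz.
Qed.

Lemma mord_coef0 m h a : mord m h -> (mtdeg a < m)%N -> h a = 0.
Proof. by rewrite mtdegE => wh lt; apply: wge_coef0 wh lt. Qed.

Lemma mord1 h : mord 1 h <-> h 0 = 0.
Proof.
split=> [/mord_coef0|h0].
  by apply; rewrite mtdeg0.
apply: mordP => a; rewrite ltnS leqn0 mtdeg_eq0 => /eqP -> //.
Qed.

Lemma mord_eq f g : (forall m, mord m (f - g)) -> f = g.
Proof.
move=> fg; apply: mpserP => a; apply/eqP; rewrite -subr_eq0 -mpsubE.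
by rewrite (mord_coef0 (fg (mtdeg a).+1)).
Qed.

Lemma mtrunc D h : mord D (h - \sum_(a <- midx_lt k D) mpC (h a) * mpmon a).
Proof.
apply: mordP => b bD; rewrite mpsubE mpsumE.
rewrite (bigD1_seq b) ?midx_lt_uniq ?mem_midx_lt //=.
rewrite mpCmulE /mpmon eqxx mulr1 big1 ?addr0 ?subrr // => a ab.
by rewrite mpCmulE /mpmon eq_sym (negPf ab) mulr0.
Qed.

Lemma mord2_affine h :
  mord 2 (h - mpC (h 0) - \sum_i mpC (h (munit i)) * mpX A i).
Proof.
apply: mordP => a.
rewrite ltnS leq_eqVlt ltnS leqn0 mtdeg_eq0 => /orP[/eqP /mtdeg1P[i ->]|/eqP ->].
  rewrite !mpsubE mpsumE (bigD1 i) //= mpCmulE /mpX eqxx mulr1 big1 => [|s si].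
    rewrite /mpC; case: eqP => [/ffunP /(_ i)|]; first by rewrite !ffunE eqxx.
    by rewrite mulr0n subr0 addr0 subrr.
  rewrite mpCmulE; case: eqP => [/ffunP /(_ i)|]; last by rewrite mulr0.
  by rewrite !ffunE eqxx eq_sym (negPf si).
rewrite !mpsubE mpsumE /mpC eqxx subrr big1 ?subr0 // => i _.
rewrite mpCmulE /mpX; case: eqP => [/ffunP /(_ i)|]; last by rewrite mulr0.
by rewrite !ffunE eqxx.
Qed.

End Weight.
Arguments mpC {k A} c.
Arguments mpmon {k} A b.

(** * Substitution *)

Section Subst.
Variables (k l : nat) (A : comNzRingType).
Implicit Types (f g h : mpser k A) (u : 'I_k -> mpser l A).

Local Notation "u ^^ a" := (\prod_i u i ^+ a i) (at level 30).

Lemma mord_monsubst u a : (forall i, u i 0 = 0) -> mord (mtdeg a) (u ^^ a).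
Proof.
move=> u0; apply: wge_prod => i _; rewrite -{1}[a i]muln1.
by apply: wgeX; apply/mord1.
Qed.

(** Monomials of degree above that of [c] do not reach the coefficient of [c], so any larger cutoff
    may be used and different coefficients can share one truncation. *)
Lemma mpsubstE D h u c : (forall i, u i 0 = 0) -> (mtdeg c < D)%N ->
  mpsubst h u c = \sum_(a <- midx_lt k D) h a * (u ^^ a) c.
Proof.
move=> u0 cD; rewrite /mpsubst.
have big (E : nat) : (mtdeg c < E <= D)%N -> \sum_(a <- midx_lt k E) h a * (u ^^ a) c
    = \sum_(a <- midx_lt k D | (mtdeg a <= mtdeg c)%N) h a * (u ^^ a) c.
  case/andP => cE ED; rewrite (bigID (fun a => mtdeg a <= mtdeg c)%N) /=.
  rewrite [X in _ + X]big1 ?addr0 => [|a]; last first.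
    by rewrite -ltnNge => /(mord_coef0 (mord_monsubst u0)) ->; rewrite mulr0.
  rewrite -[LHS]big_filter -[RHS]big_filter; apply: perm_big; apply: uniq_perm.
  - by rewrite filter_uniq ?midx_lt_uniq.
  - by rewrite filter_uniq ?midx_lt_uniq.
  move=> a; rewrite mem_filter [RHS]mem_filter !mem_midx_lt.
  by apply: andb_id2l => ac; rewrite !(leq_ltn_trans ac) // (leq_trans cE).
by rewrite !big ?ltnSn ?cD //= ?leqnn.
Qed.

Lemma mpsubst_mord D h u : (forall i, u i 0 = 0) ->
  mord D (mpsubst h u - \sum_(a <- midx_lt k D) mpC (h a) * u ^^ a).
Proof.
move=> u0; apply: mordP => c cD; rewrite mpsubE mpsumE (mpsubstE _ u0 cD).
by apply/eqP; rewrite subr_eq0; apply/eqP/eq_bigr => a _; rewrite mpCmulE.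
Qed.

Lemma mpsubstB f g u : mpsubst (f - g) u = mpsubst f u - mpsubst g u.
Proof.
apply: mpserP => c; rewrite mpsubE /mpsubst -sumrB; apply: eq_bigr => a _.
by rewrite mpsubE mulrBl.
Qed.

Lemma wge_mpsubst (w : midx l) (v : 'I_k -> nat) m h u :
  (forall i, wge w (v i) (u i)) ->
  (forall a, h a != 0 -> (m <= \sum_i v i * a i)%N) ->
  wge w m (mpsubst h u).
Proof.
move=> wu hm c nz.
have [a _ nza] : exists2 a, a \in midx_lt k (mtdeg c).+1 & h a * (u ^^ a) c != 0.
  apply/hasP; apply: contraNT nz => /hasPn z; rewrite /mpsubst big1_seq // => b /=.
  by move/z; rewrite negbK => /eqP.
have ha : h a != 0 by apply: contraNneq nza => ->; rewrite mul0r.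
apply: leq_trans (hm _ ha) _.
have wa : wge w (\sum_i v i * a i)%N (u ^^ a).
  by apply: wge_prod => i _; rewrite mulnC; apply: wgeX.
by apply: wa; apply: contraNneq nza => ->; rewrite mulr0.
Qed.

Lemma mord_mpsubst m h u : (forall i, u i 0 = 0) -> mord m h ->
  mord m (mpsubst h u).
Proof.
move=> u0 hm; apply: (@wge_mpsubst _ (fun=> 1%N)) => [i|a /hm].
  exact/mord1.
by rewrite -mtdegE /mtdeg; under [X in _ -> (_ <= X)%N]eq_bigr do rewrite mul1n.
Qed.

Lemma wge_mpsubst_sub (w : midx l) m h u u' :
  (forall i, wge w m (u i - u' i)) -> wge w m (mpsubst h u - mpsubst h u').
Proof.
move=> uu c; rewrite mpsubE /mpsubst -sumrB => nz.
have [a _ nza] : exists2 a, a \in midx_lt k (mtdeg c).+1 &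
    h a * (u ^^ a) c - h a * (u' ^^ a) c != 0.
  apply/hasP; apply: contraNT nz => /hasPn z; rewrite big1_seq // => b /=.
  by move/z; rewrite negbK => /eqP.
have wa : wge w m (u ^^ a - u' ^^ a).
  elim/big_ind2: _ => [|x y z t|i _].
  - by rewrite subrr; apply: wge_zero.
  - exact: wge_subM.
  - exact: wge_subX.
apply: wa; apply: contraNneq nza => /eqP; rewrite mpsubE subr_eq0 => /eqP ->.
by rewrite subrr.
Qed.

Lemma mpsubstC c u : mpsubst (mpC c) u = mpC c.
Proof.
apply: mpserP => b; rewrite /mpsubst (bigD1_seq 0) ?midx_lt_uniq //=; last first.
  by rewrite mem_midx_lt mtdeg0.
rewrite big1 => [|i _]; last by rewrite ffunE.
rewrite big1 ?addr0 => [|a a0]; last by rewrite /mpC (negPf a0) mul0r.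
by rewrite mp1E /mpC eqxx; case: (b == 0); rewrite ?mulr0 ?mulr1.
Qed.

Variables (u : 'I_k -> mpser l A) (u0 : forall i, u i 0 = 0).

(** Substitution is a ring morphism only for series without constant term; the proof [u0] is kept as
    a phantom argument so that the morphism structures can be attached to it. *)
Definition mps h := let _ := u0 in mpsubst h u.

Lemma mpsE h : mps h = mpsubst h u. Proof. by []. Qed.

HB.instance Definition _ := GRing.isZmodMorphism.Build (mpser k A) (mpser l A)
  mps (fun f g => mpsubstB f g u).

Lemma mpsCM c h : mps (mpC c * h) = mpC c * mps h.
Proof.
apply: mpserP => b; rewrite mpCmulE !mpsE /mpsubst big_distrr.
by apply: eq_bigr => a _ /=; rewrite mpCmulE mulrA.
Qed.

Lemma mps_mon a : mps (mpmon A a) = u ^^ a.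
Proof.
apply: mpserP => b; rewrite mpsE (@mpsubstE (maxn (mtdeg a) (mtdeg b)).+1) //; last first.
  by rewrite ltnS leq_maxr.
rewrite (bigD1_seq a) ?midx_lt_uniq ?mem_midx_lt ?ltnS ?leq_maxl //= /mpmon eqxx mul1r.
by rewrite [X in _ + X]big1 ?addr0 // => c /negPf ->; rewrite mul0r.
Qed.

(** Modulo degree [D] both factors are polynomials, where it suffices to look at monomials;
    truncation errors keep order [D] under products and substitution. *)
Lemma mpsM f g : mps (f * g) = mps f * mps g.
Proof.
apply: mord_eq => D.
pose tr h := \sum_(a <- midx_lt k D) mpC (h a) * mpmon A a.
have mtr h : mord D (mps h - mps (tr h)).
  by rewrite -raddfB; apply: mord_mpsubst => //; apply: mtrunc.
have trM : mps (tr f * tr g) = mps (tr f) * mps (tr g).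
  rewrite /tr big_distrl /= !raddf_sum big_distrl /=; apply: eq_bigr => a _.
  rewrite big_distrr /= !raddf_sum big_distrr /=; apply: eq_bigr => b _.
  rewrite !mpsCM mulrACA -rmorphM -mpmonD !mpsCM !mps_mon mulrACA -rmorphM.
  congr (_ * _); rewrite -big_split; apply: eq_bigr => i _ /=.
  by rewrite maddE exprD.
have -> : mps (f * g) - mps f * mps g =
    (mps (f * g) - mps (tr f * tr g))
    - (mps f * mps g - mps (tr f) * mps (tr g)) by rewrite trM; ring.
apply: wgeB; last by apply: wge_subM; apply: mtr.
rewrite -raddfB; apply: mord_mpsubst => //.
by apply: wge_subM; apply: mtrunc.
Qed.

HB.instance Definition _ := GRing.isMonoidMorphism.Build (mpser k A) (mpser l A)
  mps (conj (mpsubstC 1 u) mpsM).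

Lemma mpsubstX i : mpsubst (mpX A i) u = u i.
Proof.
rewrite -mpsE mpX_mon mps_mon (bigD1 i) //= big1 => [|j ji].
  by rewrite ffunE eqxx mulr1.
by rewrite ffunE (negPf ji).
Qed.

Lemma mpsubst0 h : mpsubst h u 0 = h 0.
Proof.
rewrite (@mpsubstE 1) //; last by rewrite ltnS leqn0 mtdeg_eq0.
rewrite (bigD1_seq 0) ?midx_lt_uniq ?mem_midx_lt ?ltnS ?leqn0 ?mtdeg_eq0 //=.
rewrite [X in _ + X]big1_seq ?addr0 => [|a /andP[a0]]; last first.
  by rewrite mem_midx_lt ltnS leqn0 mtdeg_eq0 (negPf a0).
by rewrite big1 ?mp1E ?eqxx ?mulr1 // => i _; rewrite ffunE.
Qed.

Lemma mpsubst_munit h j :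
  mpsubst h u (munit j) = \sum_i h (munit i) * u i (munit j).
Proof.
have /mord_coef0 lin : mord 2 (mps h - mpC (h 0) - \sum_i mpC (h (munit i)) * u i).
  have -> : mps h - mpC (h 0) - \sum_i mpC (h (munit i)) * u i =
      mps (h - mpC (h 0) - \sum_i mpC (h (munit i)) * mpX A i).
    rewrite !raddfB [X in _ = _ - X]raddf_sum /= [mps (mpC _)]mpsubstC.
    congr (_ - _).
    by apply: eq_bigr => i _; rewrite mpsCM [mps (mpX _ _)]mpsubstX.
  by apply: mord_mpsubst => //; apply: mord2_affine.
have /negPf nz : munit j != 0 :> midx l.
  by apply/eqP => /ffunP /(_ j); rewrite !ffunE eqxx.
have := lin (munit j); rewrite mtdegE mwdot_unit ffunE => /(_ isT) /eqP.
rewrite !mpsubE mpsumE /mpC nz mulr0n subr0 subr_eq0 mpsE => /eqP ->.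
by apply: eq_bigr => i _; rewrite mpCmulE.
Qed.

End Subst.

Lemma mpsubst_comp (k l m : nat) (A : comNzRingType) (h : mpser k A)
    (u : 'I_k -> mpser l A) (v : 'I_l -> mpser m A) :
  (forall i, u i 0 = 0) -> (forall i, v i 0 = 0) ->
  mpsubst (mpsubst h u) v = mpsubst h (fun i => mpsubst (u i) v).
Proof.
move=> u0 v0; have uv0 i : mpsubst (u i) v 0 = 0 by rewrite mpsubst0.
apply: mord_eq => D; rewrite -(mpsE v0).
pose T := \sum_(a <- midx_lt k D) mpC (h a) * \prod_i u i ^+ a i.
have -> : mps v0 (mpsubst h u) = mps v0 (mpsubst h u - T) + mps v0 T.
  by rewrite raddfB subrK.
rewrite -addrA; apply: wgeD; first by apply: mord_mpsubst => //; apply: mpsubst_mord.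
have -> : mps v0 T = \sum_(a <- midx_lt k D) mpC (h a) *
    \prod_i mpsubst (u i) v ^+ a i.
  rewrite raddf_sum; apply: eq_bigr => a _ /=; rewrite mpsCM.
  rewrite rmorph_prod; congr (_ * _).
  by apply: eq_bigr => i _; rewrite rmorphXn.
by rewrite -opprB; apply: wgeN; apply: mpsubst_mord.
Qed.

Lemma mpsubst_id (k : nat) (A : comNzRingType) (h : mpser k A) :
  mpsubst h (@mpX A k) = h.
Proof.
have X0 (i : 'I_k) : mpX A i 0 = 0.
  by apply/mord1; have := @wge_X k A [ffun=> 1%N] i; rewrite ffunE.
apply: mord_eq => D.
have := @mpsubst_mord _ _ _ D h _ X0; under eq_bigr do rewrite -mpmon_prod.
by move=> h1; have := wgeB h1 (@mtrunc _ _ D h); rewrite opprB addrA subrK.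
Qed.

(** * Implicit and inverse functions *)

Section FixedPoint.
Variables (l : nat) (A : comNzRingType) (I : Type).
Implicit Types (s t : I -> mpser l A).

Lemma mord_fixpoint (T : (I -> mpser l A) -> (I -> mpser l A)) :
  (forall s, (forall i, s i 0 = 0) -> forall i, T s i 0 = 0) ->
  (forall d s t, (0 < d)%N -> (forall i, s i 0 = 0) -> (forall i, t i 0 = 0) ->
    (forall i, mord d (s i - t i)) -> forall i, mord d.+1 (T s i - T t i)) ->
  exists s, (forall i, s i 0 = 0) /\ T s = s.
Proof.
move=> T0 Tc; pose it d := iter d T (fun=> 0).
have it0 d i : it d i 0 = 0 by elim: d i => [|d IH] i //=; apply: T0.
have itS d i : mord d.+1 (it d.+1 i - it d i).
  elim: d i => [|d IH] i; first by apply/mord1; rewrite mpsubE !it0 subr0.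
  exact: Tc (it0 _) (it0 _) IH i.
have itD d m i : mord d.+1 (it (d + m)%N i - it d i).
  elim: m => [|m IH]; first by rewrite addn0 subrr; apply: wge_zero.
  rewrite -(subrK (it (d + m)%N i) (it (d + m.+1)%N i)) -addrA; apply: wgeD => //.
  by rewrite addnS; apply: wge_le (itS _ _); rewrite ltnS leq_addr.
pose s i : mpser l A := fun a => it (mtdeg a) i a.
have sE d i : mord d.+1 (s i - it d i).
  apply: mordP => a; rewrite ltnS => ad; apply/eqP.
  rewrite mpsubE /s -opprB oppr_eq0 -(subnKC ad) -mpsubE.
  by rewrite (mord_coef0 (itD _ _ _)).
have s0 i : s i 0 = 0 by rewrite /s mtdeg0.
exists s; split=> //; apply/funext => i; apply: mord_eq => m.
have -> : T s i - s i = (T s i - T (it m) i) - (s i - it m.+1 i).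
  by rewrite /=; ring.
apply: wgeB.
  by apply: wge_le (Tc m.+1 _ _ _ s0 (it0 m) (sE m) i) => //; lia.
by apply: wge_le (sE m.+1 i); lia.
Qed.

End FixedPoint.

Section Linearization.
Variables (k l : nat) (A : comNzRingType).
Implicit Types (h : mpser k A) (u v : 'I_k -> mpser l A).

Lemma mord_subM (d r r' : nat) (f g f' g' : mpser l A) :
  mord r f' -> mord r' g -> mord (d + r) (f - f') -> mord (d + r') (g - g') ->
  mord (d + (r + r')) (f * g - f' * g').
Proof.
move=> of' og off' ogg'.
have -> : f * g - f' * g' = (f - f') * g + f' * (g - g') by ring.
apply: wgeD; first by apply: wge_le (wgeM off' og); lia.
by apply: wge_le (wgeM of' ogg'); lia.
Qed.

Lemma mord_monsubst_sub d u v (a : midx k) :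
  (forall i, u i 0 = 0) -> (forall i, v i 0 = 0) ->
  (forall i, mord d.+1 (u i - v i)) ->
  mord (d + mtdeg a) (\prod_i u i ^+ a i - \prod_i v i ^+ a i).
Proof.
move=> u0 v0 uv; pose P (r : nat) x := [/\ mord r x.1, mord r x.2
  & mord (d + r) (x.1 - x.2 : mpser l A)].
have PM r r' x y : P r x -> P r' y -> P (r + r')%N (x.1 * y.1, x.2 * y.2).
  case=> x1 x2 x3 [y1 y2 y3]; split; [exact: wgeM|exact: wgeM|].
  exact: mord_subM.
suff [] : P (mtdeg a) (\prod_i u i ^+ a i, \prod_i v i ^+ a i) by [].
rewrite /mtdeg; elim/big_rec3: _ => /=.
  by split=> //=; rewrite subrr; apply: wge_zero.
move=> i y1 y2 y3 _ Py; apply: (PM _ _ (u i ^+ a i, v i ^+ a i)) Py.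
elim: (a i) => [|m Pm]; first by split=> //=; rewrite subrr; apply: wge_zero.
rewrite !exprS -addn1 addnC; apply: (PM _ _ (u i, v i)) Pm.
by split=> /=; rewrite ?addn1 //; apply/mord1.
Qed.

(** First order Taylor expansion. Once the affine part of [h] is removed, only monomials of degree
    at least two remain, and on these [mord_monsubst_sub] gains the extra order. *)
Lemma mpsubst_linear h d u v :
  (forall i, u i 0 = 0) -> (forall i, v i 0 = 0) ->
  (forall i, mord d.+1 (u i - v i)) ->
  mord d.+2 (mpsubst h u - mpsubst h v
             - \sum_i mpC (h (munit i)) * (u i - v i)).
Proof.
move=> u0 v0 uv.
pose g := h - mpC (h 0) - \sum_i mpC (h (munit i)) * mpX A i.
have gE w (w0 : forall i, w i 0 = 0) : mps w0 g =
    mpsubst h w - mpC (h 0) - \sum_i mpC (h (munit i)) * w i.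
  rewrite !raddfB [X in _ - X = _]raddf_sum /= [mps _ (mpC _)]mpsubstC.
  by congr (_ - _); apply: eq_bigr => i _; rewrite mpsCM [mps _ (mpX _ _)]mpsubstX.
have -> : mpsubst h u - mpsubst h v - \sum_i mpC (h (munit i)) * (u i - v i) =
    mps u0 g - mps v0 g.
  rewrite !gE; under eq_bigr do rewrite mulrBr; rewrite sumrB; ring.
have g_ord a : g a != 0 -> (1 < mtdeg a)%N by rewrite mtdegE; apply: mord2_affine.
apply: mordP => c cd; rewrite mpsubE !mpsE /mpsubst -sumrB big1 // => a _.
rewrite -mulrBr; have [->|/g_ord a2] := eqVneq (g a) 0; first by rewrite mul0r.
rewrite -mpsubE (mord_coef0 (@mord_monsubst_sub d u v a u0 v0 uv)) ?mulr0 //; lia.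
Qed.

End Linearization.

Section Inversion.
Variables (k : nat) (A : comNzRingType).

Definition mpjac k l (u : 'I_k -> mpser l A) : 'M[A]_(k, l) :=
  \matrix_(i, j) u i (munit j).

Lemma mpjac_comp l m (u : 'I_k -> mpser l A) (v : 'I_l -> mpser m A) :
  (forall i, v i 0 = 0) ->
  mpjac (fun i => mpsubst (u i) v) = mpjac u *m mpjac v.
Proof.
move=> v0; apply/matrixP => i j; rewrite !mxE mpsubst_munit //.
by apply: eq_bigr => s _; rewrite !mxE.
Qed.

Lemma mpjacX : mpjac (@mpX A k) = 1%:M.
Proof.
apply/matrixP => i j; rewrite !mxE /mpX; congr (nat_of_bool _)%:R.
apply/eqP/eqP => [/ffunP /(_ i)|->//]; rewrite !ffunE eqxx.
by case: eqP => // ->.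
Qed.

Lemma mpX0 (i : 'I_k) : mpX A i 0 = 0.
Proof. by apply/mord1; have := @wge_X k A [ffun=> 1%N] i; rewrite ffunE. Qed.

Lemma mpser_right_inverse (u : 'I_k -> mpser k A) (M : 'M[A]_k) :
  (forall i, u i 0 = 0) -> mpjac u *m M = 1%:M -> M *m mpjac u = 1%:M ->
  exists v : 'I_k -> mpser k A,
    (forall i, v i 0 = 0) /\ forall i, mpsubst (u i) v = mpX A i.
Proof.
move=> u0 uM Mu.
have MuE i m : \sum_j M i j * u j (munit m) = (i == m)%:R.
  have := congr1 (fun X : 'M_k => X i m) Mu; rewrite !mxE => <-.
  by apply: eq_bigr => j _; rewrite mxE.
have uME i m : \sum_j u i (munit j) * M j m = (i == m)%:R.
  have := congr1 (fun X : 'M_k => X i m) uM; rewrite !mxE => <-.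
  by apply: eq_bigr => j _; rewrite mxE.
pose E (s : 'I_k -> mpser k A) j := mpsubst (u j) s - mpX A j.
(* Newton iteration with the constant inverse Jacobian [M]: its linear part in [s] vanishes, so it
   contracts. A fixed point has [M E = 0], and multiplying by [mpjac u] gives [E = 0]. *)
pose T s i := s i - \sum_j mpC (M i j) * E s j.
have E0 s : (forall i, s i 0 = 0) -> forall j, E s j 0 = 0.
  by move=> s0 j; rewrite /E mpsubE mpsubst0 // u0 mpX0 subr0.
have [s s0|d s t d0 s0 t0 st i|v [v0 vE]] := @mord_fixpoint k A _ T.
- move=> i; rewrite /T mpsubE s0 mpsumE big1 ?subr0 // => j _.
  by rewrite mpCmulE E0 ?mulr0.
- case: d d0 st => // d _ st.
  pose L j := mpsubst (u j) s - mpsubst (u j) t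
     - \sum_m mpC (u j (munit m)) * (s m - t m).
  have -> : T s i - T t i = - \sum_j mpC (M i j) * L j.
    have MJ : \sum_j mpC (M i j) * (\sum_m mpC (u j (munit m)) * (s m - t m))
        = s i - t i.
      under eq_bigr do rewrite big_distrr /=.
      rewrite exchange_big (bigD1 i) //= [X in _ + X]big1 ?addr0 => [|m mi].
        under eq_bigr do rewrite mulrA -rmorphM.
        rewrite -big_distrl -rmorph_sum /=.
        by rewrite MuE eqxx rmorph1 mul1r.
      under eq_bigr do rewrite mulrA -rmorphM.
      rewrite -big_distrl -rmorph_sum /=.
      by rewrite MuE eq_sym (negPf mi) rmorph0 mul0r.
    rewrite /T /L; under [in RHS]eq_bigr do rewrite mulrBr.
    rewrite [in RHS]sumrB MJ.
    have -> : \sum_j mpC (M i j) * (mpsubst (u j) s - mpsubst (u j) t)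
        = \sum_j mpC (M i j) * E s j - \sum_j mpC (M i j) * E t j.
      by rewrite -sumrB; apply: eq_bigr => j _; rewrite /E -mulrBr; congr (_ * _); ring.
    ring.
  apply: wgeN; apply: wge_sum => j _; apply: wgeMl.
  exact: mpsubst_linear.
exists v; split=> // i; apply/eqP; rewrite -subr_eq0; apply/eqP.
have ME j : \sum_m mpC (M j m) * E v m = 0.
  have := congr1 (fun f => f j) vE; rewrite /T => /eqP.
  by rewrite subr_eq addrC -subr_eq subrr eq_sym => /eqP.
have : \sum_j mpC (u i (munit j)) * (\sum_m mpC (M j m) * E v m) = 0.
  by rewrite big1 // => j _; rewrite ME mulr0.
under eq_bigr do rewrite big_distrr /=.
rewrite exchange_big (bigD1 i) //= [X in _ + X]big1 ?addr0 => [|m mi].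
  under eq_bigr do rewrite mulrA -rmorphM.
  rewrite -big_distrl -rmorph_sum /=.
  by rewrite uME eqxx rmorph1 mul1r.
under eq_bigr do rewrite mulrA -rmorphM.
rewrite -big_distrl -rmorph_sum /=.
by rewrite uME eq_sym (negPf mi) rmorph0 mul0r.
Qed.

(** A right inverse [v] has Jacobian [M], hence a right inverse [w] of its own; associativity of
    substitution forces [w = u]. *)
Lemma mpser_inverse (u : 'I_k -> mpser k A) (M : 'M[A]_k) :
  (forall i, u i 0 = 0) -> mpjac u *m M = 1%:M -> M *m mpjac u = 1%:M ->
  exists v : 'I_k -> mpser k A, [/\ forall i, v i 0 = 0,
    forall i, mpsubst (u i) v = mpX A i & forall i, mpsubst (v i) u = mpX A i].
Proof.
move=> u0 uM Mu; have [v [v0 uv]] := mpser_right_inverse u0 uM Mu.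
have juv : mpjac u *m mpjac v = 1%:M.
  rewrite -mpjac_comp // -mpjacX; congr mpjac; exact/funext.
have vE : mpjac v = M by rewrite -[LHS]mul1mx -Mu -mulmxA juv mulmx1.
have [|w [w0 vw]] := mpser_right_inverse v0 _ juv; first by rewrite vE.
suff wu : w = u by exists v; split=> // i; rewrite -wu.
apply/funext => i; have := @mpsubst_comp _ _ _ _ (u i) _ _ v0 w0.
rewrite uv mpsubstX //; under [in RHS]eq_fun do rewrite vw.
by rewrite mpsubst_id.
Qed.

(** The same simplified Newton iteration, now in the single unknown [y], with [c] inverting the
    partial derivative. *)
Lemma mpser_implicit l (h : mpser k A) (j : 'I_k) (c : A) (x : 'I_k -> mpser l A) :
  h 0 = 0 -> c * h (munit j) = 1 -> (forall i, x i 0 = 0) ->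
  exists y : mpser l A, y 0 = 0 /\
    mpsubst h (fun i => if i == j then y else x i) = 0.
Proof.
move=> h0 ch x0.
pose X (s : unit -> mpser l A) i := if i == j then s tt else x i.
have X0 s : (forall i, s i 0 = 0) -> forall i, X s i 0 = 0.
  by move=> s0 i; rewrite /X; case: eqP.
pose T (s : unit -> mpser l A) (_ : unit) := s tt - mpC c * mpsubst h (X s).
have [s s0 []|d s t d0 s0 t0 st []|s [s0 sE]] := @mord_fixpoint l A _ T.
- by rewrite /T mpsubE mpCmulE mpsubst0 ?s0 ?h0 ?mulr0 ?subr0 //; apply: X0.
- case: d d0 st => // d _ st.
  have -> : T s tt - T t tt = - (mpC c * (mpsubst h (X s) - mpsubst h (X t)
      - \sum_i mpC (h (munit i)) * (X s i - X t i))).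
    have -> : \sum_i mpC (h (munit i)) * (X s i - X t i) =
        mpC (h (munit j)) * (s tt - t tt).
      rewrite (bigD1 j) //= [X in _ + X]big1 ?addr0 => [|i ij].
        by rewrite /X eqxx.
      by rewrite /X (negPf ij) subrr mulr0.
    by rewrite /T mulrBr [mpC c * (mpC _ * _)]mulrA -rmorphM ch rmorph1; ring.
  apply: wgeN; apply: wgeMl; apply: mpsubst_linear; [exact: X0|exact: X0|].
  move=> i; rewrite /X; case: eqP => // _; rewrite subrr; exact: wge_zero.
exists (s tt); split=> //.
have := congr1 (fun f => f tt) sE; rewrite /T => /eqP.
rewrite subr_eq addrC -subr_eq subrr => /eqP /(congr1 (fun f => mpC (h (munit j)) * f)).
by rewrite mulr0 mulrA -rmorphM mulrC [h _ * c]mulrC ch rmorph1 mulr1.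
Qed.

End Inversion.

(** * Arithmetic of the bounds given by arcs *)

Lemma leq_of_pmul p V w1 n1 e : (0 < p -> p * V <= w1 * (n1 * e) -> n1 <= p -> V <= e * w1)%N.
Proof.
move=> p0 pV np; rewrite -(leq_pmul2l p0); apply: leq_trans pV _.
have -> : (w1 * (n1 * e) = n1 * (e * w1))%N by nia.
by rewrite leq_mul2r np orbT.
Qed.

Lemma ratio_of_mid V n1 e w0 w1 w2 : (1 < n1 -> w1 <= w2 -> V <= e * w1 ->
  n1.+1 * V <= n1 * e * (w0 + w1 + w2))%N.
Proof.
move=> n1g w12 Ve; apply: (@leq_trans (n1.+1 * (e * w1))%N); first by rewrite leq_mul2l Ve orbT.
rewrite -[(n1 * e)%N]mulnC -mulnA mulnCA leq_mul2l; apply/orP; right; nia.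
Qed.

(** The two bounds correspond to [m = w1 / p] and [m' = p w0]. That [m + m' <= w0 + w1] amounts to
    [(p - 1) (w1 - p w0) >= 0]. *)
Lemma ratio_of_contact p V n1 e w0 w1 w2 : (0 < p -> p * w0 <= w1 -> V <= e * (w0 * p + w2) ->
  p * V <= w1 * (n1 * e) -> n1.+1 * V <= n1 * e * (w0 + w1 + w2))%N.
Proof.
move=> p0 pw Vb Va; rewrite -(leq_pmul2l p0).
have H : (n1 * p * V <= n1 * p * (e * (w0 * p + w2)))%N by rewrite leq_mul2l Vb orbT.
have K : (p * (p * w0) + w1 <= p * w0 + p * w1)%N.
  case: p p0 pw {Vb Va H} => // p _ pw; nia.
have L : (n1 * e * (p * (p * w0) + w1) <= n1 * e * (p * w0 + p * w1))%N by rewrite leq_mul2l K orbT.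
nia.
Qed.

(** Here [m = w0] and [m' = w1]; the first bound plus [n1] times the second is the claim. *)
Lemma ratio_of_axis V n1 e w0 w1 w2 : (V <= w0 * (n1 * e) -> V <= e * (w1 + w2) ->
  n1.+1 * V <= n1 * e * (w0 + w1 + w2))%N.
Proof.
move=> Va Vb; have H : (n1 * V <= n1 * (e * (w1 + w2)))%N by rewrite leq_mul2l Vb orbT.
nia.
Qed.

Lemma ratio_of_tangent V n1 e w0 w1 w2 : (1 < n1 -> w0 <= w2 -> w1 <= w2 ->
  V <= e * (w0 + w1) -> n1.+1 * V <= n1 * e * (w0 + w1 + w2))%N.
Proof.
move=> n1g w02 w12 Ve; apply: (@leq_trans (n1.+1 * (e * (w0 + w1)))%N).
  by rewrite leq_mul2l Ve orbT.
rewrite -[(n1 * e)%N]mulnC -mulnA mulnCA leq_mul2l; apply/orP; right; nia.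
Qed.

(** * Series in one variable, the components of arcs *)

Section Univariate.
Variable A : comNzRingType.
Implicit Types g : mpser 1 A.

Lemma midx1E (a : midx 1) : a = munit ord0 *+ mtdeg a.
Proof. by rewrite {1}[a]midx_sumE /mtdeg !big_ord1. Qed.

Lemma mwdot_const k m (a : midx k) : mwdot [ffun=> m] a = (m * mtdeg a)%N.
Proof.
by rewrite /mwdot /mtdeg big_distrr; apply: eq_bigr => i _; rewrite ffunE.
Qed.

Lemma mord_scale k m d (h : mpser k A) : mord d h -> wge [ffun=> m] (m * d) h.
Proof. by move=> hd a /hd; rewrite -mtdegE mwdot_const leq_mul2l orbC => ->. Qed.

Lemma mord_lead p g : mord p g ->
  mord p.+1 (g - mpC (g (munit ord0 *+ p)) * mpmon A (munit ord0 *+ p)).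
Proof.
move=> gp; apply: mordP => a; rewrite ltnS leq_eqVlt mpsubE mpCmulE /mpmon.
case/orP => [/eqP <-|ap]; first by rewrite -midx1E eqxx mulr1 subrr.
rewrite (mord_coef0 gp ap) sub0r; case: eqP => [E|]; last by rewrite mulr0 oppr0.
by move: ap; rewrite E mtdegE mwdotMn mwdot_unit ffunE muln1 ltnn.
Qed.

Lemma mord_order g : g <> 0 -> exists p, mord p g /\ g (munit ord0 *+ p) != 0.
Proof.
move=> g0; have ex : exists p, g (munit ord0 *+ p) != 0.
  apply: contrapT => /forallNP all0; apply: g0; apply/funext => a; rewrite [a]midx1E.
  by apply/eqP; move: (all0 (mtdeg a)) => /negP; rewrite negbK.
case: (ex_minnP ex) => p gp minp; exists p; split=> //.
apply: mordP => a ap; apply/eqP; apply: contraTT ap => ga.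
by rewrite -leqNgt minp // -midx1E.
Qed.

End Univariate.

Lemma ord3P (T : 'I_3 -> Prop) : T i3_0 -> T i3_1 -> T i3_2 -> forall i, T i.
Proof.
move=> T0 T1 T2 [[|[|[|//]]] lt].
- by rewrite (_ : Ordinal lt = i3_0) //; apply: val_inj.
- by rewrite (_ : Ordinal lt = i3_1) //; apply: val_inj.
- by rewrite (_ : Ordinal lt = i3_2) //; apply: val_inj.
Qed.

Lemma sum_ord3 (M : nmodType) (F : 'I_3 -> M) :
  \sum_i F i = F i3_0 + F i3_1 + F i3_2.
Proof.
rewrite !big_ord_recl big_ord0 addr0 addrA.
by congr (F _ + F _ + F _); apply: val_inj.
Qed.

(** * Monomial valuations *)

Section MonomialBound.
Variables (K : fieldType) (n1 e V : nat) (h : mpser 3 K).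
Hypothesis n1_gt1 : (1 < n1)%N.
Variables (q P : 'I_3 -> mpser 3 K) (w : 'I_3 -> nat).

(* Any substitution [th] under which the parameters [q i] get weight at least
   [kap * w i] gives weight at least [kap * V] to [h]. *)
Definition value_test := forall l (om : midx l) (th : 'I_3 -> mpser l K) kap,
  (forall i, th i 0 = 0) ->
  (forall i, wge om (kap * w i) (mpsubst (q i) th)) ->
  wge om (kap * V) (mpsubst h th).

(** Meant for the normal form: on [x_j = 0] the binomial reduces to a power of [z], and every
    monomial above the Newton polygon contains [x_j]. *)
Definition axis_test (j : 'I_3) := forall l (th : 'I_3 -> mpser l K),
  (forall i, th i 0 = 0) -> th j = 0 -> mpsubst h th = th i3_2 ^+ (n1 * e).

(** When [z ^ n1] weighs more than [x_j1 x_j2], the leading form is a constant times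
    [(x_j1 x_j2) ^ e]. The weights [om] only serve to isolate its coefficient and may differ from
    those used in [value_test]. *)
Definition lead_test (j1 j2 : 'I_3) :=
  forall l (om : midx l) (th : 'I_3 -> mpser l K) c1 c2 b1 b2 z,
  (forall i, th i 0 = 0) -> c1 != 0 -> c2 != 0 ->
  (0 < mwdot om b1)%N -> (0 < mwdot om b2)%N ->
  wge om (mwdot om b1).+1 (th j1 - mpC c1 * mpmon K b1) ->
  wge om (mwdot om b2).+1 (th j2 - mpC c2 * mpmon K b2) ->
  wge om z (th i3_2) -> (mwdot om b1 + mwdot om b2 < n1 * z)%N ->
  mpsubst h th ((b1 + b2) *+ e) != 0.

Hypothesis test : value_test.
Hypotheses (q0 : forall i, q i 0 = 0) (P0 : forall i, P i 0 = 0).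
Hypotheses (qP : forall i, mpsubst (q i) P = mpX K i)
           (Pq : forall i, mpsubst (P i) q = mpX K i).
Hypotheses (w01 : (w i3_0 <= w i3_1)%N) (w12 : (w i3_1 <= w i3_2)%N).

Let w02 : (w i3_0 <= w i3_2)%N. Proof. exact: leq_trans w01 w12. Qed.
Let le_w2 i : (w i <= w i3_2)%N.
Proof.
by elim/ord3P: i.
Qed.

Lemma jacPq i j : \sum_s P i (munit s) * q s (munit j) = (i == j)%:R.
Proof.
rewrite -mpsubst_munit // Pq /mpX; congr (nat_of_bool _)%:R.
by apply/eqP/eqP => [/ffunP /(_ j)|->//]; rewrite !ffunE eqxx; case: eqP.
Qed.

Lemma jacqP i j : \sum_s q i (munit s) * P s (munit j) = (i == j)%:R.
Proof.
rewrite -mpsubst_munit // qP /mpX; congr (nat_of_bool _)%:R.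
by apply/eqP/eqP => [/ffunP /(_ j)|->//]; rewrite !ffunE eqxx; case: eqP.
Qed.

Section Transversal.
Variables j1 j2 : 'I_3.
Hypotheses (j12 : j1 != j2) (j1z : j1 != i3_2) (j2z : j2 != i3_2).
Hypotheses (axis : axis_test j1) (lead : lead_test j1 j2).
Hypothesis J2 : q i3_2 (munit j2) != 0.

(** The curve [x_j1 = q i3_2 = 0] can be parametrized by [z], since [q i3_2] has a nonzero
    derivative in [x_j2], and [h] restricts to [z ^ (n1 * e)] on it. The pair [kap], [mu] stands for
    the rational weight [mu / kap] of the parameter. *)
Lemma axis_bound : exists th : 'I_3 -> mpser 1 K,
  [/\ forall i, th i 0 = 0, th j1 = 0, mpsubst (q i3_2) th = 0 &
   forall kap mu, wge [ffun=> mu] (kap * w i3_0) (mpsubst (q i3_0) th) ->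
     wge [ffun=> mu] (kap * w i3_1) (mpsubst (q i3_1) th) ->
     (kap * V <= mu * (n1 * e))%N].
Proof.
pose x i : mpser 1 K := if i == i3_2 then mpX K ord0 else 0.
have x0 i : x i 0 = 0 by rewrite /x; case: ifP => // _; apply: mpX0.
have [y [y0 qy]] := mpser_implicit (q0 i3_2) (mulVf J2) x0.
set th := (fun i => if i == j2 then y else x i) in qy.
have th0 i : th i 0 = 0 by rewrite /th; case: ifP.
have thj : th j1 = 0 by rewrite /th (negPf j12) /x (negPf j1z).
exists th; split=> // kap mu t0 t1; have ht := @axis _ th th0 thj.
have : wge [ffun=> mu] (kap * V) (mpsubst h th).
  by apply: test => //; apply: ord3P => //; rewrite qy; apply: wge_zero.
rewrite ht /th eq_sym (negPf j2z) /x eqxx mpX_mon -mpmonMn.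
move/(_ (munit ord0 *+ (n1 * e))); rewrite /mpmon eqxx oner_eq0 => /(_ isT).
by rewrite mwdotMn mwdot_unit ffunE mulnC [(_ * mu)%N]mulnC.
Qed.

Lemma wge_var_scale (om : midx 2) d (g : mpser 1 K) : mord d g ->
  wge om (om i2_0 * d) (mpsubst g (fun=> mpX K i2_0)).
Proof.
move=> gd; apply: (@wge_mpsubst _ _ _ _ (fun=> om i2_0)) => [i|a /gd].
  exact: wge_X.
rewrite -mtdegE /mtdeg !big_ord1 => ad; exact: leq_mul.
Qed.

(* The test series are [g j1], [g j2 + s], [g i3_2] for a further variable [s]
   of weight [w i3_2]; modulo [s] they define the arc [g]. *)
Lemma arc_bound (g : 'I_3 -> mpser 1 K) p mu z : (0 < p)%N ->
  (forall i, g i 0 = 0) ->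
  (forall i, wge [ffun=> mu] (w i) (mpsubst (q i) g)) ->
  mord p (g j1) -> g j1 (munit ord0 *+ p) != 0 ->
  mord z (g i3_2) -> (p < n1 * z)%N -> (V <= e * (mu * p + w i3_2))%N.
Proof.
move=> p0 g0 qg gp gp0 gz pz.
pose t := mpX K i2_0; pose s := mpX K i2_1.
have t0 (i : 'I_1) : t 0 = 0 by apply: mpX0.
pose G i := mpsubst (g i) (fun=> t).
have G0 i : G i 0 = 0 by rewrite /G mpsubst0.
pose th i := if i == j2 then G i + s else G i.
have th0 i : th i 0 = 0.
  by rewrite /th; case: ifP => _; rewrite ?mpaddE G0 // add0r; apply: mpX0.
(* Two weightings are needed: [om] measures the parameters, [om'] isolates a monomial. Under [om']
   the variable [s] outranks all of [g j2], and [p < n1 * z] becomes [2 p + 1 < 2 n1 z]. *)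
pose om : midx 2 := [ffun i => if i == i2_0 then mu else w i3_2].
pose om' : midx 2 := [ffun i => if i == i2_0 then 2 else 1%N].
have om0 : om i2_0 = mu by rewrite ffunE.
have om1 : om i2_1 = w i3_2 by rewrite ffunE.
have om'0 : om' i2_0 = 2 by rewrite ffunE.
have om'1 : om' i2_1 = 1%N by rewrite ffunE.
have qth i : wge om (1 * w i) (mpsubst (q i) th).
  rewrite mul1n -(subrK (mpsubst (q i) G) (mpsubst (q i) th)); apply: wgeD.
    apply: wge_le (le_w2 i) _; apply: wge_mpsubst_sub => m; rewrite /th.
    case: ifP => _; last by rewrite subrr; apply: wge_zero.
    by rewrite addrC addKr -om1; apply: wge_X.
  rewrite /G -(mpsubst_comp _ g0 t0).
  apply: (@wge_mpsubst _ _ _ _ (fun=> mu)) => [_|a /(qg i)].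
    by rewrite -om0; apply: wge_X.
  by rewrite mwdot_const /mtdeg !big_ord1.
pose b1 : midx 2 := munit i2_0 *+ p; pose b2 : midx 2 := munit i2_1.
have b1E v : mwdot v b1 = (v i2_0 * p)%N by rewrite mwdotMn mwdot_unit mulnC.
have b2E v : mwdot v b2 = v i2_1 by rewrite mwdot_unit.
have : mpsubst h th ((b1 + b2) *+ e) != 0.
  apply: (@lead _ om' th (g j1 (munit ord0 *+ p)) 1 b1 b2 (2 * z)) => //.
  - exact: oner_neq0.
  - by rewrite b1E om'0 muln_gt0.
  - by rewrite b2E om'1.
  - rewrite /th (negPf j12) b1E om'0.
    have -> : mpC (g j1 (munit ord0 *+ p)) * mpmon K b1 =
        mpsubst (mpC (g j1 (munit ord0 *+ p)) * @mpmon 1 K (munit ord0 *+ p)) (fun=> t).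
      rewrite -(mpsE t0) mpsCM mps_mon big_ord1 mulrn_midxE ffunE eqxx muln1.
      by rewrite /b1 mpmonMn.
    rewrite /G -mpsubstB; apply: wge_le (wge_var_scale om' (mord_lead gp)).
    by rewrite om'0; lia.
  - rewrite /th eqxx b2E om'1 rmorph1 mul1r -[mpmon K b2]/s addrK.
    by apply: wge_le (wge_var_scale om' (_ : mord 1 (g j2))); rewrite ?om'0 //; apply/mord1.
  - rewrite /th eq_sym (negPf j2z) -om'0; exact: wge_var_scale.
  - by rewrite b1E b2E om'0 om'1; lia.
have := @test _ om th 1 th0 qth; rewrite mul1n => tV /tV.
by rewrite mwdotMn mwdotD b1E b2E om0 om1.
Qed.

(** What decides is the order [p] of [x_j1] along the curve [q i3_1 = q i3_2 = 0]. If
    [p w_0 <= w_1], contact of order [p] lowers the weight of the axis arc to [w_1 / p]. If [p] is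
    larger or infinite, that arc already carries weight [w_0], and a smooth arc of weight [w_1]
    supplies the other bound. *)
Lemma transversal_bound :
  (n1.+1 * V <= n1 * e * (w i3_0 + w i3_1 + w i3_2))%N.
Proof.
have [th [th0 thj q2th axisV]] := axis_bound.
(* [U] is the axis arc seen in the coordinates [q]; conversely [g] below is the curve
   [q i3_1 = q i3_2 = 0] seen in the original coordinates. *)
pose U i := mpsubst (q i) th.
have U0 i : U i 0 = 0 by rewrite /U mpsubst0.
have U1 i mu : wge [ffun=> mu] mu (U i).
  by have := @mord_scale K 1 mu 1 (U i); rewrite muln1; apply; apply/mord1.
have PU : mpsubst (P j1) U = 0.
  by rewrite /U -(mpsubst_comp _ q0 th0) Pq mpsubstX.
pose x i : mpser 1 K := if i == i3_0 then mpX K ord0 else 0.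
have x0 i : x i 0 = 0 by rewrite /x; case: ifP => // _; apply: mpX0.
pose g i := mpsubst (P i) x.
have g0 i : g i 0 = 0 by rewrite /g mpsubst0.
have qg i : mpsubst (q i) g = x i by rewrite /g -(mpsubst_comp _ P0 x0) qP mpsubstX.
have g1E : g j1 (munit ord0) = P j1 (munit i3_0).
  rewrite /g mpsubst_munit // sum_ord3 /x /= !mp0E !mulr0 !addr0.
  by rewrite /mpX eqxx mulr1.
(* The contact order of [x_j1 = 0] and [q i3_1 = 0] on the surface
   [q i3_2 = 0] is the order of [g j1]. *)
have contact p : mord p (g j1) -> P j1 (munit i3_0) = 0 -> mord p (U i3_1).
  move=> gp Pj0.
  (* Otherwise the linear part of [x_j1] would be a multiple of that of [q i3_2], whose derivative
     in [x_j2] does not vanish. *)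
  have Pj1 : P j1 (munit i3_1) != 0.
    apply: contraNneq J2 => Pj1.
    have := jacPq j1 j1; have := jacPq j1 j2.
    rewrite !sum_ord3 Pj0 Pj1 !mul0r !add0r eqxx (negPf j12) => /eqP.
    by rewrite mulf_eq0 => /orP[/eqP ->|-> //]; rewrite mul0r => /eqP; rewrite eq_sym oner_eq0.
  (* Bootstrapping: linearize [P j1] at [(U i3_0, 0, 0)], where its value is [g j1] at [U i3_0] and
     so has order at least [p]. As [P j1] vanishes on [U], each round gains one order for [U i3_1]
     until [p] is reached. *)
  suff : forall m, mord (minn p m.+1) (U i3_1).
    by move=> /(_ p); rewrite (minn_idPl _).
  elim=> [|m IH]; first by apply: wge_le (geq_minr _ _) _; apply/mord1.
  have [pm|mp] := leqP p m.+1.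
    by apply: wge_le IH; rewrite leq_min geq_minl (leq_trans (geq_minl _ _)).
  rewrite (minn_idPr (ltnW mp)) in IH; rewrite (minn_idPr mp).
  pose U' i := if i == i3_0 then U i3_0 else 0.
  have U'0 i : U' i 0 = 0 by rewrite /U'; case: ifP.
  have UU' i : mord m.+1 (U i - U' i).
    elim/ord3P: i; rewrite /U' /=; rewrite ?subrr; try exact: wge_zero.
      by rewrite subr0.
    by rewrite /U q2th subrr; apply: wge_zero.
  have := @mpsubst_linear _ _ _ (P j1) m U U' U0 U'0 UU'.
  rewrite PU sum_ord3 /U' /= subrr !subr0 mulr0 !add0r [U i3_2]q2th mulr0 addr0.
  have : mord m.+2 (mpsubst (P j1) U').
    have -> : mpsubst (P j1) U' = mpsubst (g j1) (fun=> U i3_0).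
      rewrite /g (mpsubst_comp _ x0 (fun=> U0 i3_0)); congr mpsubst.
      apply/funext => i; rewrite /U' /x; case: ifP => _.
        by rewrite mpsubstX // => ?; apply: U0.
      by rewrite -(mpsE (fun _ : 'I_1 => U0 i3_0)) raddf0.
    by apply: mord_mpsubst => [?|]; [apply: U0|apply: wge_le gp].
  move=> o1 /(wgeD o1); rewrite addrA subrr sub0r => /wgeN; rewrite opprK.
  move/(@wgeMl 1 K _ _ (mpC (P j1 (munit i3_1))^-1) _).
  by rewrite mulrA -rmorphM mulVf // rmorph1 mul1r.
have [[p [gp gp0 pw]]|nop] := pselect (exists p,
    [/\ mord p (g j1), g j1 (munit ord0 *+ p) != 0 & (p * w i3_0 <= w i3_1)%N]).
  have p_gt0 : (0 < p)%N.
    by rewrite lt0n; apply: contraNneq gp0 => ->; rewrite mulr0n g0.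
  have Up : mord p (U i3_1).
    have [p1|p1] := leqP p 1; first by apply: wge_le p1 _; apply/mord1.
    by apply: (contact p gp); rewrite -g1E (mord_coef0 gp) // mtdegE mwdot_unit ffunE.
  have Va : (p * V <= w i3_1 * (n1 * e))%N.
    apply: axisV; first by apply: wge_le pw _; apply: U1.
    by rewrite mulnC; apply: mord_scale.
  (* The moving arc only guarantees order 1 for [z], so it needs [p < n1] to make [z ^ n1]
     negligible. For [p >= n1] the axis bound suffices by itself. *)
  have [pn|pn] := ltnP p n1; last first.
    by apply: (ratio_of_mid _ n1_gt1 w12); exact: leq_of_pmul p_gt0 Va pn.
  have Vb : (V <= e * (w i3_0 * p + w i3_2))%N.
    apply: (@arc_bound g p (w i3_0) 1) => //; last by rewrite muln1.
    - move=> i; rewrite qg /x; case: eqP => [->|_]; last exact: wge_zero.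
      by have := @wge_X 1 K [ffun=> w i3_0] ord0; rewrite ffunE.
    - exact/mord1.
  exact: ratio_of_contact p_gt0 pw Vb Va.
have U2 : P j1 (munit i3_0) = 0 /\ wge [ffun=> w i3_0] (w i3_1) (U i3_1).
  have [g1|g1] := pselect (g j1 = 0).
    have Pj0 : P j1 (munit i3_0) = 0 by rewrite -g1E g1.
    split=> //; suff -> : U i3_1 = 0 by apply: wge_zero.
    apply: mord_eq => m; rewrite subr0; apply: contact => //.
    by rewrite g1; apply: wge_zero.
  have [p [gp gp0]] := mord_order g1.
  have wp : (w i3_1 < p * w i3_0)%N.
    by rewrite ltnNge; apply/negP => pw; apply: nop; exists p.
  have p1 : (1 < p)%N by move: wp; case: (p) => [|[|]] //; lia.
  have Pj0 : P j1 (munit i3_0) = 0.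
    by rewrite -g1E (mord_coef0 gp) // mtdegE mwdot_unit ffunE.
  split=> //; apply: wge_le (mord_scale (w i3_0) (contact p gp Pj0)).
  by rewrite mulnC ltnW.
have Va : (V <= w i3_0 * (n1 * e))%N.
  have := axisV 1%N (w i3_0); rewrite !mul1n; apply; first exact: U1.
  by case: U2.
(* A smooth arc on [q i3_2 = 0] with [z = 0] and parameter [x_j1]. The other two [q i] have order at
   least 1 on it, so weight [w i3_1] serves both. *)
pose x' i : mpser 1 K := if i == j1 then mpX K ord0 else 0.
have x'0 i : x' i 0 = 0 by rewrite /x'; case: ifP => // _; apply: mpX0.
have [y [y0 qy]] := mpser_implicit (q0 i3_2) (mulVf J2) x'0.
set g' := (fun i => if i == j2 then y else x' i) in qy.
have g'0 i : g' i 0 = 0 by rewrite /g'; case: ifP.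
have Vb : (V <= e * (w i3_1 + w i3_2))%N.
  rewrite -[w i3_1]muln1; apply: (@arc_bound g' 1 (w i3_1) 1) => //.
  - have o1 i : wge [ffun=> w i3_1] (w i3_1) (mpsubst (q i) g').
      have := @mord_scale K 1 (w i3_1) 1 (mpsubst (q i) g').
      by rewrite muln1; apply; apply/mord1; rewrite mpsubst0.
    apply: ord3P => //; first exact: wge_le (o1 _).
    by rewrite qy; apply: wge_zero.
  - exact/mord1.
  - by rewrite mulr1n /g' (negPf j12) /x' eqxx /mpX eqxx oner_neq0.
  - exact/mord1.
  - by rewrite muln1.
exact: ratio_of_axis Va Vb.
Qed.

End Transversal.

Hypotheses (axis0 : axis_test i3_0) (axis1 : axis_test i3_1)
  (lead01 : lead_test i3_0 i3_1).

(** On [q i3_2 = 0], with coordinates [q i3_0] and [q i3_1], the function [z] has order at least two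
    while [x_1] and [x_2] have independent linear parts. So [(x_1 x_2) ^ e] leads, and a product of
    two linear monomials gives the bound. *)
Lemma tangent_bound : q i3_2 (munit i3_0) = 0 -> q i3_2 (munit i3_1) = 0 ->
  (V <= e * (w i3_0 + w i3_1))%N.
Proof.
move=> q20 q21.
have [P20 P21] : P i3_2 (munit i3_0) = 0 /\ P i3_2 (munit i3_1) = 0.
  have q22 : q i3_2 (munit i3_2) != 0.
    have := jacqP i3_2 i3_2; rewrite sum_ord3 q20 q21 !mul0r !add0r eqxx => /eqP.
    by apply: contraTneq => ->; rewrite mul0r eq_sym oner_eq0.
  have := jacqP i3_2 i3_1; have := jacqP i3_2 i3_0.
  rewrite !sum_ord3 q20 q21 !mul0r !add0r /= => /eqP; rewrite mulf_eq0 (negPf q22).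
  by move/eqP => -> /eqP; rewrite mulf_eq0 (negPf q22) => /eqP.
pose v i : mpser 2 K :=
  if i == i3_0 then mpX K i2_0 else if i == i3_1 then mpX K i2_1 else 0.
have v0 i : v i 0 = 0 by rewrite /v; do 2?[case: ifP => _] => //; apply: mpX0.
pose th i := mpsubst (P i) v.
have th0 i : th i 0 = 0 by rewrite /th mpsubst0.
have qth i : mpsubst (q i) th = v i by rewrite /th -(mpsubst_comp _ P0 v0) qP mpsubstX.
have th_lin i j : th i (munit j) = P i (munit (if j == i2_0 then i3_0 else i3_1)).
  rewrite /th mpsubst_munit // sum_ord3 /v /= mp0E mulr0 addr0.
  case: j => [[|[|//]] lt].
    rewrite (_ : Ordinal lt = i2_0) /=; last exact: val_inj.
    rewrite /mpX eqxx mulr1; case: eqP => [/ffunP /(_ i2_0)|]; first by rewrite !ffunE.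
    by rewrite mulr0 addr0.
  rewrite (_ : Ordinal lt = i2_1) /=; last exact: val_inj.
  rewrite /mpX eqxx mulr1; case: eqP => [/ffunP /(_ i2_0)|]; first by rewrite !ffunE.
  by rewrite mulr0 add0r.
(* Weights 2 and 3 rank the two variables strictly, and terms of degree two, of weight at least 4,
   stay behind both. *)
pose om : midx 2 := [ffun i => if i == i2_0 then 2 else 3%N].
have om0 : om i2_0 = 2 by rewrite ffunE.
have om1 : om i2_1 = 3 by rewrite ffunE.
have om_ge m (g : mpser 2 K) : mord m g -> wge om (2 * m) g.
  move=> gm a /gm; rewrite -mtdegE => ma; apply: leq_trans (leq_mul (leqnn 2) ma) _.
  rewrite /mtdeg /mwdot big_distrr leq_sum // => i _; rewrite leq_mul2r ffunE.
  by case: ifP; rewrite orbT.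
have tail i : wge om 4 (th i - mpC (P i (munit i3_0)) * mpmon K (munit i2_0)
                             - mpC (P i (munit i3_1)) * mpmon K (munit i2_1)).
  have := om_ge 2 _ (mord2_affine (h := th i)).
  rewrite th0 rmorph0 subr0 !big_ord_recl big_ord0 addr0 opprD addrA !th_lin.
  by congr (wge _ _ (_ - mpC (P _ (munit _)) * mpmon _ _
    - mpC (P _ (munit _)) * mpmon _ _)).
have lead i : i = i3_0 \/ i = i3_1 -> exists c b, [/\ c != 0,
    wge om (mwdot om b).+1 (th i - mpC c * mpmon K b) &
    b = munit i2_0 \/ b = munit i2_1 /\ P i (munit i3_0) = 0].
  move=> i01; have [Pi0|Pi0] := eqVneq (P i (munit i3_0)) 0; last first.
    exists (P i (munit i3_0)), (munit i2_0); split=> //; last by left.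
    rewrite mwdot_unit om0.
    rewrite -(subrK (mpC (P i (munit i3_1)) * mpmon K (munit i2_1)) (th i - _)).
    apply: wgeD; first exact: wge_le (tail i).
    by apply: wgeMl; have := @wge_X 2 K om i2_1; rewrite om1.
  have Pi1 : P i (munit i3_1) != 0.
    apply/eqP => Pi1; have := jacPq i i.
    rewrite sum_ord3 Pi0 Pi1 !mul0r !add0r eqxx.
    by case: i01 => ->; rewrite (q20, q21) mulr0 => /eqP; rewrite eq_sym oner_eq0.
  exists (P i (munit i3_1)), (munit i2_1); split=> //; last by right.
  by have := tail i; rewrite Pi0 rmorph0 mul0r subr0 mwdot_unit om1.
have [c0 [b0 [c0n lead0 b0E]]] := lead i3_0 (or_introl erefl).
have [c1 [b1 [c1n lead1 b1E]]] := lead i3_1 (or_intror erefl).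
have om_b b (Q : Prop) : b = munit i2_0 \/ b = munit i2_1 /\ Q -> (2 <= mwdot om b <= 3)%N.
  by case=> [->|[-> _]]; rewrite mwdot_unit (om0, om1).
have /andP[b0l b0g] := om_b _ _ b0E; have /andP[b1l b1g] := om_b _ _ b1E.
have b01 : (mwdot om b0 + mwdot om b1 < 8)%N by lia.
have hth : mpsubst h th ((b0 + b1) *+ e) != 0.
  apply: (@lead01 _ om th c0 c1 b0 b1 4) => //; try lia.
  apply: (om_ge 2); have := @mord2_affine _ _ (th i3_2).
  rewrite th0 rmorph0 subr0 !big_ord_recl big_ord0 addr0 !th_lin /= P20 P21.
  by rewrite rmorph0 !mul0r addr0 subr0.
pose om2 : midx 2 := [ffun i => if i == i2_0 then w i3_0 else w i3_1].
have om20 : om2 i2_0 = w i3_0 by rewrite ffunE.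
have om21 : om2 i2_1 = w i3_1 by rewrite ffunE.
have : wge om2 (1 * V) (mpsubst h th).
  apply: test => //; apply: ord3P; rewrite qth /v /= ?mul1n.
  - by rewrite -om20; apply: wge_X.
  - by rewrite -om21; apply: wge_X.
  - exact: wge_zero.
move/(_ _ hth); rewrite mul1n mwdotMn mwdotD => Vle; apply: leq_trans Vle _.
rewrite leq_mul2l; apply/orP; right.
(* If both leading variables are the first one, [w i3_0 <= w i3_1] gives the bound; both being the
   second would contradict the independence of the linear parts. *)
case: b0E b1E => [->|[-> P00]] [->|[-> P10]]; rewrite !mwdot_unit ?om20 ?om21 ?leq_add2l //.
- by rewrite addnC.
have := jacqP i3_0 i3_0; rewrite sum_ord3 P00 P10 P20 !mulr0 !addr0 eqxx => /eqP.
by rewrite eq_sym oner_eq0.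
Qed.

Lemma monomial_bound : (n1.+1 * V <= n1 * e * (w i3_0 + w i3_1 + w i3_2))%N.
Proof.
have lead10 : lead_test i3_1 i3_0.
  move=> l om th c1 c2 b1 b2 z th0 c10 c20 b10 b20 t1 t2 tz lt.
  by rewrite addrC; apply: (@lead01 _ _ _ _ _ _ _ _ th0 c20 c10 b20 b10 t2 t1 tz); rewrite addnC.
have [J1|] := eqVneq (q i3_2 (munit i3_1)) 0; last first.
  by apply: (@transversal_bound i3_0 i3_1).
have [J0|] := eqVneq (q i3_2 (munit i3_0)) 0; last first.
  by apply: (@transversal_bound i3_1 i3_0).
exact: ratio_of_tangent n1_gt1 w02 w12 (tangent_bound J0 J1).
Qed.

End MonomialBound.

(** * Series in two variables and substitution of scaled powers *)

Definition mk2 (x y : nat) : midx 2 := [ffun i => if i == i2_0 then x else y].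

Lemma mk2_0 x y : mk2 x y i2_0 = x. Proof. by rewrite ffunE. Qed.

Lemma mk2_1 x y : mk2 x y i2_1 = y. Proof. by rewrite ffunE. Qed.

Lemma ord2P (T : 'I_2 -> Prop) : T i2_0 -> T i2_1 -> forall i, T i.
Proof.
move=> T0 T1 [[|[|//]] lt].
- by rewrite (_ : Ordinal lt = i2_0) //; apply: val_inj.
- by rewrite (_ : Ordinal lt = i2_1) //; apply: val_inj.
Qed.

Lemma midx2P (a b : midx 2) : a i2_0 = b i2_0 -> a i2_1 = b i2_1 -> a = b.
Proof. by move=> e0 e1; apply/ffunP; apply: ord2P. Qed.

Lemma mk2E (a : midx 2) : a = mk2 (a i2_0) (a i2_1).
Proof. by apply: midx2P; rewrite ffunE. Qed.

Lemma leq_sub_antisym (a b c : nat) :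
  (a <= c -> b <= a + b - c -> c <= a + b -> c = a)%N.
Proof. lia. Qed.

(** The product of the lexicographically least monomials of [f] and [g] receives a single
    contribution in [f * g]. *)
Lemma mpser2_domain (A : idomainType) (f g : mpser 2 A) :
  f * g = 0 -> f = 0 \/ g = 0.
Proof.
have lex (h : mpser 2 A) : h <> 0 -> exists2 a, h a != 0 & forall b, h b != 0 ->
    (a i2_0 <= b i2_0)%N /\ (b i2_0 = a i2_0 -> a i2_1 <= b i2_1)%N.
  move=> h0; have ex : exists x, `[< exists y, h (mk2 x y) != 0 >].
    apply: contrapT => /forallNP z; apply: h0; apply/funext => a.
    apply/eqP; apply: contrapT => /negP ha; apply: (z (a i2_0)).
    by apply/asboolP; exists (a i2_1); rewrite -mk2E.
  case: (ex_minnP ex) => x /asboolP exy minx.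
  case: (ex_minnP exy) => y hxy miny; exists (mk2 x y) => // b hb.
  rewrite mk2_0 mk2_1; split=> [|bx].
    by apply: minx; apply/asboolP; exists (b i2_1); rewrite -mk2E.
  by apply: miny; rewrite -bx -mk2E.
move=> fg0; have [f0|/lex[a fa mina]] := pselect (f = 0); first by left.
have [g0|/lex[b gb minb]] := pselect (g = 0); first by right.
have /eqP := congr1 (fun h : mpser 2 A => h (a + b)) fg0.
rewrite mp0E mpmulE (bigD1_seq a) ?mbelow_uniq ?mem_mbelow ?mle_addr //= maddK.
rewrite big1_seq ?addr0 => [|c /andP[ca]]; first by rewrite mulf_eq0 (negPf fa) (negPf gb).
rewrite mem_mbelow => /mleP cab; apply/eqP; apply: contraNT ca.
rewrite mulf_eq0 => /norP[/mina[a0 a1] /minb[b0 b1]]; apply/eqP.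
have := cab i2_0; have := cab i2_1; move: b0 b1; rewrite !msubE !maddE => b0 b1 ab1 ab0.
have e0 := leq_sub_antisym a0 b0 ab0.
apply: midx2P => //; apply: leq_sub_antisym (a1 e0) _ ab1.
by apply: b1; rewrite e0 addKn.
Qed.

Section MonomialSubst.
Variables (k : nat) (A : comNzRingType) (z : 'I_k -> A) (m : nat).

(** One formula for two substitutions: the ramification [s_i ^ n], with all scalars 1, and the
    conjugations, with roots of unity as scalars and exponent 1. *)
Lemma mpsubst_scaleE (h : mpser k A) c :
  mpsubst h (fun i => mpC (z i) * mpX A i ^+ m.+1) c =
  if [forall i, (m.+1 %| c i)%N] then
    (\prod_i z i ^+ (c i %/ m.+1)) * h [ffun i => (c i %/ m.+1)%N] else 0.
Proof.
set u := fun i => _.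
have uE (a : midx k) : \prod_i u i ^+ a i =
    mpC (\prod_i z i ^+ a i) * mpmon A (a *+ m.+1).
  rewrite mpmonMn mpmon_prod rmorph_prod -prodrXl -big_split.
  by apply: eq_bigr => i _; rewrite /u exprMn rmorphXn exprAC.
transitivity (\sum_(a <- midx_lt k (mtdeg c).+1)
    h a * ((\prod_i z i ^+ a i) * (c == a *+ m.+1)%:R)).
  apply: eq_bigr => a _; congr (_ * _); 
  have -> : (c == a *+ m.+1)%:R = mpmon A (a *+ m.+1) c by [].
  rewrite -mpCmulE. exact (f_equal (fun f : mpser k A => f c) (uE a)).
case: ifPn => [/forallP dc|ndc]; last first.
  rewrite big1 // => a _; case: eqP => [cE|_]; last by rewrite !mulr0.
  by case/negP: ndc; apply/forallP => i; rewrite cE mulrn_midxE dvdn_mulr.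
set d := [ffun i => _].
have cE : c = d *+ m.+1 by apply/ffunP => i; rewrite mulrn_midxE ffunE mulnC divnK.
have dc' : (mtdeg d <= mtdeg c)%N.
  by rewrite [X in (_ <= mtdeg X)%N]cE !mtdegE mwdotMn leq_pmull.
rewrite (bigD1_seq d) ?midx_lt_uniq ?mem_midx_lt //= -cE eqxx mulr1.
rewrite [X in _ + X]big1 ?addr0 => [|a ad].
  by rewrite [LHS]mulrC; congr (_ * _); apply: eq_bigr => i _; rewrite ffunE.
case: eqP => [cE'|_]; last by rewrite !mulr0.
case/eqP: ad; apply/ffunP => i; have := congr1 (fun f : midx k => f i) cE'.
by rewrite {1}cE !mulrn_midxE => /eqP; rewrite eqn_pmul2l // => /eqP.
Qed.

End MonomialSubst.

Lemma mpramE k (A : comNzRingType) m (h : mpser k A) :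
  mpram m.+1 h = mpsubst h (fun i => mpX A i ^+ m.+1).
Proof.
apply/funext => c; have -> : (fun i => mpX A i ^+ m.+1) =
    (fun i : 'I_k => mpC 1 * mpX A i ^+ m.+1).
  by apply/funext => i; rewrite rmorph1 mul1r.
rewrite mpsubst_scaleE /mpram; case: ifP => // _.
by rewrite big1 ?mul1r // => i _; rewrite expr1n.
Qed.

(** * Convergent power series *)

Section Convergence.
Variable R : realType.
Local Notation C := (R[i]).
Variable k : nat.
Implicit Types f g h : mpser k C.

Lemma convergentP h : convergent h ->
  exists M r : C, [/\ 0 <= M, 0 <= r & forall a, `|h a| <= M * r ^+ mtdeg a].
Proof.
case=> M [r hM]; exists `|M|, `|r|; split=> // a.
by rewrite -normrX -normrM (le_trans (hM a)) // real_ler_norm // (ger0_real (le_trans _ (hM a))).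
Qed.

Lemma convergentD f g : convergent f -> convergent g -> convergent (f + g).
Proof.
move=> /convergentP[M [r [M0 r0 fM]]] /convergentP[N [s [N0 s0 gN]]].
exists (M + N), (r + s) => a; rewrite mpaddE; apply: le_trans (ler_normD _ _) _.
rewrite mulrDl; apply: lerD.
  by apply: le_trans (fM a) _; rewrite ler_wpM2l // lerXn2r ?nnegrE ?addr_ge0 ?lerDl.
by apply: le_trans (gN a) _; rewrite ler_wpM2l // lerXn2r ?nnegrE ?addr_ge0 ?lerDr.
Qed.

Lemma convergentN f : convergent f -> convergent (- f).
Proof. by case=> M [r fM]; exists M, r => a; rewrite mpoppE normrN. Qed.

Lemma convergent_mpmon (b : midx k) : convergent (mpmon C b).
Proof.
exists 1, 1 => a; rewrite expr1n mulr1 /mpmon.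
by case: eqP; rewrite ?normr1 ?normr0 ?ler01.
Qed.

Lemma convergent0 : convergent (0 : mpser k C).
Proof. by exists 0, 0 => a; rewrite mp0E normr0 mul0r. Qed.

Lemma size_mbelow (a : midx k) : (size (mbelow a) <= (2 ^ k) ^ mtdeg a)%N.
Proof.
rewrite size_filter (leq_trans (count_size _ _)) //.
rewrite size_filter (leq_trans (count_size _ _)) // size_map -cardE card_ffun !card_ord.
rewrite (_ : (2 ^ k) ^ mtdeg a = (2 ^ mtdeg a) ^ k)%N; last by rewrite expnAC.
move: (mtdeg a) => d; elim: k => // j IH.
by rewrite !expnS leq_mul // ltn_expl.
Qed.

(** At most [(2 ^ k) ^ mtdeg a] indices lie below [a], so the number of summands is absorbed into
    the geometric rate. *)
Lemma convergentM f g : convergent f -> convergent g -> convergent (f * g).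
Proof.
move=> /convergentP[M [r [M0 r0 fM]]] /convergentP[N [s [N0 s0 gN]]].
exists (M * N), ((r + s) *+ 2 ^ k) => a; rewrite mpmulE.
apply: le_trans (ler_norm_sum _ _ _) _.
apply: (@le_trans _ _ (\sum_(b <- mbelow a) M * N * (r + s) ^+ mtdeg a)).
  rewrite big_seq [leRHS]big_seq; apply: ler_sum => b; rewrite mem_mbelow => ba.
  rewrite normrM (le_trans (ler_pM _ _ (fM b) (gN _))) //.
  rewrite mulrACA ler_wpM2l ?mulr_ge0 // -(msubK ba) mtdegD exprD maddK.
  by apply: ler_pM; rewrite ?exprn_ge0 // lerXn2r ?nnegrE ?addr_ge0 ?lerDl ?lerDr.
rewrite big_const_seq count_predT iter_addr_0 -mulrnAr ler_wpM2l ?mulr_ge0 //.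
rewrite -mulr_natr exprMn_n -[leRHS]mulr_natr ler_wpM2l ?exprn_ge0 ?addr_ge0 //.
by rewrite ler_nat size_mbelow.
Qed.

Lemma convergent_mpC (c : C) : convergent (mpC c : mpser k C).
Proof.
exists `|c|, 1 => a; rewrite expr1n mulr1 /mpC.
by case: eqP; rewrite ?mulr1n ?mulr0n ?normr0.
Qed.

End Convergence.

Lemma prim_root_exists (F : numClosedFieldType) n :
  (0 < n)%N -> exists z : F, n.-primitive_root z.
Proof.
pose p : {poly F} := 'X^n - 1; have [r Dp] := closed_field_poly_normal p.
move=> n_gt0; rewrite (monicP _) ?monicXnsubC // scale1r in Dp.
have rn1: all n.-unity_root r by apply/allP=> z; rewrite -root_prod_XsubC -Dp.
have sz_r: (n < (size r).+1)%N.
  by rewrite -(size_prod_XsubC r id) -Dp size_XnsubC.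
have [|z] := hasP (has_prim_root n_gt0 rn1 _ sz_r); last by exists z.
by rewrite -separable_prod_XsubC -Dp separable_Xn_sub_1 // pnatr_eq0 -lt0n.
Qed.

(** * Conjugates of a fractional root *)

(** The absence of zero divisors is a plain hypothesis on a commutative ring, to be supplied by
    [mpser2_domain]. *)
Lemma prod_XsubC_dvd (A : comNzRingType) (p : {poly A}) (rs : seq A) :
  (forall x y : A, x * y = 0 -> x = 0 \/ y = 0) ->
  all (root p) rs -> uniq rs -> exists q, p = q * \prod_(r <- rs) ('X - r%:P).
Proof.
move=> dom; elim: rs => [|r rs IH] /=.
  by exists p; rewrite big_nil mulr1.
case/andP=> pr prs /andP[rrs /(IH prs)[q pE]].
have nz : \prod_(s <- rs) (r - s) <> 0.
  elim: rs rrs {IH prs pE} => [|s rs IH]; first by rewrite big_nil => _ /eqP; rewrite oner_eq0.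
  rewrite inE big_cons negb_or => /andP[rs_ rrs] /dom[/eqP|]; last exact: IH.
  by rewrite subr_eq0 (negPf rs_).
have /factor_theorem[q' qE] : root q r.
  move: pr; rewrite pE rootE hornerM horner_prod => /eqP.
  under eq_bigr do rewrite hornerXsubC.
  by case/dom => [/eqP|/nz].
by exists q'; rewrite big_cons mulrA -qE.
Qed.

Section ConvergentPoly.
Variable R : realType.
Local Notation C := (R[i]).
Implicit Types p q : {poly mpser 2 C}.

Lemma conv_poly_prod_XsubC (rs : seq (mpser 2 C)) :
  (forall r, r \in rs -> convergent r) ->
  conv_poly (\prod_(r <- rs) ('X - r%:P)).
Proof.
elim: rs => [|r rs IH] crs.
  rewrite big_nil => i; rewrite coef1; case: (i == 0%N).
    by rewrite mulr1n; apply: (convergent_mpmon R (0 : midx 2)).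
  by rewrite mulr0n; apply: convergent0.
have {}IH : conv_poly (\prod_(r <- rs) ('X - r%:P)).
  by apply: IH => s srs; apply: crs; rewrite inE srs orbT.
have cr : convergent r by apply: crs; rewrite inE eqxx.
rewrite big_cons => i; rewrite mulrBl coefB coefXM coefCM.
apply: convergentD; first by case: eqP => _; [exact: convergent0|apply: IH].
by apply: convergentN; apply: convergentM.
Qed.

(** Descending induction on the degree: as [d] is monic, each coefficient of [q] is one of [p] minus
    products of coefficients of [d] with higher coefficients of [q]. *)
Lemma conv_poly_quotient p q d : conv_poly d -> d \is monic -> conv_poly p ->
  p = q * d -> conv_poly q.
Proof.
move=> cd dm cp pE; have d0 : d != 0 by apply: monic_neq0.
pose s := (size d).-1.
have IH m : forall i, (size q <= i + m)%N -> convergent q`_i.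
  elim: m => [|m IH] i; first by rewrite addn0 => /leq_sizeP -> //; apply: convergent0.
  move=> qi; have /eqP := congr1 (fun h : {poly mpser 2 C} => h`_(i + s)) pE.
  rewrite coefM -(big_mkord xpredT (fun j => q`_j * d`_(i + s - j))).
  rewrite (big_cat_nat (n := i)) //=; last by rewrite ltnW // ltnS leq_addr.
  rewrite big_nat_cond big1 ?add0r => [|j /andP[/andP[_ ji] _]]; last first.
    by rewrite [d`_ _]nth_default ?mulr0 // (polySpred d0) -/s; move: ji; clear; lia.
  rewrite big_ltn ?ltnS ?leq_addr // addKn -[d`_s]/(lead_coef d) (monicP dm) mulr1.
  rewrite -subr_eq => /eqP <-; apply: convergentD; first exact: cp.
  apply: convergentN; rewrite big_nat_cond.
  apply: (big_ind (@convergent R 2)); [exact: convergent0|exact: convergentD|].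
  move=> j /andP[/andP[ij _] _]; apply: convergentM => //; apply: IH; lia.
by move=> i; apply: (IH (size q)); rewrite leq_addl.
Qed.

Lemma conv_poly_unit_monic p : p \is monic -> conv_poly_unit p -> size p = 1%N.
Proof.
move=> pm [g _ pg]; have g0 : g != 0.
  by apply: contra_eq_neq pg => ->; rewrite mulr0 eq_sym oner_neq0.
have := congr1 (fun h : {poly mpser 2 C} => size h) pg.
rewrite size_monicM // size_poly1.
by move: (monic_neq0 pm) g0; rewrite -!size_poly_gt0; lia.
Qed.

End ConvergentPoly.

Section Conjugates.
Variables (R : realType) (n' : nat).
Local Notation C := (R[i]).
Local Notation n := n'.+1.
Variable om : C.
Hypothesis om_prim : n.-primitive_root om.

(** The automorphism multiplying [s_1] by [om ^ i] and [s_2] by [om ^ j]; the exponent 1 fits the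
    shape of [mpsubst_scaleE] at [m = 0]. *)
Definition galconj_var i j (m : 'I_2) : mpser 2 C :=
  mpC (if m == i2_0 then om ^+ i else om ^+ j) * mpX C m ^+ 1.

Lemma galconj_var0 i j m : galconj_var i j m 0 = 0.
Proof. by rewrite /galconj_var expr1 mpCmulE mpX0 mulr0. Qed.

Definition galconj i j := mps (galconj_var0 i j).

Lemma galconjE i j (h : mpser 2 C) a :
  galconj i j h a = om ^+ (i * a i2_0 + j * a i2_1) * h a.
Proof.
rewrite /galconj mpsE mpsubst_scaleE (_ : [forall _, _] = true); last first.
  by apply/forallP => m; rewrite dvd1n.
have -> : [ffun m => (a m %/ 1)%N] = a by apply/ffunP => m; rewrite ffunE divn1.
congr (_ * _); rewrite exprD !exprM !big_ord_recl big_ord0 mulr1 !divn1.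
by congr (_ ^+ a _ * _ ^+ a _); apply: val_inj.
Qed.

Lemma galconj_mod i j : galconj i j =1 galconj (i %% n) (j %% n).
Proof.
move=> h; apply/funext => a; rewrite !galconjE !exprD !exprM.
by rewrite !(prim_expr_mod om_prim).
Qed.

Lemma galconjD i j k l h : galconj k l (galconj i j h) = galconj (i + k) (j + l) h.
Proof.
apply/funext => a; rewrite !galconjE mulrA -exprD; congr (_ ^+ _ * _); ring.
Qed.

Lemma om_neq0 : om != 0.
Proof.
apply/eqP => om0; have := prim_expr_order om_prim.
by rewrite om0 expr0n => /eqP; rewrite eq_sym oner_eq0.
Qed.

Lemma galconj_inj i j : injective (galconj i j).
Proof.
move=> g h gh; apply/funext => a.
have := congr1 (fun f : mpser 2 C => f a) gh.
by rewrite !galconjE => /(mulfI (expf_neq0 _ om_neq0)).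
Qed.

Definition ram_var (m : 'I_2) : mpser 2 C := mpX C m ^+ n.

Lemma ram_var0 m : ram_var m 0 = 0.
Proof. by rewrite /ram_var exprS mpc0M mpX0 mul0r. Qed.

Definition ram := mps ram_var0.

Lemma ramE : mpram n = ram :> (mpser 2 C -> mpser 2 C).
Proof. by apply/funext => h; rewrite mpramE. Qed.

Lemma ram_coef (h : mpser 2 C) b : ram h (b *+ n) = h b.
Proof.
rewrite -ramE /mpram ifT; last by apply/forallP => m; rewrite mulrn_midxE dvdn_mulr.
by congr (h _); apply/ffunP => m; rewrite ffunE mulrn_midxE mulKn.
Qed.

Lemma ram_coef0 (h : mpser 2 C) a : ram h a != 0 ->
  exists2 b, a = b *+ n & h b != 0.
Proof.
rewrite -ramE /mpram; case: ifPn => [/forallP na hb|]; last by rewrite eqxx.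
exists [ffun i => (a i %/ n)%N] => //; apply/ffunP => m.
by rewrite mulrn_midxE ffunE mulnC divnK.
Qed.

Lemma ram_inj : injective ram.
Proof.
move=> g h gh; apply/funext => b; by rewrite -[LHS]ram_coef gh ram_coef.
Qed.

Lemma galconj_ram i j h : galconj i j (ram h) = ram h.
Proof.
apply/funext => a; rewrite galconjE; have [->|/ram_coef0[b -> _]] := eqVneq (ram h a) 0.
  by rewrite mulr0.
rewrite !mulrn_midxE [(i * _)%N]mulnCA [(j * _)%N]mulnCA -mulnDr exprM.
by rewrite (prim_expr_order om_prim) expr1n mul1r.
Qed.

(** Each coefficient is multiplied by a power of the primitive root [om], so invariance leaves only
    exponents divisible by [n]. *)
Lemma galconj_fixed_ram (h : mpser 2 C) : galconj 1 0 h = h -> galconj 0 1 h = h ->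
  exists g, h = ram g.
Proof.
move=> h10 h01; exists (fun b => h (b *+ n)); apply/funext => a.
have dv (m : 'I_2) : h a != 0 -> (n %| a m)%N.
  move=> ha; rewrite (prim_order_dvd om_prim); apply/eqP/(mulIf ha); rewrite mul1r.
  elim/ord2P: m.
    by rewrite -{2}h10 galconjE mul1n mul0n addn0.
  by rewrite -{2}h01 galconjE mul1n mul0n.
rewrite -ramE /mpram; case: ifPn => [/forallP na|na].
  by congr (h _); apply/ffunP => m; rewrite mulrn_midxE ffunE mulnC divnK.
by apply/eqP; apply: contraNT na => ha; apply/forallP => m; apply: dv.
Qed.

Lemma convergent_conj i j h : convergent h -> convergent (galconj i j h).
Proof.
case=> M [r hM]; exists M, r => a; rewrite galconjE normrM normrX.
have -> : `|om| = 1.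
  apply/eqP; rewrite -(@pexpr_eq1 _ _ n) ?normr_ge0 // -normrX.
  by rewrite (prim_expr_order om_prim) normr1.
by rewrite expr1n mul1r.
Qed.

Lemma convergent_unram h : convergent (ram h) -> convergent h.
Proof.
case=> M [r hM]; exists M, (r ^+ n) => b.
by have := hM (b *+ n); rewrite ram_coef !mtdegE mwdotMn exprM.
Qed.

(** The product over the distinct conjugates is invariant, so it comes from a convergent polynomial
    over the base ring; that polynomial divides [f], and irreducibility makes it [f]. *)
Lemma conj_factorization (f : {poly mpser 2 C}) (zeta : mpser 2 C) :
  conv_poly f -> f \is monic -> conv_poly_irreducible f ->
  convergent zeta -> root (map_poly ram f) zeta ->
  exists rs : seq (mpser 2 C), [/\ size rs = (size f).-1,
    forall r, r \in rs -> exists i j, r = galconj i j zeta &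
    map_poly ram f = \prod_(r <- rs) ('X - r%:P)].
Proof.
move=> cf fm [_ _ irr] cz fz.
pose rs := undup [seq galconj i j zeta | i <- iota 0 n, j <- iota 0 n].
have mem_rs r : reflect (exists i j, r = galconj i j zeta) (r \in rs).
  rewrite mem_undup; apply: (iffP allpairsP) => [[[i j] [_ _ ->]]|[i [j ->]]].
    by exists i, j.
  exists (i %% n, j %% n)%N; rewrite !mem_iota !add0n /= !ltn_pmod //.
  by split=> //; apply: galconj_mod.
pose P := \prod_(r <- rs) ('X - r%:P).
have Pm : P \is monic by apply: monic_prod_XsubC.
have conjP k l : map_poly (galconj k l) P = P.
  rewrite /P rmorph_prod /=; under eq_bigr do rewrite map_polyXsubC.
  rewrite -(big_map (galconj k l) xpredT (fun r => 'X - r%:P)); apply: perm_big.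
  have sub : {subset map (galconj k l) rs <= rs}.
    move=> _ /mapP[r /mem_rs[i [j ->]] ->]; rewrite galconjD; apply/mem_rs.
    by exists (i + k)%N, (j + l)%N.
  have u : uniq (map (galconj k l) rs) by rewrite (map_inj_uniq (@galconj_inj k l)) undup_uniq.
  have [] := uniq_min_size u sub; first by rewrite size_map.
  by move=> _ eqs; apply: uniq_perm; rewrite // undup_uniq.
have Pcoef i : exists g, P`_i = ram g.
  have Pinv k l : galconj k l P`_i = P`_i by rewrite -[in RHS](conjP k l) coef_map.
  exact: galconj_fixed_ram.
have [g gE] := choice Pcoef.
pose P0 := \poly_(i < size P) g i.
have P0E : map_poly ram P0 = P.
  apply/polyP => i; rewrite coef_map coef_poly /=; case: ifP => [_|].
    exact/esym/gE.
  by move/negbT; rewrite -leqNgt => /leq_sizeP ->; rewrite ?raddf0.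
have size_ram (p : {poly mpser 2 C}) : size (map_poly ram p) = size p.
  by rewrite size_map_inj_poly //; [exact: @ram_inj|exact: raddf0].
have P0m : P0 \is monic.
  apply/eqP; apply: ram_inj; rewrite [RHS](rmorph1 ram) -(monicP Pm) -P0E.
  by rewrite lead_coef_map_inj //; [exact: @ram_inj|exact: raddf0].
have [q fP] : exists q, map_poly ram f = q * P.
  apply: prod_XsubC_dvd; [exact: mpser2_domain| |exact: undup_uniq].
  apply/allP => r /mem_rs[i [j ->]]; have := rmorph_root (galconj i j) fz.
  rewrite -map_poly_comp; congr (root _ _); apply: eq_map_poly => h /=.
  exact: galconj_ram.
(* Divisibility is known only after ramification. Division with remainder by the monic [P0],
   compared in degree with the ramified quotient, brings it down to the base ring. *)
pose q0 := Pdiv.Ring.rdivp f P0; pose r0 := Pdiv.Ring.rmodp f P0.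
have fE : f = q0 * P0 + r0 by apply: Pdiv.RingMonic.rdivp_eq.
have r0lt : (size r0 < size P0)%N by rewrite Pdiv.Ring.ltn_rmodpN0 ?monic_neq0.
have r00 : r0 = 0.
  have : (q - map_poly ram q0) * P = map_poly ram r0.
    by rewrite mulrBl -fP {1}fE rmorphD rmorphM /= P0E addrC addKr.
  have [->|qq] := eqVneq (q - map_poly ram q0) 0.
    rewrite mul0r => /esym /eqP; rewrite -size_poly_eq0 size_ram size_poly_eq0.
    by move/eqP.
  move/(congr1 (fun p : {poly _} => size p)); rewrite size_ram size_Mmonic // -P0E size_ram.
  move=> szE; exfalso; move: qq r0lt szE; rewrite -size_poly_gt0.
  by move: (size (q - _)) (size P0) (size r0); clear; lia.
rewrite r00 addr0 in fE.
have cP : conv_poly P.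
  by apply: conv_poly_prod_XsubC => r /mem_rs[i [j ->]]; apply: convergent_conj.
have cP0 : conv_poly P0.
  move=> i; apply: convergent_unram.
  by rewrite -[ram _](coef_map ram) P0E.
have cq0 := conv_poly_quotient cP0 P0m cf fE.
have sP : size P0 = (size rs).+1 by rewrite -size_ram P0E size_prod_XsubC.
have rs_gt0 : (0 < size rs)%N.
  have : zeta \in rs.
    by apply/mem_rs; exists 0%N, 0%N; apply/funext => a; rewrite galconjE !mul0n mul1r.
  by case: (rs).
have q01 : q0 = 1.
  have q0m : q0 \is monic by rewrite -(monicMr _ P0m) -fE.
  have [u|u] := irr _ _ cq0 cP0 fE; last first.
    by move: (conv_poly_unit_monic P0m u); rewrite sP; lia.
  have /eqP := conv_poly_unit_monic q0m u; case/size_poly1P => c c0 qc.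
  by move: q0m; rewrite qc monicE lead_coefC => /eqP ->.
rewrite q01 mul1r in fE.
exists rs; split; [by rewrite fE sP|by move=> r /mem_rs|].
by rewrite fE P0E.
Qed.

End Conjugates.

(** * Normal form *)

(** The coefficients of a split monic polynomial are homogeneous in its roots. *)
Lemma coef_prod_XsubC_scale (A : comNzRingType) (I : eqType) (rs : seq I)
    (F : I -> A) (W : A) i : (i <= size rs)%N ->
  (\prod_(r <- rs) ('X - (W * F r)%:P))`_i =
  W ^+ (size rs - i) * (\prod_(r <- rs) ('X - (F r)%:P))`_i.
Proof.
elim: rs i => [|r rs IH] i; first by rewrite !big_nil leqn0 => /eqP ->; rewrite expr0 mul1r.
rewrite !big_cons ![in LHS]mulrBl ![in RHS]mulrBl !coefB !coefXM !coefCM /= => iS.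
rewrite mulrBr; congr (_ - _).
  by case: i iS => [|i] iS; rewrite /= ?mulr0 // IH // subSS.
have [ir|ir] := leqP i (size rs); first by rewrite IH // subSn // exprS; ring.
by rewrite !nth_default ?size_prod_XsubC ?mulr0.
Qed.

Lemma coef_expXnC (A : comNzRingType) (m e i : nat) (c : A) :
  (('X^m + c%:P) ^+ e)`_i =
  \sum_(j < e.+1) (c ^+ j *+ 'C(e, j)) *+ (i == m * (e - j))%N.
Proof.
rewrite exprDn coef_sum; apply: eq_bigr => j _.
rewrite coefMn -rmorphXn coefMC -exprM coefXn mulrnAl mul1r.
by case: (i == _); rewrite ?mulr1n ?mulr0n ?mul0rn.
Qed.

Lemma coef_expXnC_scale (A : comNzRingType) (m e i : nat) (c W : A) :
  (i <= m * e)%N ->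
  (('X^m + (c * W ^+ m)%:P) ^+ e)`_i = W ^+ (m * e - i) * (('X^m + c%:P) ^+ e)`_i.
Proof.
move=> ime; rewrite !coef_expXnC mulr_sumr; apply: eq_bigr => j _.
case: eqP => [->|_]; last by rewrite !mulr0n mulr0.
rewrite !mulr1n exprMn -exprM -mulnBr subKn; last by rewrite -ltnS.
by rewrite mulrnAr mulrC.
Qed.

Lemma size_expXnC (A : comNzRingType) (m e : nat) (c : A) : (0 < m)%N ->
  ('X^m + c%:P : {poly A}) ^+ e \is monic /\
  size (('X^m + c%:P : {poly A}) ^+ e) = (m * e).+1.
Proof.
move=> m0; have pm : ('X^m + c%:P : {poly A}) \is monic.
  by rewrite -[c]opprK polyCN monicXnsubC.
split; first exact: monic_exp.
elim: e => [|e IH]; first by rewrite expr0 size_poly1 muln0.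
rewrite exprS size_monicM ?monic_neq0 ?monic_exp // IH.
by rewrite -[c]opprK polyCN size_XnsubC // addSn mulnS addnS.
Qed.

(** Write [p] as [q] evaluated at [X^m]. An [m]-th root of a root of [q] is a root of [p], so [g] is
    the only root of [q]. *)
Lemma expXnC_eq (F : numClosedFieldType) (m e : nat) (g : F) (p : {poly F}) :
  (0 < m)%N -> p \is monic -> size p = (m * e).+1 ->
  (forall i, p`_i != 0 -> (m %| i)%N) -> (forall x, root p x -> x ^+ m = g) ->
  p = ('X^m + (- g)%:P) ^+ e.
Proof.
move=> m0 pm sp dv pr.
pose q : {poly F} := \poly_(i < e.+1) p`_(m * i).
have pq : p = q \Po 'X^m.
  apply/polyP => i; rewrite coef_comp_poly_Xn // coef_poly.
  case: ifPn => [mi|mi]; last by apply/eqP; apply: contraNT mi => /dv.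
  rewrite mulnC divnK //; case: ifPn => // ie; apply: nth_default.
  by rewrite sp -(divnK mi) [(m * e)%N]mulnC ltn_mul2r m0 ltnNge -ltnS.
have qe : q`_e = 1.
  by rewrite coef_poly ltnSn; have := monicP pm; rewrite lead_coefE sp.
have sq : size q = e.+1.
  apply/eqP; rewrite eqn_leq size_poly /= ltnNge; apply/negP => /leq_sizeP /(_ e (leqnn e)).
  by rewrite qe => /eqP; rewrite oner_eq0.
have qm : q \is monic by rewrite monicE lead_coefE sq qe.
have [s qs] := closed_field_poly_normal q.
rewrite (monicP qm) scale1r in qs.
have sg : all (pred1 g) s.
  apply/allP => y ys; have ry : root q y by rewrite qs root_prod_XsubC.
  have : root p (m.-root y) by rewrite pq rootE horner_comp hornerXn rootCK // -rootE.
  by move/pr; rewrite rootCK // => <-; rewrite /= eqxx.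
have qE : q = ('X - g%:P) ^+ e.
  have se : size s = e by have := sq; rewrite qs size_prod_XsubC => -[].
  by rewrite qs; move/all_pred1P: sg => ->; rewrite big_nseq -Monoid.iteropE se.
by rewrite pq qE rmorphXn /= comp_polyB comp_polyX comp_polyC polyCN.
Qed.

Section NormalForm.
Variables (R : realType) (f : {poly mpser 2 R[i]}) (zeta : mpser 2 R[i]).
Variables (n1 e : nat).
Local Notation C := (R[i]).
Local Notation n := (size f).-1.
Hypotheses (f_weierstrass : weierstrass_poly f)
  (f_irreducible : conv_poly_irreducible f)
  (zeta_root : fractional_root f n zeta).
Hypotheses (n1_gt0 : (0 < n1)%N) (e_gt0 : (0 < e)%N) (nE : n = (n1 * e)%N).
Hypothesis zeta_supp : forall a, zeta a != 0 ->
  (e <= a i2_0)%N && (e <= a i2_1)%N \/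
  exists2 b, a = b *+ n & b i2_0 = 0%N \/ b i2_1 = 0%N.
Hypothesis zeta_lead : zeta (mk2 e e) != 0.

(** In the variables [s_i] the exponent [lambda_1] is [(e, e)]. Once [h0] is removed, each conjugate
    is [(s_1 s_2)^e] times a series whose constant term has [n_1]-th power [gam]. The coefficient of
    degree [k] is then [(s_1 s_2)^(e (n - k))] times a series: the constant terms of these series
    build the binomial, the rest is [D]. *)
Lemma quasi_ordinary_normal_form :
  exists (h0 : mpser 2 C) (gam : C) (D : {poly mpser 2 C}),
  [/\ h0 0 = 0, gam != 0,
      f \Po ('X + h0%:P) =
        ('X^n1 + (mpC (- gam) * (mpX C i2_0 * mpX C i2_1))%:P) ^+ e + D,
      (size D <= n)%N &
      forall k b, D`_k b != 0 -> [/\ (n <= n1 * b i2_0 + k)%N,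
        (n <= n1 * b i2_1 + k)%N &
        ~ (n = n1 * b i2_0 + k /\ n = n1 * b i2_1 + k)%N]].
Proof.
have [cf fm f0] := f_weierstrass; have [cz zr] := zeta_root.
have n_gt0 : (0 < n)%N by rewrite nE muln_gt0 n1_gt0.
have [n' En] : exists n', n = n'.+1 by case: n n_gt0 => // m; exists m.
have zsupp := zeta_supp; rewrite En in zsupp; rewrite En (@ramE R n') in zr.
have [om om_prim] : exists z : C, (n'.+1).-primitive_root z by apply: prim_root_exists.
have [rs [srs rsP fE]] := conj_factorization om_prim cf fm f_irreducible cz zr.
have sf : size f = n'.+2 by move: En; case: (size f) => //= m ->.
(* Modulo the maximal ideal a Weierstrass polynomial becomes a power of the variable. *)
have z0 : zeta 0 = 0.
  have := rmorph_root (@mpc0 2 C) zr; rewrite -map_poly_comp.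
  have -> : map_poly (@mpc0 2 C \o @ram R n') f = 'X^(n'.+1).
    apply/polyP => i; rewrite coef_map_id0; last first.
      by rewrite /= /mpc0 /ram mpsE mpsubst0 //; apply: ram_var0.
    rewrite /= coefXn /mpc0 /ram mpsE mpsubst0; last exact: ram_var0.
    have [ilt|] := ltnP i n'.+1; first by rewrite f0 ?En // ltn_eqF.
    rewrite leq_eqVlt => /orP[/eqP <-|ilt].
      by have := monicP fm; rewrite lead_coefE En => ->; rewrite eqxx mp1E eqxx.
    by rewrite gtn_eqF // nth_default ?mp0E // sf.
  by rewrite rootE hornerXn expf_eq0 /= => /eqP.
pose h0 : mpser 2 C := fun b =>
  if (b i2_0 == 0%N) || (b i2_1 == 0%N) then zeta (b *+ n'.+1) else 0.
have h00 : h0 0 = 0 by rewrite /h0 !ffunE /= mul0rn z0.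
pose W := mpmon C (mk2 e e).
pose rho (r : mpser 2 C) : mpser 2 C := fun a => r (a + mk2 e e).
have h0ram a : @ram R n' h0 a = if mle (mk2 e e) a then 0 else zeta a.
  have h0E b : h0 b != 0 -> (b i2_0 = 0%N \/ b i2_1 = 0%N) /\ h0 b = zeta (b *+ n'.+1).
    by rewrite /h0; case: ifPn => [/orP[] /eqP ->|]; rewrite ?eqxx //; split=> //; [left|right].
  case: ifPn => [/mleP ea|na].
    apply/eqP; apply: contraT => /ram_coef0[b aE /h0E[b01 _]].
    have := ea i2_0; have := ea i2_1; rewrite aE mk2_0 mk2_1 !mulrn_midxE.
    by case: b01 => ->; rewrite muln0; lia.
  have [za|za] := eqVneq (zeta a) 0.
    rewrite za; apply/eqP; apply: contraT => /[dup] /ram_coef0[b aE /h0E[_ hb]].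
    by rewrite aE ram_coef hb -aE za eqxx.
  case: (zsupp a za) => [/andP[ea0 ea1]|[b aE b01]].
    by case/mleP: na; apply: ord2P; rewrite (mk2_0, mk2_1).
  rewrite aE ram_coef /h0; case: ifP => // /negbT.
  by case: b01 => ->; rewrite ?eqxx ?orbT.
have rhoE r : r \in rs -> r = @ram R n' h0 + W * rho r.
  move=> /rsP[i [j ->]]; apply/funext => a.
  rewrite mpaddE [W * _]mulrC mpmulmonE h0ram /rho; case: ifPn => ea.
    by rewrite add0r addrC msubK.
  have := congr1 (fun g : mpser 2 C => g a) (galconj_ram om_prim i j h0).
  by rewrite !galconjE !h0ram (negPf ea) addr0.
pose gam := zeta (mk2 e e) ^+ n1.
have rho0 r : r \in rs -> rho r 0 ^+ n1 = gam.
  move=> /rsP[i [j ->]]; rewrite /rho add0r galconjE mk2_0 mk2_1 exprMn -exprM.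
  rewrite -mulnDl -mulnA [(e * _)%N]mulnC -nE En mulnC exprM.
  by rewrite (prim_expr_order om_prim) expr1n mul1r.
pose ft := f \Po ('X + h0%:P).
have ftE : map_poly (@ram R n') ft = \prod_(r <- rs) ('X - (W * rho r)%:P).
  rewrite /ft map_comp_poly fE rmorph_prod /= big_seq [RHS]big_seq.
  apply: eq_bigr => r rrs; rewrite comp_polyB comp_polyX comp_polyC.
  rewrite rmorphD /= map_polyX map_polyC /= {1}(rhoE r rrs) polyCD; ring.
pose G := \prod_(r <- rs) ('X - (rho r)%:P).
have rsn : size rs = n'.+1 by rewrite srs En.
have ftG k : (k <= n'.+1)%N -> @ram R n' ft`_k = W ^+ (n'.+1 - k) * G`_k.
  move=> kn; rewrite -[ram _ _](coef_map (@ram R n')) ftE.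
  by rewrite coef_prod_XsubC_scale ?rsn.
have Wpow m : W ^+ m = mpmon C (mk2 e e *+ m) by rewrite mpmonMn.
pose p := map_poly (@mpc0 2 C) G.
have pE : p = \prod_(r <- rs) ('X - (rho r 0)%:P).
  rewrite /p rmorph_prod /=; apply: eq_bigr => r _.
  by rewrite map_polyXsubC.
have pp : p = ('X^n1 + (- gam)%:P) ^+ e.
  apply: expXnC_eq => //.
  - by rewrite pE monic_prod_XsubC.
  - by rewrite pE size_prod_XsubC rsn -nE En.
  (* A nonzero constant term here puts the monomial [(s_1 s_2)^(e (n - k))] into a series in the
     [s_i^n], so that [n_1] divides [n - k]. *)
  - move=> k; rewrite coef_map /= => Gk.
    have kn : (k <= n'.+1)%N.
      rewrite leqNgt; apply/negP => kn; move: Gk.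
      by rewrite [G`_k]nth_default ?raddf0 ?eqxx // size_prod_XsubC rsn.
    have : @ram R n' ft`_k (mk2 e e *+ (n'.+1 - k)) != 0.
      rewrite ftG // mulrC Wpow mpmulmonE ifT; last exact/mleP.
      by rewrite (_ : msub _ _ = 0) //; apply/ffunP => i; rewrite msubE subnn ffunE.
    case/ram_coef0 => b /(congr1 (fun b : midx 2 => b i2_0)).
    rewrite !mulrn_midxE mk2_0 -En {2}nE [(n1 * e)%N]mulnC -mulnA mulnC => /eqP.
    rewrite eqn_pmul2l // => /eqP nk _.
    have : (n1 %| n - k)%N by rewrite nk dvdn_mulr.
    by rewrite dvdn_subr ?En // -?En ?nE ?dvdn_mulr.
  - move=> x; rewrite pE -(big_map (fun r => rho r 0) xpredT (fun r => 'X - r%:P)).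
    by rewrite root_prod_XsubC => /mapP[r rrs ->]; apply: rho0.
pose L : {poly mpser 2 C} :=
  ('X^n1 + (mpC (- gam) * (mpX C i2_0 * mpX C i2_1))%:P) ^+ e.
have ramXX : @ram R n' (mpC (- gam) * (mpX C i2_0 * mpX C i2_1)) = mpC (- gam) * W ^+ n1.
  rewrite [LHS]mpsCM; congr (_ * _); rewrite /ram mpsM !mpsE !mpsubstX; try exact: ram_var0.
  rewrite /ram_var Wpow !mpX_mon -!mpmonMn -mpmonD; congr mpmon.
  apply: midx2P; rewrite maddE !mulrn_midxE ?mk2_0 ?mk2_1 /munit !ffunE /=;
    by rewrite -En nE; lia.
have ramL k : (k <= n'.+1)%N -> @ram R n' L`_k = W ^+ (n'.+1 - k) * mpC (p`_k).
  move=> kn; rewrite -[ram _ _](coef_map (@ram R n')) rmorphXn rmorphD /=.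
  rewrite map_polyXn map_polyC /= -/(@ram R n') ramXX coef_expXnC_scale; last first.
    by rewrite -nE En.
  rewrite -nE En; congr (_ * _); rewrite pp -(coef_map (@mpC 2 C)) rmorphXn rmorphD /=.
  by rewrite map_polyXn map_polyC.
have pk k : p`_k = G`_k 0 by rewrite coef_map.
have Gn : G`_n'.+1 = 1.
  have /monicP := monic_prod_XsubC rs xpredT rho.
  by rewrite lead_coefE size_prod_XsubC rsn.
have [Lm sL] := size_expXnC e (mpC (- gam) * (mpX C i2_0 * mpX C i2_1)) n1_gt0.
have sft : size ft = n'.+2.
  rewrite -(size_map_inj_poly (@ram_inj R n') (raddf0 (@ram R n'))) ftE.
  by rewrite size_prod_XsubC rsn.
have Dn : (size (ft - L)%R <= n)%N.
  apply/leq_sizeP => k; rewrite En leq_eqVlt coefB => /orP[/eqP <-|kn].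
    apply/eqP; rewrite subr_eq0; apply/eqP; apply: (@ram_inj R n').
    by rewrite ftG // ramL // pk Gn mp1E eqxx rmorph1.
  rewrite !nth_default ?subr0 //; last by rewrite sft.
  by rewrite /L sL -nE En.
exists h0, gam, (ft - L); split=> //.
- by rewrite expf_neq0.
- by rewrite -/L -/ft addrCA subrr addr0.
- move=> k b; rewrite coefB => Db.
  have kn : (k < n'.+1)%N.
    rewrite ltnNge; apply/negP => kn; case/eqP: Db.
    by have /leq_sizeP /(_ k) := Dn; rewrite En coefB => /(_ kn) ->.
  have : @ram R n' (ft`_k - L`_k) (b *+ n'.+1) != 0 by rewrite ram_coef; exact: Db.
  (* The bracket has no constant term, whence the strict position above the Newton polygon: the
     exponent is at least that of the power of [W], with no equality in both coordinates. *)
  have -> : @ram R n' (ft`_k - L`_k) = (G`_k - mpC p`_k) * W ^+ (n'.+1 - k).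
    rewrite mulrBl ![_ * W ^+ _]mulrC -ftG ?(ltnW kn) // -ramL ?(ltnW kn) //.
    exact: (raddfB (@ram R n')).
  rewrite Wpow mpmulmonE.
  case: ifP => [/mleP le|]; last by rewrite eqxx.
  have := le i2_0; have := le i2_1; rewrite !mulrn_midxE mk2_0 mk2_1 => le1 le0 Hb.
  rewrite En.
  have le_n m : ((n'.+1 - k) * e <= n'.+1 * m)%N -> (n'.+1 <= n1 * m + k)%N.
    rewrite -En nE => H; have : (e * (n1 * e - k) <= e * (n1 * m))%N by nia.
    by rewrite leq_pmul2l // leq_subLR addnC.
  split; [exact: le_n|exact: le_n|case=> e0 e1].
  case/negP: Hb; have -> : msub (b *+ n'.+1) (mk2 e e *+ (n'.+1 - k)) = 0.
    have eqn m : (n'.+1 = n1 * m + k -> n'.+1 * m - (n'.+1 - k) * e = 0)%N.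
      by move=> E; rewrite {2}E addnK -[in X in (X * m)%N]En nE; nia.
    apply: midx2P; rewrite msubE !mulrn_midxE ?mk2_0 ?mk2_1 ffunE; exact: eqn.
  by rewrite mpsubE pk /mpC eqxx subrr.
Qed.

End NormalForm.

(** * Substitution into polynomials over a series ring *)

Section PolySubst.
Variables (A : comNzRingType).

Definition base_var l (th : 'I_3 -> mpser l A) (m : 'I_2) : mpser l A :=
  if m == i2_0 then th i3_0 else th i3_1.

Lemma base_var0 l (th : 'I_3 -> mpser l A) :
  (forall i, th i 0 = 0) -> forall m, base_var th m 0 = 0.
Proof. by move=> th0 m; rewrite /base_var; case: ifP. Qed.

(** Turns the coefficientwise inclusion into an evaluation at [z], so that substitutions can be
    computed with ring morphisms. *)
Lemma mpser_of_polyE (p : {poly mpser 2 A}) :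
  mpser_of_poly p =
  (map_poly (mps (base_var0 (@mpX0 3 A))) p).[mpX A i3_2].
Proof.
set emb := mps _.
pose pr (a : midx 3) : midx 2 := [ffun i => if i == i2_0 then a i3_0 else a i3_1].
have embE (c : mpser 2 A) a : emb c a = if a i3_2 == 0%N then c (pr a) else 0.
  pose up (b : midx 2) : midx 3 :=
    [ffun i => if i == i3_0 then b i2_0 else if i == i3_1 then b i2_1 else 0%N].
  have upE (b : midx 2) : \prod_i base_var (@mpX A 3) i ^+ b i = mpmon A (up b).
    rewrite mpmon_prod !big_ord_recl !big_ord0 !ffunE /= !expr0 !mulr1.
    by congr (mpX _ _ ^+ b _ * mpX _ _ ^+ b _); apply: val_inj.
  rewrite /emb mpsE /mpsubst.
  transitivity (\sum_(b <- midx_lt 2 (mtdeg a).+1) c b * (a == up b)%:R).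
    by apply: eq_bigr => b _; rewrite upE.
  have apr b : a = up b -> a i3_2 = 0%N /\ pr a = b.
    move=> ->; rewrite !ffunE /=; split=> //.
    by apply/ffunP; apply: ord2P; rewrite !ffunE.
  case: eqP => [a2|a2]; last first.
    rewrite big1 // => b _; case: eqP => [/apr[]//|]; by rewrite mulr0.
  rewrite (bigD1_seq (pr a)) ?midx_lt_uniq //=; last first.
    rewrite mem_midx_lt ltnS.
    have -> : mtdeg a = (a i3_0 + a i3_1 + a i3_2)%N by apply: (sum_ord3 (fun i => a i)).
    have -> : mtdeg (pr a) = (a i3_0 + a i3_1)%N.
      by rewrite /mtdeg !big_ord_recl big_ord0 addn0 !ffunE.
    exact: leq_addr.
  rewrite big1 ?addr0 => [|b ba]; last first.
    case: eqP => [/apr[_ E]|_]; last by rewrite mulr0.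
    by rewrite E eqxx in ba.
  case: eqP => [_|]; first by rewrite mulr1.
  by case; apply/ffunP; apply: ord3P; rewrite !ffunE /=.
apply/funext => a; rewrite (@horner_coef_wide _ (size p)) ?size_poly // mpsumE.
rewrite /mpser_of_poly -/(pr a).
have pr_sub i : pr (msub a (munit i3_2 *+ i)) = pr a.
  by apply/ffunP; apply: ord2P;
    rewrite [LHS]ffunE [RHS]ffunE /= msubE mulrn_midxE ffunE /= muln0 subn0.
have sub2 i : msub a (munit i3_2 *+ i) i3_2 = (a i3_2 - i)%N.
  by rewrite msubE mulrn_midxE ffunE eqxx muln1.
have le2 i : mle (munit i3_2 *+ i) a = (i <= a i3_2)%N.
  apply/mleP/idP => [/(_ i3_2)|ia]; first by rewrite mulrn_midxE ffunE eqxx muln1.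
  by apply: ord3P; rewrite mulrn_midxE ffunE /= ?muln0 ?muln1.
transitivity (\sum_(i < size p) if i == a i3_2 :> nat then p`_i (pr a) else 0); last first.
  apply: eq_bigr => i _; rewrite coef_map mpX_mon -mpmonMn mpmulmonE le2.
  rewrite [if (_ <= _)%N then _ else _](_ : _ =
    if (i <= a i3_2)%N then emb p`_i (msub a (munit i3_2 *+ i)) else 0) //.
  by rewrite embE sub2 pr_sub subn_eq0 eqn_leq; case: (i <= a i3_2)%N.
have [sp|sp] := ltnP (a i3_2) (size p); last first.
  rewrite nth_default // big1 // => i _.
  by rewrite ltn_eqF // (leq_trans (ltn_ord i)).
rewrite (bigD1 (Ordinal sp)) //= eqxx big1 ?addr0 // => i ia.
by rewrite ifN //; apply: contraNneq ia => E; apply/eqP/val_inj.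
Qed.

Lemma mpsubst_of_poly l (p : {poly mpser 2 A}) (th : 'I_3 -> mpser l A)
    (th0 : forall i, th i 0 = 0) :
  mpsubst (mpser_of_poly p) th =
  (map_poly (mps (base_var0 th0)) p).[th i3_2].
Proof.
rewrite mpser_of_polyE -(mpsE th0) -horner_map /= -map_poly_comp.
rewrite mpsE mpsubstX //; congr (_.[_]); apply: eq_map_poly => c /=.
rewrite !mpsE (mpsubst_comp _ (base_var0 (@mpX0 3 A)) th0); congr mpsubst.
by apply/funext => m; rewrite /base_var; case: ifP => _; rewrite mpsubstX.
Qed.

End PolySubst.

(** Add the two face inequalities with multipliers [v1] and [v2]. The factor [z ^ k] makes the
    result strict when [k > 0]; for [k = 0] strictness comes from not lying on both faces. *)
Lemma face_weight_lt n1 e k z v1 v2 x y : (0 < v1 -> 0 < v2 -> v1 + v2 < n1 * z ->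
  n1 * e <= n1 * x + k -> n1 * e <= n1 * y + k ->
  ~ (n1 * e = n1 * x + k /\ n1 * e = n1 * y + k) ->
  n1 * (e * (v1 + v2)) < n1 * (k * z + (v1 * x + v2 * y)))%N.
Proof.
move=> v1p v2p vz xe ye ne.
have X : (v1 * (n1 * e) <= v1 * (n1 * x + k))%N by rewrite leq_mul2l xe orbT.
have Y : (v2 * (n1 * e) <= v2 * (n1 * y + k))%N by rewrite leq_mul2l ye orbT.
case: k ne xe ye X Y => [|k] ne xe ye X Y.
  have XY : (v1 * (n1 * e) + v2 * (n1 * e) < v1 * (n1 * x) + v2 * (n1 * y))%N.
    have [xe'|xe'] := ltnP (n1 * e) (n1 * x + 0).
      have : (v1 * (n1 * e) < v1 * (n1 * x))%N by rewrite ltn_pmul2l // -[(n1 * x)%N]addn0.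
      lia.
    have : (v2 * (n1 * e) < v2 * (n1 * y))%N by rewrite ltn_pmul2l //; lia.
    lia.
  lia.
have Z : (k.+1 * (v1 + v2) < k.+1 * (n1 * z))%N by rewrite ltn_pmul2l.
lia.
Qed.

(** * The normal form satisfies the substitution tests *)

Section NormalFormTests.
Variables (K : fieldType) (f : {poly mpser 2 K}) (n1 e : nat).
Variables (h0 : mpser 2 K) (gam : K) (D : {poly mpser 2 K}).
Hypotheses (h00 : h0 0 = 0) (gam_neq0 : gam != 0) (n1_gt1 : (1 < n1)%N).
Hypothesis fE : f \Po ('X + h0%:P) =
  ('X^n1 + (mpC (- gam) * (mpX K i2_0 * mpX K i2_1))%:P) ^+ e + D.
Hypothesis D_size : (size D <= n1 * e)%N.
Hypothesis D_supp : forall k b, D`_k b != 0 ->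
  [/\ (n1 * e <= n1 * b i2_0 + k)%N, (n1 * e <= n1 * b i2_1 + k)%N &
      ~ (n1 * e = n1 * b i2_0 + k /\ n1 * e = n1 * b i2_1 + k)%N].

Definition shift_var l (th : 'I_3 -> mpser l K) (i : 'I_3) : mpser l K :=
  if i == i3_2 then th i3_2 + mpsubst h0 (base_var th) else th i.

Lemma shift_var0 l (th : 'I_3 -> mpser l K) :
  (forall i, th i 0 = 0) -> forall i, shift_var th i 0 = 0.
Proof.
move=> th0 i; rewrite /shift_var; case: ifP => // _.
by rewrite mpaddE th0 mpsubst0 ?h00 ?addr0 //; apply: base_var0.
Qed.

Lemma mpsubst_normal_form l (th : 'I_3 -> mpser l K) : (forall i, th i 0 = 0) ->
  mpsubst (mpser_of_poly f) (shift_var th) =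
  (th i3_2 ^+ n1 - mpC gam * (th i3_0 * th i3_1)) ^+ e +
  \sum_(k < n1 * e) mpsubst D`_k (base_var th) * th i3_2 ^+ k.
Proof.
move=> th0; have b0 := base_var0 th0.
have bE : base_var (shift_var th) = base_var th by [].
rewrite (mpsubst_of_poly _ (shift_var0 th0)) /shift_var eqxx.
pose Phi := mps b0.
have -> : map_poly (mps (base_var0 (shift_var0 th0))) f = map_poly Phi f by [].
have -> : th i3_2 + mpsubst h0 (base_var th) = ('X + (Phi h0)%:P).[th i3_2].
  by rewrite hornerD hornerX hornerC.
rewrite -horner_comp.
have -> : 'X + (Phi h0)%:P = map_poly Phi ('X + h0%:P).
  by rewrite rmorphD /= map_polyX map_polyC.
rewrite -map_comp_poly fE rmorphD rmorphXn rmorphD /= map_polyXn map_polyC /=.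
rewrite !hornerE /=. congr (_ ^+ e + _).
  congr (_ + _); rewrite -!mulrA mpsCM rmorphN mulNr; congr (- (_ * _)).
  by rewrite mpsM !mpsE !mpsubstX.
rewrite (@horner_coef_wide _ (n1 * e)); last exact: leq_trans (size_poly _ _) D_size.
by apply: eq_bigr => k _; rewrite coef_map.
Qed.

Definition straight : mpser 3 K := mpsubst (mpser_of_poly f) (shift_var (@mpX K 3)).

Lemma mpsubst_shift l (th : 'I_3 -> mpser l K) (th0 : forall i, th i 0 = 0) i :
  mpsubst (shift_var (@mpX K 3) i) th = shift_var th i.
Proof.
rewrite /shift_var; case: ifP => _; last by rewrite mpsubstX.
rewrite -(mpsE th0) rmorphD /= !mpsE mpsubstX //; congr (_ + _).
rewrite (mpsubst_comp _ (base_var0 (@mpX0 3 K)) th0); congr mpsubst.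
by apply/funext => m; rewrite /base_var; case: ifP => _; rewrite mpsubstX.
Qed.

Lemma mpsubst_straight l (th : 'I_3 -> mpser l K) : (forall i, th i 0 = 0) ->
  mpsubst straight th = mpsubst (mpser_of_poly f) (shift_var th).
Proof.
move=> th0; rewrite /straight (mpsubst_comp _ (shift_var0 (@mpX0 3 K)) th0).
by congr mpsubst; apply/funext => i; apply: mpsubst_shift.
Qed.

Lemma straight_axis (j : 'I_3) : (0 < e)%N -> j = i3_0 \/ j = i3_1 ->
  axis_test n1 e straight j.
Proof.
move=> e0 j01 l th th0 thj; rewrite mpsubst_straight // mpsubst_normal_form //.
have -> : th i3_0 * th i3_1 = 0 by case: j01 thj => -> ->; rewrite ?mulr0 ?mul0r.
rewrite mulr0 subr0 -exprM big1 ?addr0 // => k _.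
suff -> : mpsubst D`_k (base_var th) = 0 by rewrite mul0r.
apply: mord_eq => m; rewrite subr0.
pose j' := if j == i3_0 then i2_0 else i2_1.
apply: (@wge_mpsubst _ _ _ _ (fun i => if i == j' then m else 0%N)) => [i|b].
  case: ifP => // /eqP ->; rewrite /j'.
  by case: j01 thj => -> thj; rewrite /base_var /= thj; apply: wge_zero.
case/D_supp => b0 b1 _; have k_lt := ltn_ord k.
(* Because [k < n1 * e], the face inequalities make both exponents positive, so every monomial of
   [D] dies on either coordinate plane. *)
have bj : (0 < b j')%N.
  by rewrite /j'; case: ifP => _; rewrite lt0n; apply/eqP => E; move: b0 b1; rewrite E; lia.
rewrite (bigD1 j') //= eqxx; apply: leq_trans (leq_addr _ _).
by rewrite leq_pmulr.
Qed.

Lemma straight_lead : lead_test n1 e straight i3_0 i3_1.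
Proof.
move=> l om th c1 c2 b1 b2 z th0 c10 c20 b10 b20 t1 t2 tz lt.
rewrite mpsubst_straight // mpsubst_normal_form //.
set v1 := mwdot om b1 in t1 b10 lt; set v2 := mwdot om b2 in t2 b20 lt.
have w1 : wge om v1 (th i3_0).
  rewrite -(subrK (mpC c1 * mpmon K b1) (th i3_0)); apply: wgeD.
    exact: wge_le (leqnSn _) t1.
  by apply: wgeMl; apply: wge_mon.
have w2 : wge om v2 (th i3_1).
  rewrite -(subrK (mpC c2 * mpmon K b2) (th i3_1)); apply: wgeD.
    exact: wge_le (leqnSn _) t2.
  by apply: wgeMl; apply: wge_mon.
pose c := - (gam * (c1 * c2)).
have c_neq0 : c != 0 by rewrite oppr_eq0 !mulf_neq0.
have wc : wge om (v1 + v2) (mpC c * mpmon K (b1 + b2)).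
  by apply: wgeMl; rewrite /v1 /v2 -mwdotD; apply: wge_mon.
have lead0 : wge om (v1 + v2).+1 (th i3_2 ^+ n1 - mpC gam * (th i3_0 * th i3_1)
    - mpC c * mpmon K (b1 + b2)).
  have -> : th i3_2 ^+ n1 - mpC gam * (th i3_0 * th i3_1) - mpC c * mpmon K (b1 + b2) =
     th i3_2 ^+ n1 - mpC gam * ((th i3_0 - mpC c1 * mpmon K b1) * th i3_1
       + mpC c1 * mpmon K b1 * (th i3_1 - mpC c2 * mpmon K b2)).
    by rewrite /c mpmonD rmorphN !rmorphM; ring.
  apply: wgeB; first by apply: wge_le lt _; apply: wgeX.
  apply: wgeMl; apply: wgeD.
    by apply: wge_le (wgeM t1 w2); rewrite addSn.
  have wm : wge om v1 (mpC c1 * mpmon K b1) by apply: wgeMl; apply: wge_mon.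
  by apply: wge_le (wgeM wm t2); rewrite addnS.
have w0 : wge om (v1 + v2) (th i3_2 ^+ n1 - mpC gam * (th i3_0 * th i3_1)).
  rewrite -(subrK (mpC c * mpmon K (b1 + b2)) (_ - mpC gam * _)); apply: wgeD => //.
  exact: wge_le (leqnSn _) lead0.
have leadX := wge_subX_lead (d := e) w0 wc lead0.
have tailX : wge om (e * (v1 + v2)).+1
    (\sum_(k < n1 * e) mpsubst D`_k (base_var th) * th i3_2 ^+ k).
  apply: wge_sum => k _.
  suff [m wm le] : exists2 m, wge om m (mpsubst D`_k (base_var th))
     & (e * (v1 + v2) < m + k * z)%N.
    by apply: wge_le le _; apply: wgeM => //; apply: wgeX.
  (* The subtraction may truncate to 0, which is harmless: [z ^ k] alone is then heavy enough. *)
  exists (e * (v1 + v2) + 1 - k * z)%N; last by lia.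
  apply: (@wge_mpsubst _ _ _ _ (fun i => if i == i2_0 then v1 else v2)) => [i|b].
    by rewrite /base_var; case: ifP.
  case/D_supp => bb1 bb2 bb3; rewrite !big_ord_recl big_ord0 addn0 /=.
  have -> : lift ord0 ord0 = i2_1 :> 'I_2 by apply: val_inj.
  have -> : ord0 = i2_0 :> 'I_2 by apply: val_inj.
  move: (b i2_0) (b i2_1) bb1 bb2 bb3 => x y bb1 bb2 bb3.
  rewrite leq_subLR addn1.
  have n1_gt0 : (0 < n1)%N by apply: ltnW.
  by rewrite -(ltn_pmul2l n1_gt0); apply: face_weight_lt.
have : wge om (e * (v1 + v2)).+1 ((th i3_2 ^+ n1 - mpC gam * (th i3_0 * th i3_1)) ^+ e +
  \sum_(k < n1 * e) mpsubst D`_k (base_var th) * th i3_2 ^+ k -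
  (mpC c * mpmon K (b1 + b2)) ^+ e).
  by rewrite addrAC; apply: wgeD.
move/wge_coef0 => /(_ ((b1 + b2) *+ e)); rewrite mwdotMn mwdotD ltnSn => /(_ isT) /eqP.
rewrite mpsubE subr_eq0 => /eqP ->.
rewrite exprMn -rmorphXn -mpmonMn mpCmulE /mpmon eqxx mulr1.
by rewrite expf_neq0.
Qed.

End NormalFormTests.

(** * Regular systems of parameters *)

Lemma mpmul_munit k (A : comNzRingType) (f g : mpser k A) m : g 0 = 0 ->
  (f * g) (munit m) = f 0 * g (munit m).
Proof.
move=> g0; have : mord 2 ((f - mpC (f 0)) * g).
  apply: (wgeM (m := 1) (m' := 1)); apply/mord1 => //.
  by rewrite mpsubE /mpC eqxx subrr.
move/mord_coef0 => /(_ (munit m)); rewrite mtdegE mwdot_unit ffunE => /(_ isT) /eqP.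
by rewrite mulrBl mpsubE mpCmulE subr_eq0 => /eqP.
Qed.

(** Express the variables as combinations of the [u i]: the constant terms of the coefficients form
    an inverse of the Jacobian. *)
Lemma regular_parameters_inverse (K : fieldType) (u : 'I_3 -> mpser 3 K) :
  regular_parameters u -> exists v : 'I_3 -> mpser 3 K,
  [/\ forall i, v i 0 = 0, forall i, mpsubst (u i) v = mpX K i
    & forall i, mpsubst (v i) u = mpX K i].
Proof.
case=> u0 gen; have [a aE] := choice (fun j => gen (mpX K j) (mpX0 K j)).
pose M : 'M[K]_3 := \matrix_(j, i) a j i 0.
have Mu : M *m mpjac u = 1%:M.
  rewrite -mpjacX; apply/matrixP => j m; rewrite !mxE [in RHS]aE mpsumE.
  by apply: eq_bigr => i _; rewrite !mxE mpmul_munit.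
exact: mpser_inverse u0 (mulmx1C Mu) Mu.
Qed.

Lemma regular_parameters_perm (K : fieldType) (u : 'I_3 -> mpser 3 K) s :
  injective s -> regular_parameters u -> regular_parameters (u \o s).
Proof.
move=> sI [u0 gen]; split=> [i|h h0]; first exact: u0.
have [a ->] := gen h h0; exists (a \o s).
by rewrite (reindex_inj sI).
Qed.

Lemma sort3 (w : 'I_3 -> nat) : exists s : 'I_3 -> 'I_3,
  [/\ injective s, (w (s i3_0) <= w (s i3_1))%N & (w (s i3_1) <= w (s i3_2))%N].
Proof.
pose r i j := (w i <= w j)%N; pose t := sort r (enum 'I_3).
have st : size t = 3 by rewrite size_sort size_enum_ord.
have tr : sorted r t by apply: sort_sorted => i j; apply: leq_total.
have ut : uniq t by rewrite sort_uniq enum_uniq.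
exists (fun i => nth i3_0 t i); split.
- move=> i j /eqP; rewrite nth_uniq ?st ?ltn_ord // => /eqP; exact: val_inj.
- by have := tr; case: (t) st => [|a [|b [|c []]]] //= _ /and3P[].
- by have := tr; case: (t) st => [|a [|b [|c []]]] //= _ /and3P[].
Qed.

Section MonomialRatio.
Variables (K : fieldType) (f : {poly mpser 2 K}) (n1 e : nat).
Variables (h0 : mpser 2 K) (gam : K) (D : {poly mpser 2 K}).
Hypotheses (h00 : h0 0 = 0) (gam_neq0 : gam != 0) (n1_gt1 : (1 < n1)%N).
Hypotheses (e_gt0 : (0 < e)%N).
Hypothesis fE : f \Po ('X + h0%:P) =
  ('X^n1 + (mpC (- gam) * (mpX K i2_0 * mpX K i2_1))%:P) ^+ e + D.
Hypothesis D_size : (size D <= n1 * e)%N.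
Hypothesis D_supp : forall k b, D`_k b != 0 ->
  [/\ (n1 * e <= n1 * b i2_0 + k)%N, (n1 * e <= n1 * b i2_1 + k)%N &
      ~ (n1 * e = n1 * b i2_0 + k /\ n1 * e = n1 * b i2_1 + k)%N].

(** Reduction to [monomial_bound]: [s] sorts the weights, [S] translates [z] by [h0], and [T] is the
    inverse translation, which yields the inverse [P] of the translated parameters [q]. *)
Lemma monomial_ratio (u : 'I_3 -> mpser 3 K) (w : midx 3) V :
  regular_parameters u -> monomial_value u w (mpser_of_poly f) V ->
  (n1.+1 * V <= n1 * e * (w i3_0 + w i3_1 + w i3_2))%N.
Proof.
move=> ru [c fc [_ wc]].
have [s [sI ws01 ws12]] := sort3 w.
have [v [v0 uv vu]] := regular_parameters_inverse (regular_parameters_perm sI ru).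
have u0 i : u i 0 = 0 by case: ru.
have X0 := @mpX0 3 K.
pose S := shift_var h0 (@mpX K 3).
have S0 : forall i, S i 0 = 0 by apply: shift_var0.
have ShE l (th : 'I_3 -> mpser l K) (th0 : forall i, th i 0 = 0) :
    (fun i => mpsubst (S i) th) = shift_var h0 th.
  by apply/funext => i; apply: mpsubst_shift.
pose q i := mpsubst (u (s i)) S.
have q0 i : q i 0 = 0 by rewrite /q mpsubst0 ?u0.
pose T i : mpser 3 K := if i == i3_2
  then mpX K i3_2 - mpsubst h0 (base_var (@mpX K 3)) else mpX K i.
have T0 i : T i 0 = 0.
  rewrite /T; case: ifP => _; rewrite ?mpsubE ?X0 // mpsubst0 ?h00 ?subr0 //.
  exact: base_var0.
have mpsubst_base l (th : 'I_3 -> mpser l K) (th0 : forall i, th i 0 = 0) :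
    mpsubst (mpsubst h0 (base_var (@mpX K 3))) th = mpsubst h0 (base_var th).
  rewrite (mpsubst_comp _ (base_var0 X0) th0); congr mpsubst.
  by apply/funext => m; rewrite /base_var; case: ifP => _; rewrite mpsubstX.
have TE l (th : 'I_3 -> mpser l K) (th0 : forall i, th i 0 = 0) i :
    mpsubst (T i) th = if i == i3_2 then th i3_2 - mpsubst h0 (base_var th) else th i.
  rewrite /T; case: ifP => _; last by rewrite mpsubstX.
  by rewrite mpsubstB mpsubstX // mpsubst_base.
pose P i := mpsubst (T i) v.
have P0 i : P i 0 = 0 by rewrite /P mpsubst0.
have SP : (fun i => mpsubst (S i) P) = v.
  rewrite ShE //; apply/funext => i; rewrite /shift_var.
  have -> : base_var P = base_var v.
    by apply/funext => m; rewrite /base_var /P; case: ifP => _; rewrite TE.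
  by case: eqP => [->|/eqP i2]; rewrite /P TE ?(negPf i2) // subrK.
have qP i : mpsubst (q i) P = mpX K i.
  by rewrite /q (mpsubst_comp _ S0 P0) SP -uv.
have Pq i : mpsubst (P i) q = mpX K i.
  rewrite /P (mpsubst_comp _ v0 q0).
  have -> : (fun j => mpsubst (v j) q) = S.
    apply/funext => j; rewrite -[q]/(fun i => mpsubst ((u \o s) i) S).
    by rewrite -(mpsubst_comp _ (fun i => u0 (s i)) S0) vu mpsubstX.
  rewrite TE // /S /shift_var /=; case: eqP => [->|] //.
  by rewrite (_ : base_var _ = base_var (@mpX K 3)) ?addrK.
have sumw : (w i3_0 + w i3_1 + w i3_2 =
    w (s i3_0) + w (s i3_1) + w (s i3_2))%N.
  transitivity (\sum_i w i)%N; first exact/esym/(sum_ord3 (fun i => w i)).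
  by rewrite (reindex_inj sI); apply: (sum_ord3 (fun i => w (s i))).
rewrite sumw.
apply: (@monomial_bound K n1 e V (straight f h0) n1_gt1 q P (fun i => w (s i))) => //.
- move=> l om th kap th0 qth; rewrite mpsubst_straight //.
  have sh0 := shift_var0 h00 th0.
  rewrite fc (mpsubst_comp _ u0 sh0).
  apply: (@wge_mpsubst _ _ _ _ (fun i => kap * w i)%N) => [i|a /wc].
    have [s' _ ss'] := injF_bij sI.
    rewrite -(ss' i); have := qth (s' i); rewrite /q (mpsubst_comp _ S0 th0).
    by rewrite ShE.
  under [X in _ -> (_ <= X)%N]eq_bigr do rewrite -mulnA.
  by rewrite -big_distrr leq_mul2l orbC => ->.
- by apply: (straight_axis h00 gam_neq0 n1_gt1 fE D_size D_supp) => //; left.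
- by apply: (straight_axis h00 gam_neq0 n1_gt1 fE D_size D_supp) => //; right.
- exact: (straight_lead h00 gam_neq0 n1_gt1 fE D_size D_supp).
Qed.

End MonomialRatio.

(** * A divisor bounding the log canonical threshold *)

(** As [k + 1 = n1], the first inequality times [k] plus the second is [n1] times the conclusion in
    weak form; equality would force equality in both. *)
Lemma chart_weight_lt n1 k n b0 b1 j : (0 < k -> n1 = k.+1 -> n <= n1 * b0 + j -> n <= n1 * b1 + j ->
  ~ (n = n1 * b0 + j /\ n = n1 * b1 + j) -> n < k * b0 + b1 + j)%N.
Proof.
move=> k0 -> h0 h1 ne; rewrite ltnNge; apply/negP => le.
have H : (k.+1 * (k * b0 + b1 + j) <= k.+1 * n)%N by rewrite leq_mul2l le orbT.
have K0 : (k * n <= k * (k.+1 * b0 + j))%N by rewrite leq_mul2l h0 orbT.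
have e1 : (n = k.+1 * b1 + j)%N by nia.
have e0 : (k * n = k * (k.+1 * b0 + j))%N by nia.
by apply: ne; split=> //; apply/eqP; rewrite -(eqn_pmul2l k0) e0.
Qed.

Section Mon3.
Variable A : comNzRingType.

Definition mk3 (x y z : nat) : midx 3 :=
  [ffun i => if i == i3_0 then x else if i == i3_1 then y else z].

Lemma mk3_0 x y z : mk3 x y z i3_0 = x. Proof. by rewrite ffunE. Qed.

Lemma mk3_1 x y z : mk3 x y z i3_1 = y. Proof. by rewrite ffunE. Qed.

Lemma mk3_2 x y z : mk3 x y z i3_2 = z. Proof. by rewrite ffunE. Qed.

Definition mk3E := (mk3_0, mk3_1, mk3_2).

Lemma midx3P (a b : midx 3) :
  a i3_0 = b i3_0 -> a i3_1 = b i3_1 -> a i3_2 = b i3_2 -> a = b.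
Proof. by move=> e0 e1 e2; apply/ffunP; apply: ord3P. Qed.

Lemma mk3_natmul x y z m : mk3 x y z *+ m = mk3 (m * x) (m * y) (m * z).
Proof. by apply: midx3P; rewrite mulrn_midxE !mk3E. Qed.

Lemma mk3_add x y z x' y' z' : mk3 x y z + mk3 x' y' z' = mk3 (x + x') (y + y') (z + z').
Proof. by apply: midx3P; rewrite maddE !mk3E. Qed.

Lemma prod_ord3 (M : comPzRingType) (F : 'I_3 -> M) :
  \prod_i F i = F i3_0 * F i3_1 * F i3_2.
Proof.
rewrite !big_ord_recl big_ord0 mulr1 mulrA.
by congr (F _ * F _ * F _); apply: val_inj.
Qed.

Lemma mon3E x y z : mpmon A (mk3 x y z) =
  mpX A i3_0 ^+ x * mpX A i3_1 ^+ y * mpX A i3_2 ^+ z.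
Proof. by rewrite mpmon_prod prod_ord3 !mk3E. Qed.

Lemma mpderivD k (i : 'I_k) (f g : mpser k A) :
  mpderiv i (f + g) = mpderiv i f + mpderiv i g.
Proof. by apply/funext => a; rewrite /mpderiv mpaddE mulrnDl. Qed.

Lemma mpderivN k (i : 'I_k) (f : mpser k A) : mpderiv i (- f) = - mpderiv i f.
Proof. by apply/funext => a; rewrite /mpderiv !mpoppE mulNrn. Qed.

Lemma mpderivC k (i : 'I_k) c (f : mpser k A) :
  mpderiv i (mpC c * f) = mpC c * mpderiv i f.
Proof. by apply/funext => a; rewrite /mpderiv !mpCmulE mulrnAr. Qed.

Lemma mpderiv_mon k (i : 'I_k) (b : midx k) :
  mpderiv i (mpmon A b) = (b i)%:R * mpmon A (msub b (munit i)).
Proof.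
have natE (m : nat) : m%:R = mpC m%:R :> mpser k A by rewrite rmorph_nat.
apply/funext => a; rewrite /mpderiv natE mpCmulE /mpmon.
case: (eqVneq (a + munit i) b) => [<-|ab].
  by rewrite maddE ffunE eqxx addn1 [a + _]addrC maddK eqxx mulr1.
have [b0|b0] := posnP (b i); first by rewrite b0 mul0r mul0rn.
case: eqP => [aE|]; last by rewrite mulr0 mul0rn.
case/eqP: ab; rewrite aE addrC msubK //; apply/mleP => j; rewrite ffunE.
by case: eqP => [->|].
Qed.

Lemma mpderiv0_mon3 x y z :
  mpderiv i3_0 (mpmon A (mk3 x.+1 y z)) = x.+1%:R * mpmon A (mk3 x y z).
Proof.
rewrite mpderiv_mon mk3_0; congr (_ * mpmon _ _).
by apply: midx3P; rewrite msubE !mk3E ffunE /= ?subn0 ?subn1.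
Qed.

Lemma mpderiv1_mon3 x y z :
  mpderiv i3_1 (mpmon A (mk3 x y.+1 z)) = y.+1%:R * mpmon A (mk3 x y z).
Proof.
rewrite mpderiv_mon mk3_1; congr (_ * mpmon _ _).
by apply: midx3P; rewrite msubE !mk3E ffunE /= ?subn0 ?subn1.
Qed.

Lemma mpderiv2_mon3 x y z :
  mpderiv i3_2 (mpmon A (mk3 x y z.+1)) = z.+1%:R * mpmon A (mk3 x y z).
Proof.
rewrite mpderiv_mon mk3_2; congr (_ * mpmon _ _).
by apply: midx3P; rewrite msubE !mk3E ffunE /= ?subn0 ?subn1.
Qed.

Lemma mpderiv2_mon30 x y : mpderiv i3_2 (mpmon A (mk3 x y 0)) = 0.
Proof. by rewrite mpderiv_mon mk3_2 mul0r. Qed.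

Lemma det3 (F : 'I_3 -> 'I_3 -> A) :
  \det (\matrix_(i < 3, j < 3) F i j) =
    F i3_0 i3_0 * (F i3_1 i3_1 * F i3_2 i3_2 - F i3_1 i3_2 * F i3_2 i3_1)
  - F i3_0 i3_1 * (F i3_1 i3_0 * F i3_2 i3_2 - F i3_1 i3_2 * F i3_2 i3_0)
  + F i3_0 i3_2 * (F i3_1 i3_0 * F i3_2 i3_1 - F i3_1 i3_1 * F i3_2 i3_0).
Proof.
rewrite (expand_det_row _ i3_0) sum_ord3 /cofactor.
rewrite !(expand_det_row _ ord0) !big_ord_recl !big_ord0 /cofactor !det_mx11 !mxE /=.
pose G (x y : nat) := F (inord x) (inord y).
have FE i j : F i j = G (val i) (val j) by rewrite /G !inord_val.
by rewrite !FE /= /bump /= !expr0 !expr1 !add0n; ring.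
Qed.

End Mon3.

Section Evaluation.
Variables (R : realType) (k : nat).
Local Notation C := (R[i]).
Implicit Types (h : mpser k C) (p : 'I_k -> C).

(** Eventually constant partial sums, as polynomials have. By [sums_to_evaluates] the limits in
    [bimeromorphic_germ] become algebraic identities. *)
Definition evaluates h p (s : C) := exists N, forall d, (N <= d)%N ->
  \sum_(a <- midx_lt k d) h a * \prod_i p i ^+ a i = s.

Lemma sums_to_evaluates h p s s' : sums_to h p s -> evaluates h p s' -> s = s'.
Proof.
move=> hs [N hN]; apply/eqP; rewrite eq_sym -subr_eq0.
apply: contraT; rewrite -normr_gt0 => d0; have [N' hN'] := hs _ d0.
have := hN' (maxn N N') (leq_maxr _ _); rewrite hN ?leq_maxl //.
by rewrite ltxx.
Qed.

Lemma evaluatesD g h p s t : evaluates g p s -> evaluates h p t ->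
  evaluates (g + h) p (s + t).
Proof.
move=> [N gN] [N' hN]; exists (maxn N N') => d; rewrite geq_max => /andP[dN dN'].
rewrite -(gN _ dN) -(hN _ dN') -big_split; apply: eq_bigr => a _.
by rewrite mpaddE mulrDl.
Qed.

Lemma evaluatesC c h p s : evaluates h p s -> evaluates (mpC c * h) p (c * s).
Proof.
move=> [N hN]; exists N => d dN; rewrite -(hN _ dN) big_distrr.
by apply: eq_bigr => a _ /=; rewrite mpCmulE mulrA.
Qed.

Lemma evaluatesN h p s : evaluates h p s -> evaluates (- h) p (- s).
Proof.
by move/(evaluatesC (-1)); rewrite rmorphN rmorph1 !mulN1r.
Qed.

Lemma evaluates_mon p b : evaluates (mpmon C b) p (\prod_i p i ^+ b i).
Proof.
exists (mtdeg b).+1 => d bd.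
rewrite (bigD1_seq b) ?midx_lt_uniq ?mem_midx_lt //= /mpmon eqxx mul1r.
by rewrite [X in _ + X]big1 ?addr0 // => a /negPf ->; rewrite mul0r.
Qed.

End Evaluation.

Section Chart.
Variables (R : realType) (k' e' : nat) (g eta0 eta1 : R[i]).
Local Notation C := (R[i]).
Local Notation k := k'.+1.
Local Notation n1 := k.+1.
Local Notation N := e'.+1.
Local Notation mon x y z := (mpmon C (mk3 x y z)).

(* In the coordinates [x_1, x_2, z' = z - eta0 x_1 - eta1 x_2] and
   [y = z'^n1 - x_1 x_2 / g], the divisor [t = 0] has weights [N (n1 - 1)], [N],
   [N] on [x_1, x_2, z'] and [n1 N + 1] on [y]. *)
Definition chart (i : 'I_3) : mpser 3 C :=
  let x := mpC g * (mon (N * k) k n1 - mon (N * k).+1 k 0) in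
  let y := mon N 1 0 in
  if i == i3_0 then x else if i == i3_1 then y
  else mon N 1 1 + mpC eta0 * x + mpC eta1 * y.

Lemma jacobian_chart :
  jacobian chart = mpC (- g) * mon (N * n1.+1) n1 0.
Proof.
rewrite /jacobian det3 /chart /=.
have -> : (N * k = (e' * k + k').+1)%N by rewrite mulSn addSn addnC.
rewrite !(mpderivD, mpderivC, mpderivN, mpderiv0_mon3, mpderiv1_mon3,
  mpderiv2_mon3, mpderiv2_mon30) !mon3E.
set t := mpX C i3_0; set a := mpX C i3_1; set b := mpX C i3_2.
set T := t ^+ e'; set M := t ^+ (e' * k + k'); set B := a ^+ k'; set D := b ^+ k'.
have -> : (N * n1.+1 = e' + e' + (e' * k + k') + 3)%N by lia.
have -> : t ^+ (e' + e' + (e' * k + k') + 3) = T * T * M * t ^+ 3 by rewrite 3!exprD.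
rewrite !exprS !expr0 -/T -/M -/B -/D.
rewrite -!natr1 natrD natrM -!natr1 mpCN.
ring.
Qed.

Hypothesis g_neq0 : g != 0.

(** Where the Jacobian is nonzero, so are [t] and [a]. Then [b] is the quotient of [z'] by [x_2],
    next [x_1 = g x_2^k (b^n1 - t)] returns [t], and [x_2] returns [a]. The chart being polynomial,
    the radius is arbitrary. *)
Lemma divisor_chart_chart : divisor_chart chart.
Proof.
have nk : (0 < N * k)%N by rewrite muln_gt0.
have cx : convergent (chart i3_0).
  rewrite /chart /=; apply: convergentM; first exact: convergent_mpC.
  by apply: convergentD; [|apply: convergentN]; apply: convergent_mpmon.
have mon0 x y z : (0 < x)%N -> (mon x y z : mpser 3 C) 0 = 0.
  by move=> x0; rewrite /mpmon; case: eqP => // /ffunP /(_ i3_0); rewrite mk3E ffunE; lia.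
split.
- apply: ord3P => //; rewrite /chart /=; first exact: convergent_mpmon.
  apply: convergentD; first apply: convergentD; first exact: convergent_mpmon.
    by apply: convergentM => //; apply: convergent_mpC.
  by apply: convergentM; [exact: convergent_mpC|exact: convergent_mpmon].
- have x0 : chart i3_0 0 = 0 by rewrite /chart /= mpCmulE mpsubE !mon0 // subrr mulr0.
  have y0 : chart i3_1 0 = 0 by apply: mon0.
  apply: ord3P => //; rewrite (_ : chart i3_2 =
    mon N 1 1 + mpC eta0 * chart i3_0 + mpC eta1 * chart i3_1) //.
  by rewrite !mpaddE !mpCmulE x0 y0 !mulr0 !addr0 mon0.
- apply/eqP => /(congr1 (fun h : mpser 3 C => h (mk3 (N * n1.+1) n1 0))) /eqP.
  by rewrite jacobian_chart mpCmulE /mpmon eqxx mulr1 oppr_eq0 (negPf g_neq0).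
exists 1 => // p q y jp jq _ _ sp jp0 sq jq0 yp yq.
have evm r x yy z : evaluates (mon x yy z) r (r i3_0 ^+ x * r i3_1 ^+ yy * r i3_2 ^+ z).
  by have := evaluates_mon r (mk3 x yy z); rewrite prod_ord3 !mk3E.
have evx r : evaluates (chart i3_0) r (g * (r i3_0 ^+ (N * k) * r i3_1 ^+ k * r i3_2 ^+ n1
    - r i3_0 ^+ (N * k).+1 * r i3_1 ^+ k * r i3_2 ^+ 0)).
  apply: evaluatesC; apply: evaluatesD; first exact: evm.
  by apply: evaluatesN; apply: evm.
have evy r : evaluates (chart i3_1) r (r i3_0 ^+ N * r i3_1 ^+ 1 * r i3_2 ^+ 0).
  exact: evm.
have evz r sx sy : evaluates (chart i3_0) r sx -> evaluates (chart i3_1) r sy ->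
    evaluates (chart i3_2) r
      (r i3_0 ^+ N * r i3_1 ^+ 1 * r i3_2 ^+ 1 + eta0 * sx + eta1 * sy).
  move=> ex ey; apply: evaluatesD; last exact: evaluatesC.
  by apply: evaluatesD; [exact: evm|exact: evaluatesC].
have jac_nz r s : sums_to (jacobian chart) r s -> s != 0 -> r i3_0 != 0 /\ r i3_1 != 0.
  rewrite jacobian_chart => sj.
  rewrite (sums_to_evaluates sj (evaluatesC _ (evm _ _ _ _))).
  move=> nz; split; apply: contraNneq nz => ->.
    by rewrite expr0n muln_eq0 !mul0r mulr0.
  by rewrite expr0n mulr0 mul0r mulr0.
have [p0 p1] := jac_nz _ _ sp jp0; have [q0 q1] := jac_nz _ _ sq jq0.
have Ex := etrans (esym (sums_to_evaluates (yp i3_0) (evx p)))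
                  (sums_to_evaluates (yq i3_0) (evx q)).
have Ey := etrans (esym (sums_to_evaluates (yp i3_1) (evy p)))
                  (sums_to_evaluates (yq i3_1) (evy q)).
have Ez := etrans (esym (sums_to_evaluates (yp i3_2) (evz p _ _ (evx p) (evy p))))
                  (sums_to_evaluates (yq i3_2) (evz q _ _ (evx q) (evy q))).
rewrite Ex Ey in Ez; move/addIr: Ez => /addIr Ez.
rewrite !expr1 !expr0 !mulr1 in Ex Ey Ez.
have qq : q i3_0 ^+ N * q i3_1 != 0 by rewrite mulf_neq0 ?expf_neq0.
have p2 : p i3_2 = q i3_2 by move: Ez; rewrite Ey => /(mulfI qq).
have pk (r : 'I_3 -> C) : r i3_0 ^+ (N * k) * r i3_1 ^+ k = (r i3_0 ^+ N * r i3_1) ^+ k.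
  by rewrite exprMn -exprM.
have e0 : p i3_0 = q i3_0.
  move/(mulfI g_neq0): Ex.
  have split_x (r : 'I_3 -> C) : r i3_0 ^+ (N * k) * r i3_1 ^+ k * r i3_2 ^+ n1
      - r i3_0 ^+ (N * k).+1 * r i3_1 ^+ k
      = (r i3_0 ^+ (N * k) * r i3_1 ^+ k) * (r i3_2 ^+ n1 - r i3_0).
    rewrite [r i3_0 ^+ (N * k).+1]exprSr; move: (r i3_0 ^+ _) (_ ^+ n1) (_ ^+ k) => *.
    ring.
  rewrite !split_x !pk Ey p2 => /(mulfI (expf_neq0 _ qq)) /addrI; exact: oppr_inj.
apply: ord3P => //; move: Ey; rewrite e0.
by apply: mulfI; rewrite expf_neq0.
Qed.

End Chart.

Lemma mwdot_munitl k (i : 'I_k) (a : midx k) : mwdot (munit i) a = a i.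
Proof.
rewrite /mwdot (bigD1 i) //= ffunE eqxx mul1n big1 ?addn0 // => j ji.
by rewrite ffunE (negPf ji).
Qed.

Section LctBound.
Variables (R : realType) (f : {poly mpser 2 R[i]}) (k' e' : nat).
Local Notation C := (R[i]).
Local Notation k := k'.+1.
Local Notation n1 := k.+1.
Local Notation e := e'.+1.
Local Notation mon x y z := (mpmon C (mk3 x y z)).
Variables (h0 : mpser 2 C) (gam : C) (D : {poly mpser 2 C}).
Hypotheses (h00 : h0 0 = 0) (gam_neq0 : gam != 0).
Hypothesis fE : f \Po ('X + h0%:P) =
  ('X^n1 + (mpC (- gam) * (mpX C i2_0 * mpX C i2_1))%:P) ^+ e + D.
Hypothesis D_size : (size D <= n1 * e)%N.
Hypothesis D_supp : forall k b, D`_k b != 0 ->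
  [/\ (n1 * e <= n1 * b i2_0 + k)%N, (n1 * e <= n1 * b i2_1 + k)%N &
      ~ (n1 * e = n1 * b i2_0 + k /\ n1 * e = n1 * b i2_1 + k)%N].

Definition lct_chart : 'I_3 -> mpser 3 C :=
  chart k' e' gam^-1 (h0 (munit i2_0)) (h0 (munit i2_1)).

Let gV_neq0 : gam^-1 != 0. Proof. by rewrite invr_eq0. Qed.

Lemma sum_ord2 (M : nmodType) (F : 'I_2 -> M) : \sum_i F i = F i2_0 + F i2_1.
Proof. by rewrite !big_ord_recl big_ord0 addr0; congr (F _ + F _); apply: val_inj. Qed.

(** The exact order needs a coefficient that cannot cancel. Terms of [D] may reach the same order as
    [Y ^ e] along [t = 0], but along [a = 0] everything except [Y ^ e] has larger order, so its
    coefficient survives. *)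
Lemma chart_value :
  ord_E lct_chart (mpser_of_poly f) (e * (e * n1).+1).
Proof.
have ch0 : forall i, lct_chart i 0 = 0 by case: (divisor_chart_chart k' e'
  (h0 (munit i2_0)) (h0 (munit i2_1)) gV_neq0).
pose B := base_var lct_chart; have B0 : forall m, B m 0 = 0 := base_var0 ch0.
(* The chart corrects [z] only by the linear part of [h0], which keeps it polynomial; the rest has
   order at least two, hence at least twice the weight of [x_2]. *)
pose tail := mpsubst h0 B - mpC (h0 (munit i2_0)) * lct_chart i3_0
                          - mpC (h0 (munit i2_1)) * lct_chart i3_1.
have tailE : tail = mpsubst (h0 - mpC (h0 0) - \sum_i mpC (h0 (munit i)) * mpX C i) B.
  rewrite -(mpsE B0) h00 rmorph0 subr0 raddfB sum_ord2 raddfD /= !mpsCM !mpsE.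
  by rewrite !mpsubstX // opprD addrA.
pose th i : mpser 3 C := if i == i3_2 then mon e 1 1 - tail else lct_chart i.
have th0 i : th i 0 = 0.
  rewrite /th; case: ifP => // _; rewrite /tail !mpsubE !mpCmulE mpsubst0 // !ch0.
  by rewrite h00 !mulr0 !subr0 /mpmon; case: eqP => // /ffunP /(_ i3_0); rewrite mk3E ffunE.
have chE : lct_chart = shift_var h0 th.
  apply/funext => i; rewrite /shift_var.
  have -> : base_var th = B by apply/funext => m; rewrite /B /base_var; case: ifP.
  case: eqP => [->|/eqP i2]; last by rewrite /th (negPf i2).
  have -> : lct_chart i3_2 = mon e 1 1 + mpC (h0 (munit i2_0)) * lct_chart i3_0
    + mpC (h0 (munit i2_1)) * lct_chart i3_1 by [].
  by rewrite /th /= /tail; ring.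
rewrite /ord_E chE (mpsubst_normal_form h00 fE D_size th0).
(* [om] is the order along [t = 0], with [W = e], or along [a = 0], with
   [W = 1]. *)
pose wt (om : midx 3) W := [/\ (0 < W)%N, wge om (W * k) (lct_chart i3_0),
  wge om W (lct_chart i3_1) & wge om W (mon e 1 1)].
have wt_t : wt (munit i3_0) e.
  split=> //.
  - rewrite /lct_chart /chart /=; apply: wgeMl; apply: wgeB.
      by have := @wge_mon _ C (munit i3_0) (mk3 (e * k) k n1); rewrite mwdot_munitl mk3E.
    have := @wge_mon _ C (munit i3_0) (mk3 (e * k).+1 k 0); rewrite mwdot_munitl mk3E.
    exact: wge_le.
  - by have := @wge_mon _ C (munit i3_0) (mk3 e 1 0); rewrite mwdot_munitl mk3E.
  - by have := @wge_mon _ C (munit i3_0) (mk3 e 1 1); rewrite mwdot_munitl mk3E.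
have wt_a : wt (munit i3_1) 1%N.
  split=> //.
  - rewrite /lct_chart /chart /= mul1n; apply: wgeMl; apply: wgeB.
      by have := @wge_mon _ C (munit i3_1) (mk3 (e * k) k n1); rewrite mwdot_munitl mk3E.
    by have := @wge_mon _ C (munit i3_1) (mk3 (e * k).+1 k 0); rewrite mwdot_munitl mk3E.
  - by have := @wge_mon _ C (munit i3_1) (mk3 e 1 0); rewrite mwdot_munitl mk3E.
  - by have := @wge_mon _ C (munit i3_1) (mk3 e 1 1); rewrite mwdot_munitl mk3E.
pose Y := mon (e * n1).+1 n1 0.
have wtail om W : wt om W -> wge om (W + W) tail.
  case=> W0 wx wy wz; rewrite tailE.
  apply: (@wge_mpsubst _ _ _ _ (fun=> W)) => [i|a].
    rewrite /B /base_var; case: ifP => // _; apply: wge_le wx.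
    by rewrite leq_pmulr.
  move/(@mord2_affine _ _ h0 a); rewrite -mtdegE => a2.
  by rewrite -big_distrr -/(mtdeg a) addnn -muln2 leq_mul2l a2 orbT.
have wz om W : wt om W -> wge om W (th i3_2).
  move=> wtW; case: (wtW) => W0 wx wy wm; rewrite /th /=; apply: wgeB => //.
  by apply: wge_le (wtail _ _ wtW); apply: leq_addr.
have Y_err om W : wt om W ->
    wge om (W * n1).+1 (th i3_2 ^+ n1 - mpC gam * (th i3_0 * th i3_1) - Y).
  move=> wtW; case: (wtW) => W0 wx wy wm.
  have -> : th i3_2 ^+ n1 - mpC gam * (th i3_0 * th i3_1) - Y =
      th i3_2 ^+ n1 - mon e 1 1 ^+ n1.
    have -> : mpC gam * (th i3_0 * th i3_1) = mon (e * n1) n1 n1 - Y.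
      rewrite /th /= /lct_chart /chart /= mulrA [mpC gam * _]mulrA -rmorphM mulfV //.
      rewrite rmorph1 mul1r mulrBl -!mpmonD !mk3_add addSn addn0 !addn1 add0n.
      by rewrite addSn -mulnSr.
    by rewrite -mpmonMn mk3_natmul [(n1 * e)%N]mulnC muln1; ring.
  rewrite mulnC; apply: wge_subX_lead => //; first exact: wz.
  rewrite /th /= addrAC subrr sub0r; apply: wgeN; apply: wge_le (wtail _ _ wtW).
  by rewrite -addn1 leq_add2l.
(* For [W = e] this bound equals the order of [Y ^ e] along [t = 0]; for [W = 1] it exceeds the
   order of [Y ^ e] along [a = 0] by one. *)
have D_wt om W : wt om W -> wge om (W * (n1 * e).+1)
    (\sum_(j < n1 * e) mpsubst D`_j (base_var th) * th i3_2 ^+ j).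
  move=> wtW; case: (wtW) => W0 wx wy wm; apply: wge_sum => j _.
  apply: (@wge_le _ _ _ (W * (n1 * e).+1 - j * W + j * W)); first by lia.
  apply: wgeM; last by apply: wgeX; apply: wz.
  apply: (@wge_mpsubst _ _ _ _ (fun i => if i == i2_0 then W * k else W)%N) => [i|b].
    by rewrite /base_var /th; case: ifP.
  case/D_supp => b0 b1 b01; have lt := chart_weight_lt (ltn0Sn k') erefl b0 b1 b01.
  have -> : (\sum_i (if i == i2_0 then W * k else W) * b i = W * k * b i2_0 + W * b i2_1)%N.
    exact: (sum_ord2 (fun i => (if i == i2_0 then W * k else W) * b i)%N).
  rewrite leq_subLR [(j * W)%N]mulnC -mulnA -!mulnDr leq_mul2l; apply/orP; right.
  by rewrite addnC.
pose al := mk3 (e * (e * n1).+1) (e * n1) (e * 0).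
have Yal : Y ^+ e = mpmon C al by rewrite /Y -mpmonMn mk3_natmul.
set G := th i3_2 ^+ n1 - mpC gam * _; set S := \sum_(_ < _) _.
have YW om W : wt om W -> (W * n1 <= mwdot om (mk3 (e * n1).+1 n1 0))%N ->
    wge om (W * n1) Y /\ wge om (W * n1) G.
  move=> wtW le; have wY : wge om (W * n1) Y by apply: wge_le le _; apply: wge_mon.
  split=> //; rewrite -(subrK Y G); apply: wgeD => //.
  by apply: wge_le (Y_err _ _ wtW); apply: leqnSn.
split.
  exists al; last by rewrite mwdot_munitl mk3E.
  have [wY wG] : wge (munit i3_1) (1 * n1) Y /\ wge (munit i3_1) (1 * n1) G.
    by apply: YW => //; rewrite mwdot_munitl mk3E mul1n.
  have : wge (munit i3_1) (e * n1).+1 (G ^+ e + S - Y ^+ e).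
    rewrite addrAC; apply: wgeD.
      have := wge_subX_lead (d := e) wG wY; rewrite mul1n; apply.
      by have := Y_err _ _ wt_a; rewrite mul1n.
    by apply: wge_le (D_wt _ _ wt_a); rewrite mul1n mulnC.
  move/wge_coef0 => /(_ al); rewrite mwdot_munitl mk3E ltnSn => /(_ isT) /eqP.
  by rewrite mpsubE subr_eq0 => /eqP ->; rewrite Yal /mpmon eqxx oner_neq0.
suff : wge (munit i3_0) (e * (e * n1).+1) (G ^+ e + S) by [].
apply: wgeD; last by apply: wge_le (D_wt _ _ wt_t); rewrite [(n1 * e)%N]mulnC.
apply: wgeX; rewrite -(subrK Y G); apply: wgeD; first exact: Y_err wt_t.
by have := @wge_mon _ C (munit i3_0) (mk3 (e * n1).+1 n1 0); rewrite mwdot_munitl mk3E.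
Qed.

Lemma lct_le : lct (mpser_of_poly f) <=
  (e * n1.+1).+1%:R / (e * (e * n1).+1)%:R.
Proof.
rewrite /lct; apply: ge_sup.
  (* An upper bound passes to the supremum of a nonempty set only, so a member is exhibited. *)
  exists 0; split=> // phi d v _ _ _; rewrite mul0r; exact: ler0n.
move=> c [c0 lc]; rewrite ler_pdivlMr ?ltr0n ?muln_gt0 //.
apply: (lc lct_chart) chart_value; first exact: (divisor_chart_chart _ _ _ _ gV_neq0).
exists (e * n1.+1)%N => //; rewrite /lct_chart jacobian_chart; split.
  exists (mk3 (e * n1.+1) n1 0); last by rewrite mwdot_munitl mk3E.
  rewrite mpCmulE /mpmon eqxx mulr1 oppr_eq0; exact: gV_neq0.
move=> a; rewrite mpCmulE /mpmon.
have [->|_] := eqVneq a (mk3 (e * n1.+1) n1 0); last by rewrite mulr0 eqxx.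
by rewrite mwdot_munitl mk3E.
Qed.

End LctBound.

(** * The first characteristic exponent and the final contradiction *)

Lemma frac_int_dvd (a n : nat) : (0 < n)%N ->
  (a%:R / n%:R : rat) \is a Num.int -> (n %| a)%N.
Proof.
move=> n0 /intrP[m mE].
have : (a%:Z)%:~R = (m * n%:Z)%:~R :> rat.
  by rewrite rmorphM /= -mE mulfVK // pnatr_eq0 -lt0n.
move/intr_inj => aE; have : (n%:Z %| a%:Z)%Z by rewrite aE dvdz_mull.
by rewrite dvdzE.
Qed.

(** [e] is the common exponent of [s_1] and [s_2] in the monomial of [lambda_1]. An exponent not
    above [lambda_1] has level 0, hence is integral, and a coordinate smaller than [e <= n] must
    then be zero. *)
Lemma first_exponent (R : realType) (n n1 : nat) (zeta : mpser 2 R[i]) (lam : seq Q2) :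
  characteristic_exponents n zeta lam -> (0 < size lam)%N ->
  lam_ lam 1 = (n1%:R^-1, n1%:R^-1) ->
  exists e, [/\ (1 < n1)%N, (0 < e)%N, n = (n1 * e)%N, zeta (mk2 e e) != 0 &
    forall a, zeta a != 0 ->
      (e <= a i2_0)%N && (e <= a i2_1)%N \/
      exists2 b, a = b *+ n & b i2_0 = 0%N \/ b i2_1 = 0%N].
Proof.
move=> [lam0 _ exps level irr] g0 lam1.
have j1 : (0 < 1 <= size lam)%N by rewrite g0.
have n1_neq0 : n1%:R != 0 :> rat.
  by apply: contraNneq lam0 => E; rewrite lam1 E invr0.
have n1_gt0 : (0 < n1)%N by rewrite lt0n -(pnatr_eq0 rat).
have n1_gt1 : (1 < n1)%N.
  rewrite ltn_neqAle n1_gt0 andbT; apply/eqP => n1E; apply: (irr 1%N j1).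
  by rewrite /= -[nth _ _ _]/(lam_ lam 1) lam1 -n1E invr1 /= rpred1.
have [a aE za] := exps 1%N j1; move: aE; rewrite lam1 => -[a0 a1].
have n_neq0 : n%:R != 0 :> rat.
  by apply: contraNneq n1_neq0 => E; rewrite -invr_eq0 -a0 E invr0 mulr0.
have n_gt0 : (0 < n)%N by rewrite lt0n -(pnatr_eq0 rat).
have nE m : m%:R / n%:R = n1%:R^-1 :> rat -> n = (n1 * m)%N.
  move=> mE; have mE' : m%:R = n1%:R^-1 * n%:R :> rat by rewrite -mE mulfVK.
  by apply/eqP; rewrite -(eqr_nat rat) natrM mE' mulVKf.
have na0 := nE _ a0; have na1 := nE _ a1.
have aE : a = mk2 (a i2_0) (a i2_0).
  apply: midx2P; rewrite ?mk2_0 ?mk2_1 //.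
  by apply/eqP; rewrite -(eqn_pmul2l n1_gt0) -na1 -na0.
have e_gt0 : (0 < a i2_0)%N by move: n_gt0; rewrite na0 muln_gt0 => /andP[].
exists (a i2_0); split=> //; first by rewrite -aE.
move=> b zb; have [|nb] := boolP ((a i2_0 <= b i2_0) && (a i2_0 <= b i2_1))%N; first by left.
right; have : at_level lam 0 (frac_exponent n b).
  rewrite /at_level /Q2le /= !divr_ge0 ?ler0n // g0 /=.
  rewrite -[nth _ _ _]/(lam_ lam 1) lam1 /= -a0 !ler_pM2r ?invr_gt0 ?ltr0n //.
  by rewrite !ler_nat.
move/(level b zb) => /= /andP[/(frac_int_dvd n_gt0) d0 /(frac_int_dvd n_gt0) d1].
exists (mk2 (b i2_0 %/ n) (b i2_1 %/ n)).
  by apply: midx2P; rewrite mulrn_midxE ?mk2_0 ?mk2_1 mulnC divnK.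
rewrite mk2_0 mk2_1; move: nb; rewrite negb_and -!ltnNge.
have le_n : (a i2_0 <= n)%N by rewrite [leqRHS]na0 leq_pmull.
by case/orP => lt; [left|right]; rewrite divn_small // (leq_trans lt).
Qed.

(** Eliminating [S] leaves the comparison of [(n1 + 1) (e n1 + 1)] with [n1 (e (n1 + 1) + 1)], and
    the former is larger by exactly 1. *)
Lemma ratio_lct_contra (n1 e S v : nat) : (0 < v -> n1.+1 * v <= n1 * e * S ->
  S * (e * (e * n1).+1) <= (e * n1.+1).+1 * v -> False)%N.
Proof.
move=> v0 h1 h2.
have H1 : ((e * n1).+1 * (n1.+1 * v) <= (e * n1).+1 * (n1 * e * S))%N.
  by rewrite leq_mul2l h1 orbT.
have H2 : (n1 * (S * (e * (e * n1).+1)) <= n1 * ((e * n1.+1).+1 * v))%N.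
  by rewrite leq_mul2l h2 orbT.
have : ((e * n1).+1 * n1.+1 * v <= n1 * (e * n1.+1).+1 * v)%N by lia.
by rewrite leq_pmul2r //; lia.
Qed.

Theorem corollary4p32 (R : realType) (f : {poly mpser 2 R[i]})
    (zeta : mpser 2 R[i]) (lam : seq Q2) (n1 : nat)
    (f_weierstrass : weierstrass_poly f)
    (f_irreducible : conv_poly_irreducible f)
    (f_quasi_ordinary : quasi_ordinary f)
    (zeta_root : fractional_root f (size f).-1 zeta)
    (zeta_char : characteristic_exponents (size f).-1 zeta lam)
    (lam_lex : lex_normalized lam)
    (zeta_normalized : normalized_root lam)
    (g_gt1 : (1 < size lam)%N)
    (n1_index : lattice_index (M_ lam 1) (M_ lam 0) n1)
    (lam1 : lam_ lam 1 = (n1%:R^-1, n1%:R^-1)) :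
  ~ exists (u : 'I_3 -> mpser 3 R[i]) (w : midx 3) (v : nat),
      [/\ regular_parameters u, w != 0,
          monomial_value u w (mpser_of_poly f) v, (0 < v)%N
        & lct (mpser_of_poly f) = (w i3_0 + w i3_1 + w i3_2)%N%:R / v%:R].
Proof.
have [e [n1_gt1 e_gt0 nE zeta_e supp]] := first_exponent zeta_char (ltnW g_gt1) lam1.
have [h0 [gam [D [h00 gam0 fE]]]] := quasi_ordinary_normal_form f_weierstrass
  f_irreducible zeta_root (ltnW n1_gt1) e_gt0 nE supp zeta_e.
rewrite nE => D_size D_supp [u [w [v [ru _ uv v0 lctE]]]].
have ratio := monomial_ratio h00 gam0 n1_gt1 e_gt0 fE D_size D_supp ru uv.
apply: (ratio_lct_contra v0 ratio).
case: n1 e n1_gt1 e_gt0 fE D_size D_supp {nE zeta_e supp ratio lam1 n1_index}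
  => [|[|k']] // [|e'] // _ _ fE D_size D_supp.
have := lct_le h00 gam0 fE D_size D_supp; rewrite lctE.
rewrite ler_pdivrMr ?ltr0n // mulrAC ler_pdivlMr ?ltr0n //.
by rewrite -!natrM ler_nat.
Qed.
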